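(* Fix an integer $b\ge2$. For all $\beta\in(0,\beta_{\rm c})$ there exists $a>0$ such that $$\sup_{u\in\mathbb R}\,\inf_{r\in[-a,a]}\,\biggl|P_{n,\beta}\Bigl(\max_{x\in\Lambda_n}\varphi_x\le u\Bigr)-P'_{n,\beta}\Bigl(\max_{x\in\Lambda_n}\varphi'_x\le u+r\Bigr)\biggr|\ \xrightarrow[n\to\infty]{}\ 0.$$ In particular, for each $\beta\in(0,\beta_{\rm c})$, the maxima $\max_{x\in\Lambda_n}\varphi_x$ (under $P_{n,\beta}$) and $\max_{x\in\Lambda_n}\varphi'_x$ (under $P'_{n,\beta}$) can be coupled to within a bounded distance, with probability tending to one as $n\to\infty$; i.e., there exist $K>0$ and, for each $n\ge1$, a coupling of the two maxima under which the probability that they differ by at most $K$ tends to one as $n\to\infty$.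
   Context: Constants: $b\ge2$ is a fixed integer and $\beta_{\rm c}:=\frac{2\pi^2}{\log b}$. Hierarchical lattice: $\Lambda_n:=\{1,\dots,b\}^n$. For $x=(x_1,\dots,x_n)\in\Lambda_n$ and $k=1,\dots,n$ let $\mathcal B_k(x):=\{y\in\Lambda_n\colon y_i=x_i\text{ for all }i=1,\dots,n-k\}$ (a set of $b^k$ elements). The hierarchical Laplacian $\Delta_n$ acts on $f\colon\Lambda_n\to\mathbb R$ by $$\Delta_nf(x)=\sum_{k=1}^n\Bigl[\Bigl(\sum_{j=0}^{k-1}b^j\Bigr)^{-1}-\Bigl(\sum_{j=0}^{k}b^j\Bigr)^{-1}\Bigr]\frac1{b^k}\sum_{y\in\mathcal B_k(x)}[f(y)-f(x)]-\Bigl(\sum_{j=0}^nb^j\Bigr)^{-1}f(x);$$ it is symmetric and negative definite on $\ell^2(\Lambda_n)$. DG-model: for $\beta>0$, $P_{n,\beta}$ is the probability measure on $\varphi\in\mathbb Z^{\Lambda_n}$ proportional to $e^{\frac12\beta(\varphi,\Delta_n\varphi)}\prod_{x\in\Lambda_n}\#(d\varphi_x)$, where $(\cdot,\cdot)$ is the inner product in $\ell^2(\Lambda_n)$ and $\#$ is the counting measure on $\mathbb Z$. GFF: $P'_{n,\beta}$ is the probability measure on $\varphi'\in\mathbb R^{\Lambda_n}$ obtained by replacing the counting measure by the Lebesgue measure, i.e., proportional to $e^{\frac12\beta(\varphi',\Delta_n\varphi')}\prod_{x\in\Lambda_n}d\varphi'_x$. *)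

(* Defs.v *)
From HB Require Import structures.
From mathcomp Require Import all_boot all_order all_algebra.
From mathcomp Require Import all_classical all_reals all_analysis.
From mathcomp Require Import measurable_realfun.

Set Implicit Arguments.
Unset Strict Implicit.
Unset Printing Implicit Defensive.

Import Order.TTheory GRing.Theory Num.Theory.
Import numFieldNormedType.Exports.

Local Open Scope classical_set_scope.
Local Open Scope ring_scope.

(** The integers with the sigma-algebra of all subsets. *)
HB.instance Definition _ := isPointed.Build int 0.
HB.instance Definition _ := @isMeasurable.Build default_measure_display
  int discrete_measurable discrete_measurable0
  discrete_measurableC discrete_measurableU.

Lemma int_counting_sigma_finite (R : realType) :
  sigma_finite [set: int] (@counting int R).
Proof.
exists (fun k => [set z : int | (`|z| <= k)%N]).
  by apply/seteqP; split => // z _; exists `|z|%N => /=.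
move=> k; split => //=; rewrite /counting asboolT ?ltry//.
have -> : [set z : int | (`|z| <= k)%N] =
    [set (n : nat)%:Z | n in `I_k.+1] `|` [set - (n : nat)%:Z | n in `I_k.+1].
  apply/seteqP; split => [z /= zk|z /= [[n nk <-]|[n nk <-]]].
  - have [z0|z0] := leP 0 z; [left|right]; exists `|z|%N; rewrite ?ltnS//=.
      by rewrite gez0_abs.
    by rewrite ltz0_abs// opprK.
  - by rewrite absz_nat -ltnS.
  - by rewrite abszN absz_nat -ltnS.
by rewrite finite_setU; split; apply: finite_image; exact: finite_II.
Qed.

HB.instance Definition _ (R : realType) :=
  @Measure_isSigmaFinite.Build _ _ _ (@counting int R) (int_counting_sigma_finite R).

Section product_power.
Context d (T : measurableType d) (R : realType).

Definition cons_pair n (z : T * n.-tuple T) : n.+1.-tuple T :=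
  [tuple of z.1 :: z.2].

Lemma measurable_cons_pair n : measurable_fun [set: T * n.-tuple T] (@cons_pair n).
Proof. exact: measurable_cons. Qed.

HB.instance Definition _ n :=
  isMeasurableFun.Build _ _ _ _ (@cons_pair n) (@measurable_cons_pair n).

Section step.
Context (nu : {sigma_finite_measure set T -> \bar R}) (n : nat)
  (mu : {sigma_finite_measure set n.-tuple T -> \bar R}).

Definition cons_measure : set (n.+1.-tuple T) -> \bar R :=
  pushforward (nu \x mu)%E (@cons_pair n).

Let preimage_cons A : measurable A -> measurable (@cons_pair n @^-1` A).
Proof. by move=> mA; rewrite -[X in measurable X]setTI; exact: measurable_cons_pair. Qed.

Let cons_measure0 : cons_measure set0 = 0%E.
Proof. by rewrite /cons_measure /pushforward preimage_set0 measure0. Qed.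

Let cons_measure_ge0 A : (0 <= cons_measure A)%E.
Proof. exact: measure_ge0. Qed.

Let cons_measure_sigma_additive : semi_sigma_additive cons_measure.
Proof.
move=> F mF tF mUF; rewrite /cons_measure /pushforward preimage_bigcup.
apply: measure_semi_sigma_additive => [k||].
- exact: preimage_cons.
- apply/trivIsetP => i j _ _ ij; rewrite -preimage_setI.
  by move/trivIsetP : tF => /(_ _ _ _ _ ij) ->//; rewrite preimage_set0.
- by rewrite -preimage_bigcup; exact: preimage_cons.
Qed.

HB.instance Definition _ := isMeasure.Build _ _ _ cons_measure
  cons_measure0 cons_measure_ge0 cons_measure_sigma_additive.

Lemma cons_measure_sigma_finite : sigma_finite [set: n.+1.-tuple T] cons_measure.
Proof.
have /sigma_finiteP[F [FT ndF Foo]] := sigma_finiteT nu.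
have /sigma_finiteP[G [GT ndG Goo]] := sigma_finiteT mu.
pose u (t : n.+1.-tuple T) : T * n.-tuple T := (tnth t ord0, [tuple of behead t]).
have mu_ : measurable_fun [set: n.+1.-tuple T] u.
  apply/measurable_fun_pair; first exact: measurable_tnth.
  exact: measurable_behead.
have uK : cancel (@cons_pair n) u.
  by move=> [x t]; rewrite /u /cons_pair /=; congr pair; apply/val_inj.
exists (fun k => u @^-1` (F k `*` G k)) => [|k].
  apply/esym/seteqP; split => // t _.
  have [i _ Fi] : (\bigcup_i F i) (u t).1 by rewrite -FT.
  have [j _ Gj] : (\bigcup_j G j) (u t).2 by rewrite -GT.
  exists (maxn i j) => //; split.
  - by move: (u t).1 Fi; exact/subsetPset/ndF/leq_maxl.
  - by move: (u t).2 Gj; exact/subsetPset/ndG/leq_maxr.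
have [mF Fk] := Foo k; have [mG Gk] := Goo k.
split.
  rewrite -[X in measurable X]setTI; apply: mu_ => //.
  exact: measurableX.
rewrite /cons_measure /pushforward -comp_preimage.
have -> : u \o @cons_pair n = id by apply/funext => z /=; rewrite uK.
by rewrite preimage_id product_measure1E// lte_mul_pinfty// ge0_fin_numE.
Qed.

HB.instance Definition _ :=
  Measure_isSigmaFinite.Build _ _ _ cons_measure cons_measure_sigma_finite.

End step.

(** The [n]-fold product measure of [nu] on [n.-tuple T]. *)
Fixpoint product_power (nu : {sigma_finite_measure set T -> \bar R}) (n : nat) :
    {sigma_finite_measure set n.-tuple T -> \bar R} :=
  match n with
  | 0 => \d_ [tuple]
  | m.+1 => cons_measure nu (product_power nu m)
  end.

End product_power.

Section hierarchical_lattice.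
Context (b n : nat).

(** The coordinates range over [0, ..., b-1] instead of [1, ..., b], and
    [tnth x i] is the coordinate of index [i + 1]. *)
Definition lattice : finType := n.-tuple 'I_b.

Definition hball (k : nat) (x : lattice) : {set lattice} :=
  [set y : lattice | [forall i : 'I_n, (i < n - k)%N ==> (tnth y i == tnth x i)]].

Definition origin (b_gt1 : (1 < b)%N) : lattice :=
  [tuple of nseq n (Ordinal (ltnW b_gt1))].

Context (R : realType).
Implicit Types f g : lattice -> R.

Definition laplacian f (x : lattice) : R :=
  \sum_(1 <= k < n.+1)
     ((\sum_(0 <= j < k) b%:R ^+ j)^-1 - (\sum_(0 <= j < k.+1) b%:R ^+ j)^-1)
     * ((b%:R ^+ k)^-1 * \sum_(y in hball k x) (f y - f x))
  - (\sum_(0 <= j < n.+1) b%:R ^+ j)^-1 * f x.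

Definition inner f g : R := \sum_x f x * g x.

(** The seed of the iterated maximum is itself one of the values of [f]. *)
Definition field_max (b_gt1 : (1 < b)%N) f : R :=
  \big[Num.max/f (origin b_gt1)]_x f x.

End hierarchical_lattice.
Arguments laplacian {b n R} f x.
Arguments inner {b n R} f g.
Arguments field_max {b n R} b_gt1 f.

(** Random fields on the lattice whose spins take values in [T] and are read
    as real numbers through [spin : T -> R]. *)
Section gibbs_measure.
Context d (T : measurableType d) (R : realType) (spin : {mfun T >-> R}).
Context (b n : nat).

Definition config := #|lattice b n|.-tuple T.

HB.instance Definition _ := Measurable.on config.

Definition field (phi : config) (x : lattice b n) : R :=
  spin (tnth phi (enum_rank x)).

Lemma measurable_field x : measurable_fun [set: config] (field ^~ x).
Proof.
apply: (@measurableT_comp _ _ _ _ _ _ spin) => //.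
exact: (@measurable_tnth _ T _ (enum_rank x)).
Qed.

Definition config_max (b_gt1 : (1 < b)%N) (phi : config) : R :=
  field_max b_gt1 (field phi).

Lemma measurable_config_max b_gt1 :
  measurable_fun [set: config] (config_max b_gt1).
Proof.
rewrite /config_max /field_max; elim: (index_enum _) => [|x s ih].
  by under eq_fun do rewrite big_nil; exact: measurable_field.
under eq_fun do rewrite big_cons.
by apply: measurable_maxr => //; exact: measurable_field.
Qed.

HB.instance Definition _ b_gt1 :=
  isMeasurableFun.Build _ _ _ _ (config_max b_gt1) (measurable_config_max b_gt1).

Definition gibbs_weight (beta : R) (phi : config) : R :=
  expR (2^-1 * beta * inner (field phi) (laplacian (field phi))).

Lemma measurable_gibbs_weight beta :
  measurable_fun [set: config] (gibbs_weight beta).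
Proof.
apply: measurableT_comp => //; apply: measurable_funM => //.
apply: measurable_sum => x; apply: measurable_funM; first exact: measurable_field.
apply: measurable_funB; last first.
  by apply: measurable_funM => //; exact: measurable_field.
apply: measurable_sum => k; do 2 (apply: measurable_funM => //).
under eq_fun do rewrite big_mkcond.
apply: measurable_sum => y; case: (y \in hball k x) => //.
by apply: measurable_funB; exact: measurable_field.
Qed.

Context (nu : {sigma_finite_measure set T -> \bar R}) (beta : R).

Definition gibbs_unnormalized (A : set config) : \bar R :=
  (\int[product_power nu #|lattice b n|]_(phi in A) (gibbs_weight beta phi)%:E)%E.

Let gibbs_unnormalized0 : gibbs_unnormalized set0 = 0%E.
Proof. exact: integral_set0. Qed.

Let gibbs_unnormalized_ge0 A : (0 <= gibbs_unnormalized A)%E.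
Proof. by apply: integral_ge0 => phi _; rewrite lee_fin expR_ge0. Qed.

Let gibbs_unnormalized_sigma_additive : semi_sigma_additive gibbs_unnormalized.
Proof.
apply: semi_sigma_additive_nng_induced => [|phi]; last by rewrite lee_fin expR_ge0.
by apply/measurable_EFinP; exact: measurable_gibbs_weight.
Qed.

HB.instance Definition _ := isMeasure.Build _ _ _ gibbs_unnormalized
  gibbs_unnormalized0 gibbs_unnormalized_ge0 gibbs_unnormalized_sigma_additive.

(** The Dirac mass is the default value that [mnormalize] requires for measures
    of total mass [0] or [+oo]; it is not used for the two choices of [nu] below
    when [0 < beta], since [laplacian] is negative definite. *)
Definition gibbs : probability config R :=
  mnormalize gibbs_unnormalized \d_(point : config).

End gibbs_measure.
Arguments config {d} T b n.
Arguments field {d T R} spin {b n} phi x.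
Arguments config_max {d T R} spin {b n} b_gt1 phi.
Arguments gibbs {d T R} spin b n nu beta.

Section models.
Context (R : realType).

Definition int_spin (z : int) : R := z%:~R.

Lemma measurable_int_spin : measurable_fun [set: int] int_spin.
Proof. by []. Qed.

HB.instance Definition _ :=
  isMeasurableFun.Build _ _ _ _ int_spin measurable_int_spin.

Definition real_spin (t : measurableTypeR R) : R := t.

Lemma measurable_real_spin : measurable_fun [set: measurableTypeR R] real_spin.
Proof. exact: measurable_id. Qed.

HB.instance Definition _ :=
  isMeasurableFun.Build _ _ _ _ real_spin measurable_real_spin.

Context (b n : nat) (beta : R).

(** The measures P_{n,beta} on Z^Lambda_n and P'_{n,beta} on R^Lambda_n. *)
Definition DG : probability (config int b n) R :=
  gibbs int_spin b n (@counting int R) beta.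

Definition GFF : probability (config (measurableTypeR R) b n) R :=
  gibbs real_spin b n (@lebesgue_measure R) beta.

Definition DG_max (b_gt1 : (1 < b)%N) : {RV DG >-> R} :=
  config_max int_spin b_gt1.

Definition GFF_max (b_gt1 : (1 < b)%N) : {RV GFF >-> R} :=
  config_max real_spin b_gt1.

End models.
Arguments DG {R} b n beta.
Arguments GFF {R} b n beta.
Arguments DG_max {R b} n beta b_gt1.
Arguments GFF_max {R b} n beta b_gt1.

Definition beta_c (R : realType) (b : nat) : R := 2 * pi ^+ 2 / ln b%:R.

Definition coupling d1 d2 (T1 : measurableType d1) (T2 : measurableType d2)
    (R : realType) (P1 : probability T1 R) (P2 : probability T2 R)
    (Q : probability (T1 * T2)%type R) : Prop :=
  (forall A, measurable A -> Q (fst @^-1` A) = P1 A) /\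
  (forall A, measurable A -> Q (snd @^-1` A) = P2 A).

(* Main.v *)
Require Import Defs.
From HB Require Import structures.
From mathcomp Require Import all_boot all_order all_algebra.
From mathcomp Require Import all_classical all_reals all_analysis.
From mathcomp Require Import measurable_realfun.
From mathcomp Require Import ring lra.

Set Implicit Arguments.
Unset Strict Implicit.
Unset Printing Implicit Defensive.

Import Order.TTheory GRing.Theory Num.Theory.
Import numFieldNormedType.Exports.

Local Open Scope classical_set_scope.
Local Open Scope ring_scope.

(** Both fields are built on a [b]-ary tree: the Gaussian weight is the law of a
    branching random walk with centred Gaussian steps of variance [1 / beta],
    read at its leaves and smeared by one more Gaussian.  Hence the partition
    function, and its restriction to the event that the maximum is at most [u],
    are obtained from one leaf by iterating
    [rg f = Gaussian average of the b-th power of f].  For the DG-model the leaf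
    carries the [1]-periodic function [theta], and averaging multiplies
    the ratio of successive Fourier coefficients by at most
    [exp (- 2 pi^2 / beta)], while the [b]-th power multiplies it by at most [b].  The product of both factors is
    less than [1] precisely when [beta < beta_c], so the partition functions
    [v n] flatten: the ratio of their extreme values is [1 + O(q ^ n)] with
    [q < 1].

    The distribution function of the DG maximum, seen from a node of the tree,
    therefore obeys the recursion of the Gaussian one, except that at level [n]
    the Gaussian step is tilted by a density with extreme values of ratio
    [1 + O(q ^ n)].  Such a tilt moves a Gaussian variable, in the sense of
    stochastic domination, by at most [O(q ^ n)].  These shifts are summable,
    and the distribution functions satisfy [G (u - K) <= F u <= G (u + K)] for
    all [n] and [u].  Since [G] is continuous, [F u = G v] for some [v] within
    [K] of [u]; evaluating the two quantile functions at the same uniform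
    variable gives the coupling. *)

(** Two obstacles shape the argument. The tilt at a node depends on the field value there, so the
    shift that absorbs it must be uniform over all densities with a given ratio [rho] of extreme
    values, and over all half-lines, far tails included. Comparing odds [Phi / (1 - Phi)] instead of
    probabilities achieves this: such a tilt multiplies the odds of a half-line by at most [rho],
    whereas a translation multiplies them by a factor that grows linearly, whatever the half-line.
    Secondly, flatness must survive [b]-th powers. Ratios of neighbouring Fourier coefficients do so
    because they add up under convolution. They are manipulated only for finite trigonometric
    polynomials, stored as real polynomials; [theta] is a bounded limit of such polynomials, and
    only the resulting oscillation inequality, which is closed under limits, is carried over to it.
    That inequality is useful once [q ^ n] is small; at the finitely many lower levels any finite
    ratio of extreme values is enough, since it only enlarges the final constant. At a leaf, the
    integers are compared with the reals at the cost of a shift by [1], their spacing. *)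

Section density.
Context d (T : measurableType d) (R : realType).
Context (mu : {measure set T -> \bar R}) (nu : {measure set T -> \bar R}).
Variable g : T -> R.
Hypothesis mg : measurable_fun [set: T] g.
Hypothesis g_ge0 : forall x, 0 <= g x.
Hypothesis nuE : forall A, measurable A -> nu A = (\int[mu]_(x in A) (g x)%:E)%E.
Local Open Scope ereal_scope.
Import HBNNSimple.

(** True for simple functions by linearity, and then in general by monotone convergence on both
    sides. *)
Lemma ge0_integral_density (f : T -> \bar R) :
  measurable_fun [set: T] f -> (forall x, 0 <= f x) ->
  \int[nu]_x f x = \int[mu]_x (f x * (g x)%:E).
Proof.
move=> mf f0.
pose f_ := nnsfun_approx measurableT mf.
have f_f x : EFin \o f_ ^~ x @ \oo --> f x by exact: cvg_nnsfun_approx.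
have f_nd n m : (n <= m)%N -> forall x, (f_ n x <= f_ m x)%R.
  by move=> nm; exact/lefP/nd_nnsfun_approx.
transitivity (limn (fun n => \int[nu]_x (f_ n x)%:E)).
  rewrite -monotone_convergence//=; last 3 first.
  - by move=> n; apply/measurable_EFinP; exact: measurable_funP.
  - by move=> n x _; rewrite lee_fin.
  - by move=> x _ a b ab; rewrite lee_fin; exact: f_nd.
  by apply: eq_integral => x _; apply/esym/cvg_lim => //; exact: f_f.
transitivity (limn (fun n => \int[mu]_x ((f_ n x)%:E * (g x)%:E))); last first.
  rewrite -monotone_convergence//=; last 3 first.
  - move=> n; apply: emeasurable_funM; first by apply/measurable_EFinP.
    exact/measurable_EFinP.
  - by move=> n x _; rewrite -EFinM lee_fin mulr_ge0.
  - by move=> x _ a b ab; rewrite -!EFinM lee_fin ler_wpM2r// f_nd.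
  apply: eq_integral => x _; apply/cvg_lim => //.
  by apply: cvgeZr => //; exact: f_f.
congr (limn _); apply/funext => n.
have mI (y : R) : measurable_fun [set: T] (\1_(f_ n @^-1` [set y]) : T -> R).
  by apply/measurable_indicP; exact: measurable_sfunP.
have mE (y : R) : measurable_fun [set: T]
    (fun x => (y * \1_(f_ n @^-1` [set y]) x)%:E).
  by apply/measurable_EFinP; apply: measurable_funM => //; exact: mI.
rewrite (eq_integral (fun x => \sum_(y \in range (f_ n)) (y * \1_(f_ n @^-1` [set y]) x)%:E)); last first.
  by move=> x _; rewrite fimfunE -fsumEFin.
rewrite ge0_integral_fsum//; last by move=> y x _; exact: nnfun_muleindic_ge0.
rewrite [RHS](eq_integral (fun x => \sum_(y \in range (f_ n))
    ((y * \1_(f_ n @^-1` [set y]) x)%:E * (g x)%:E))); last first.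
  move=> x _; rewrite fimfunE -fsumEFin// -ge0_mule_fsuml// => y.
  by rewrite nnfun_muleindic_ge0.
rewrite ge0_integral_fsum//; last 2 first.
  - by move=> y; apply: emeasurable_funM => //; exact/measurable_EFinP.
  - by move=> y x _; apply: mule_ge0; rewrite ?nnfun_muleindic_ge0 ?lee_fin.
apply: eq_fsbigr => y; rewrite inE => -[z _ <-].
under eq_integral do rewrite EFinM.
rewrite ge0_integralZl//; [|by apply/measurable_EFinP; exact: mI|by rewrite lee_fin].
under [RHS]eq_integral do rewrite EFinM -muleA.
rewrite ge0_integralZl//; last 3 first.
  - by apply: emeasurable_funM; apply/measurable_EFinP => //; exact: mI.
  - by move=> x _; rewrite -EFinM lee_fin mulr_ge0.
  - by rewrite lee_fin.
congr (_ * _).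
rewrite integral_indic// setIT nuE; last exact: measurable_sfunP.
rewrite integral_mkcond; apply: eq_integral => x _.
by rewrite patchE indicE -EFinM; case: (_ \in _); rewrite ?mul1r ?mul0r.
Qed.

End density.

(** * Translations and reflections of Lebesgue integrals *)

Section lebesgue_translation.
Context (R : realType).
Local Notation mu := (@lebesgue_measure R).
Local Open Scope ereal_scope.

Lemma lebesgue_measure_shift (c : R) (A : set R) : measurable A ->
  mu ((+%R^~ c) @^-1` A) = mu A.
Proof.
move=> mA; pose s : measurableTypeR R -> measurableTypeR R := +%R^~ c.
have ms : measurable_fun [set: measurableTypeR R] s by exact: measurable_funD.
pose s' := mfun_Sub (mem_set ms).
rewrite [RHS](@lebesgue_measure_unique _ (pushforward mu s'))// => _ [[a b] _ <-] /=.
rewrite /pushforward.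
have -> : (s @^-1` [set` `]a, b]]) = [set` `]a - c, b - c]]%R.
  by apply/seteqP; split => x /=; rewrite !in_itv/= /s ltrBlDr lerBrDr.
rewrite !lebesgue_measure_itv/= !lte_fin ltrD2r; case: ifPn => // _.
by rewrite -!EFinB; congr EFin; ring.
Qed.

Lemma ge0_integral_lebesgue_shift (f : R -> \bar R) (c : R) :
  measurable_fun [set: R] f -> (forall x, 0 <= f x) ->
  \int[mu]_x f (x + c)%R = \int[mu]_x f x.
Proof.
move=> mf f0; pose s : measurableTypeR R -> measurableTypeR R := (+%R^~ c)%R.
have ms : measurable_fun [set: measurableTypeR R] s by exact: measurable_funD.
pose s' := mfun_Sub (mem_set ms).
transitivity (\int[pushforward mu s']_x f x).
  by rewrite ge0_integral_pushforward.
by apply: eq_measure_integral => A mA _; exact: lebesgue_measure_shift.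
Qed.

Lemma lebesgue_measure_opp (A : set R) : measurable A ->
  mu (-%R @^-1` A) = mu A.
Proof.
move=> mA; pose s : measurableTypeR R -> measurableTypeR R := -%R.
have ms : measurable_fun [set: measurableTypeR R] s by exact: measurable_funN.
pose s' := mfun_Sub (mem_set ms).
rewrite [RHS](@lebesgue_measure_unique _ (pushforward mu s'))// => _ [[a b] _ <-] /=.
rewrite /pushforward.
have -> : (s @^-1` [set` `]a, b]]) = [set` `[- b, - a[]%R.
  by apply/seteqP; split => x /=; rewrite !in_itv/= /s lerNl ltrNr andbC.
rewrite !lebesgue_measure_itv/= !lte_fin ltrN2; case: ifPn => // _.
by rewrite -!EFinB; congr EFin; ring.
Qed.

Lemma ge0_integral_lebesgue_opp (f : R -> \bar R) :
  measurable_fun [set: R] f -> (forall x, 0 <= f x) ->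
  \int[mu]_x f (- x)%R = \int[mu]_x f x.
Proof.
move=> mf f0; pose s : measurableTypeR R -> measurableTypeR R := -%R.
have ms : measurable_fun [set: measurableTypeR R] s by exact: measurable_funN.
pose s' := mfun_Sub (mem_set ms).
transitivity (\int[pushforward mu s']_x f x).
  by rewrite ge0_integral_pushforward.
by apply: eq_measure_integral => A mA _; exact: lebesgue_measure_opp.
Qed.

End lebesgue_translation.

(** * The centred Gaussian of variance [1 / beta] *)

Section gaussian.
Context (R : realType) (beta : R).
Hypothesis beta_gt0 : 0 < beta.
Local Notation mu := (@lebesgue_measure R).

Definition gw (x : R) : R := expR (- (beta / 2 * x ^+ 2)).

Definition gauss : probability (measurableTypeR R) R :=
  normal_prob 0 (Num.sqrt beta^-1).

Definition gauss_mass : R := (normal_peak (Num.sqrt beta^-1))^-1.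

Lemma gw_gt0 x : 0 < gw x. Proof. exact: expR_gt0. Qed.

Lemma gw_ge0 x : 0 <= gw x. Proof. exact: expR_ge0. Qed.

Lemma gw_le1 x : gw x <= 1.
Proof. by rewrite -expR0 ler_expR oppr_le0 mulr_ge0 ?sqr_ge0// divr_ge0// ltW. Qed.

Lemma gwN x : gw (- x) = gw x. Proof. by rewrite /gw sqrrN. Qed.

Lemma measurable_gw : measurable_fun [set: R] gw.
Proof.
apply: measurableT_comp => //; apply: measurable_funN.
by apply: measurable_funM => //; exact: measurable_funX.
Qed.

Let sd_neq0 : Num.sqrt beta^-1 != 0.
Proof. by rewrite gt_eqF// sqrtr_gt0 invr_gt0. Qed.

Lemma gauss_mass_gt0 : 0 < gauss_mass.
Proof. by rewrite invr_gt0 normal_peak_gt0. Qed.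

Lemma normal_pdf_gw x : normal_pdf 0 (Num.sqrt beta^-1) x = gw x / gauss_mass.
Proof.
rewrite /normal_pdf (negbTE sd_neq0) /gauss_mass invrK mulrC /normal_fun /gw subr0.
rewrite sqr_sqrtr ?invr_ge0 ?ltW//; congr (expR _ * _).
by field; rewrite gt_eqF.
Qed.

Lemma ge0_integral_gauss (f : R -> \bar R) :
  measurable_fun [set: R] f -> (forall x, 0 <= f x)%E ->
  (\int[gauss]_x f x = \int[mu]_x (f x * (gw x / gauss_mass)%:E))%E.
Proof.
move=> mf f0; apply: ge0_integral_density => //.
- by apply: measurable_funM => //; exact: measurable_gw.
- by move=> x; rewrite divr_ge0 ?gw_ge0// ltW// gauss_mass_gt0.
- move=> A mA; rewrite /gauss /= /normal_prob.
  by apply: eq_integral => x _; rewrite normal_pdf_gw.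
Qed.

Lemma integral_gw : (\int[mu]_x (gw x)%:E = gauss_mass%:E)%E.
Proof.
have := @integral_normal_pdf R 0 (Num.sqrt beta^-1).
under eq_integral do rewrite normal_pdf_gw mulrC EFinM.
rewrite ge0_integralZl//; last 3 first.
- by apply/measurable_EFinP; exact: measurable_gw.
- by move=> x _; rewrite lee_fin gw_ge0.
- by rewrite lee_fin invr_ge0 ltW// gauss_mass_gt0.
move=> /(congr1 (fun z => gauss_mass%:E * z)%E).
by rewrite muleA -EFinM divff ?gt_eqF ?gauss_mass_gt0// mul1e mule1.
Qed.

(** The Cameron-Martin formula: by completing the square, [gw x] is [gw (x + h)] times the
    exponential at [x + h], and Lebesgue measure is translation invariant. *)
Lemma ge0_gauss_shift (f : R -> \bar R) h :
  measurable_fun [set: R] f -> (forall x, 0 <= f x)%E ->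
  (\int[gauss]_x f (x + h)%R =
   \int[gauss]_x (f x * (expR (beta * h * x - beta / 2 * h ^+ 2))%:E))%E.
Proof.
move=> mf f0.
have mgw : measurable_fun [set: R] (fun x => (gw x / gauss_mass)%:E).
  by apply/measurable_EFinP; apply: measurable_funM => //; exact: measurable_gw.
have me : measurable_fun [set: R]
    (fun x => (expR (beta * h * x - beta / 2 * h ^+ 2))%:E).
  apply/measurable_EFinP; apply: measurableT_comp => //; exact: measurable_funB.
have gwm0 x : 0 <= gw x / gauss_mass by rewrite divr_ge0 ?gw_ge0// ltW// gauss_mass_gt0.
have mfs : measurable_fun [set: R] (fun x => f (x + h)).
  by apply: measurableT_comp => //; exact: measurable_funD.
rewrite [LHS]ge0_integral_gauss//.
rewrite [RHS]ge0_integral_gauss//; last 2 first.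
- exact: emeasurable_funM.
- by move=> x; rewrite mule_ge0// lee_fin expR_ge0.
rewrite -[RHS](ge0_integral_lebesgue_shift h).
- apply: eq_integral => x _; rewrite -muleA -EFinM mulrA; congr (_ * (_ / _)%:E)%E.
  by rewrite /gw -expRD; congr expR; field.
- by apply: emeasurable_funM => //; exact: emeasurable_funM.
- by move=> x; rewrite -muleA mule_ge0// -EFinM lee_fin mulr_ge0// expR_ge0.
Qed.

Lemma ge0_gauss_opp (f : R -> \bar R) :
  measurable_fun [set: R] f -> (forall x, 0 <= f x)%E ->
  (\int[gauss]_x f (- x)%R = \int[gauss]_x f x)%E.
Proof.
move=> mf f0; rewrite !ge0_integral_gauss//; last first.
  by apply: measurableT_comp => //; exact: measurable_funN.
rewrite -[RHS](@ge0_integral_lebesgue_opp _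
  (fun x => f x * (gw x / gauss_mass)%:E)%E).
- by apply: eq_integral => x _; rewrite gwN.
- apply: emeasurable_funM => //; apply/measurable_EFinP.
  by apply: measurable_funM => //; exact: measurable_gw.
- by move=> x; rewrite mule_ge0// lee_fin divr_ge0 ?gw_ge0// ltW// gauss_mass_gt0.
Qed.

Lemma gauss_exp_moment t :
  (\int[gauss]_x (expR (t * x))%:E = (expR (t ^+ 2 / (beta *+ 2)))%:E)%E.
Proof.
have h0 : beta != 0 by rewrite gt_eqF.
have mE : measurable_fun [set: R] (fun x => (expR (t * x))%:E).
  by apply/measurable_EFinP/measurableT_comp => //; exact: measurable_funM.
have e x : expR (t * x) = expR (t ^+ 2 / (beta *+ 2)) *
    expR (beta * (t / beta) * x - beta / 2 * (t / beta) ^+ 2).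
  by rewrite -expRD; congr expR; field.
have := @ge0_gauss_shift (cst 1%E) (t / beta) (@measurable_cst _ _ _ _ _ 1%E)
  (fun=> lee01).
under [X in _ = X -> _]eq_integral do rewrite mul1e.
rewrite integral_cst// mul1e [X in X = _ -> _](_ : _ = 1%E); last first.
  exact: (@probability_setT _ _ _ gauss).
move=> e1.
under eq_integral do rewrite e EFinM.
rewrite ge0_integralZl//; first by rewrite -e1 mule1.
- apply/measurable_EFinP; apply: measurableT_comp => //.
  exact: measurable_funB.
Qed.

End gaussian.

(** * Bounded measurable functions of a real variable *)

Section bounded_measurable.
Context (R : realType).
Implicit Types f g : R -> R.

(** This class is stable under sums, products, powers and Gaussian averages, and integrable for
    every probability measure, so that membership stands in for separate integrability proofs. *)
Definition bmeas f : Prop :=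
  measurable_fun [set: R] f /\ exists M, forall x, `|f x| <= M.

Lemma bmeas_cst c : bmeas (fun=> c).
Proof. by split; [exact: measurable_cst | exists `|c|]. Qed.

Lemma bmeasD f g : bmeas f -> bmeas g -> bmeas (fun x => f x + g x).
Proof.
move=> [mf [M fM]] [mg [N gN]]; split; first exact: measurable_funD.
by exists (M + N) => x; rewrite (le_trans (ler_normD _ _))// lerD.
Qed.

Lemma bmeasM f g : bmeas f -> bmeas g -> bmeas (fun x => f x * g x).
Proof.
move=> [mf [M fM]] [mg [N gN]]; split; first exact: measurable_funM.
by exists (M * N) => x; rewrite normrM ler_pM.
Qed.

Lemma bmeasZ c f : bmeas f -> bmeas (fun x => c * f x).
Proof. by move=> /(bmeasM (bmeas_cst c)). Qed.

Lemma bmeasN f : bmeas f -> bmeas (fun x => - f x).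
Proof. by move=> /(bmeasZ (-1)); under eq_fun do rewrite mulN1r. Qed.

Lemma bmeasB f g : bmeas f -> bmeas g -> bmeas (fun x => f x - g x).
Proof. by move=> bf /bmeasN; exact: bmeasD. Qed.

Lemma bmeasX n f : bmeas f -> bmeas (fun x => f x ^+ n).
Proof.
move=> bf; elim: n => [|n ih]; first exact: bmeas_cst.
by under eq_fun do rewrite exprS; exact: bmeasM.
Qed.

Lemma bmeas_sum I (s : seq I) (F : I -> R -> R) :
  (forall i, bmeas (F i)) -> bmeas (fun x => \sum_(i <- s) F i x).
Proof.
move=> bF; elim: s => [|i s ih].
  by under eq_fun do rewrite big_nil; exact: bmeas_cst.
by under eq_fun do rewrite big_cons; exact: bmeasD.
Qed.

Lemma bmeas_prod I (s : seq I) (F : I -> R -> R) :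
  (forall i, bmeas (F i)) -> bmeas (fun x => \prod_(i <- s) F i x).
Proof.
move=> bF; elim: s => [|i s ih].
  by under eq_fun do rewrite big_nil; exact: bmeas_cst.
by under eq_fun do rewrite big_cons; exact: bmeasM.
Qed.

Lemma bmeas_comp f (k : R -> R) :
  measurable_fun [set: R] k -> bmeas f -> bmeas (f \o k).
Proof.
move=> mk [mf [M fM]]; split; first exact: measurableT_comp.
by exists M => x; exact: fM.
Qed.

Lemma bmeas_shift c f : bmeas f -> bmeas (fun x => f (c + x)).
Proof. by apply: (@bmeas_comp _ (fun x => c + x)); exact: measurable_funD. Qed.

Lemma bmeas_cos c : bmeas (fun x => cos (c * x)).
Proof.
split; last by exists 1 => x; rewrite ler_norml cos_geN1 cos_le1.
apply: measurableT_comp; last exact: measurable_funM.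
by apply: continuous_measurable_fun; exact: continuous_cos.
Qed.

Lemma bmeas_sin c : bmeas (fun x => sin (c * x)).
Proof.
split; last by exists 1 => x; rewrite ler_norml sin_geN1 sin_le1.
apply: measurableT_comp; last exact: measurable_funM.
by apply: continuous_measurable_fun; exact: continuous_sin.
Qed.

Lemma bmeas_integrable (P : probability (measurableTypeR R) R) f :
  bmeas f -> P.-integrable [set: R] (EFin \o f).
Proof.
move=> [mf [M fM]]; apply: measurable_bounded_integrable => //.
- by apply: (@le_lt_trans _ _ 1%E); [exact: probability_le1|exact: ltry].
- by exists M; split; [exact: num_real | move=> N MN x _ /=; exact/(le_trans (fM _))/ltW].
Qed.

End bounded_measurable.
#[global] Hint Resolve bmeas_cst : core.

(** * Gaussian means and Gaussian smoothing *)

Section gaussian_mean.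
Context (R : realType) (beta : R).
Hypothesis beta_gt0 : 0 < beta.
Implicit Types f g : R -> R.
Local Notation gauss := (gauss beta).

Definition gmean f : R := (\int[gauss]_z f z)%R.

Lemma EFin_gmean f : bmeas f -> (gmean f)%:E = (\int[gauss]_z (f z)%:E)%E.
Proof.
move=> bf; rewrite /gmean /Rintegral fineK//.
by apply: integrable_fin_num => //; exact: bmeas_integrable.
Qed.

Lemma gmeanD f g : bmeas f -> bmeas g ->
  gmean (fun z => f z + g z) = gmean f + gmean g.
Proof. by move=> bf bg; apply: RintegralD => //; exact: bmeas_integrable. Qed.

Lemma gmeanZ c f : bmeas f -> gmean (fun z => c * f z) = c * gmean f.
Proof. by move=> bf; apply: RintegralZl => //; exact: bmeas_integrable. Qed.

Lemma gmean_cst c : gmean (fun=> c) = c.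
Proof.
rewrite /gmean Rintegral_cst// [X in fine X](_ : _ = 1%E) ?mulr1//.
exact: (@probability_setT _ _ _ gauss).
Qed.

Lemma gmean_sum I (s : seq I) (F : I -> R -> R) : (forall i, bmeas (F i)) ->
  gmean (fun z => \sum_(i <- s) F i z) = \sum_(i <- s) gmean (F i).
Proof.
move=> bF; elim: s => [|i s ih].
  rewrite big_nil -[RHS](gmean_cst 0); congr gmean.
  by apply/funext => z; rewrite big_nil.
rewrite big_cons -ih -gmeanD//; last exact: bmeas_sum.
by congr gmean; apply/funext => z; rewrite big_cons.
Qed.

Lemma gmean_le f g : bmeas f -> bmeas g -> (forall z, f z <= g z) ->
  gmean f <= gmean g.
Proof. by move=> bf bg fg; apply: le_Rintegral => //; exact: bmeas_integrable. Qed.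

Lemma gmean_ge0 f : (forall z, 0 <= f z) -> 0 <= gmean f.
Proof. by move=> f0; exact: Rintegral_ge0. Qed.

Lemma gmean_opp f : bmeas f -> (forall z, 0 <= f z) ->
  gmean (fun z => f (- z)) = gmean f.
Proof.
move=> bf f0; rewrite /gmean /Rintegral; congr fine.
rewrite -[RHS](@ge0_gauss_opp _ _ beta_gt0 (EFin \o f))//.
by apply/measurable_EFinP; case: bf.
Qed.

Definition avg f psi : R := gmean (fun z => f (psi + z)).

Lemma EFin_avg f psi : bmeas f ->
  (avg f psi)%:E = (\int[gauss]_z (f (psi + z))%:E)%E.
Proof. by move=> bf; rewrite EFin_gmean//; exact: bmeas_shift. Qed.

Lemma avgD f g psi : bmeas f -> bmeas g ->
  avg (fun z => f z + g z) psi = avg f psi + avg g psi.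
Proof. by move=> bf bg; rewrite /avg gmeanD//; exact: bmeas_shift. Qed.

Lemma avgZ c f psi : bmeas f -> avg (fun z => c * f z) psi = c * avg f psi.
Proof. by move=> bf; rewrite /avg gmeanZ//; exact: bmeas_shift. Qed.

Lemma avg_cst c psi : avg (fun=> c) psi = c.
Proof. exact: gmean_cst. Qed.

Lemma avg_le f g psi : bmeas f -> bmeas g -> (forall z, f z <= g z) ->
  avg f psi <= avg g psi.
Proof. by move=> bf bg fg; apply: gmean_le => //; exact: bmeas_shift. Qed.

Lemma avg_ge0 f psi : (forall z, 0 <= f z) -> 0 <= avg f psi.
Proof. by move=> f0; exact: gmean_ge0. Qed.

Lemma avg_shift f c psi : avg (fun z => f (z + c)) psi = avg f (psi + c).
Proof. by congr gmean; apply/funext => z; rewrite addrAC. Qed.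

Lemma bmeas_avg f : bmeas f -> bmeas (avg f).
Proof.
move=> bf; have [mf [M fM]] := bf; split; last first.
  exists M => psi; rewrite ler_norml; apply/andP; split.
    rewrite -(avg_cst (- M) psi); apply: avg_le => // z.
    by have := fM z; rewrite ler_norml => /andP[].
  rewrite -[leRHS](avg_cst M psi); apply: avg_le => // z.
  by have := fM z; rewrite ler_norml => /andP[].
(* Adding the bound [M] makes the integrand nonnegative, so that measurability follows from
   Tonelli. *)
have -> : avg f = (fun psi => avg (fun z => f z + M) psi - M).
  by apply/funext => psi; rewrite avgD// avg_cst addrK.
apply: measurable_funB => //; apply/measurable_EFinP.
rewrite (_ : _ \o _ = fun psi => \int[gauss]_z (f (psi + z) + M)%:E)%E; last first.
  by apply/funext => psi /=; rewrite EFin_avg//; exact: bmeasD.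
apply: (@measurable_fun_fubini_tonelli_F _ _ (measurableTypeR R)
  (measurableTypeR R) R gauss (fun x => (f (x.1 + x.2) + M)%:E)).
  apply/measurable_EFinP; apply: measurable_funD => //.
  by apply: measurableT_comp => //; exact: measurable_funD.
by move=> x; rewrite lee_fin -lerBlDr sub0r; have /ler_normlP[] := fM (x.1 + x.2); lra.
Qed.

End gaussian_mean.

(** * Fourier transform of the Gaussian *)

Section gaussian_characteristic_function.
Context (R : realType) (beta : R).
Hypothesis beta_gt0 : 0 < beta.
Local Notation gauss := (gauss beta).
Local Notation gmean := (gmean beta).
Local Notation avg := (avg beta).

Lemma is_derive_gmean (f df : R -> R -> R) (a : R) (G : R -> R) :
  (forall x, gauss.-integrable [set: R] (EFin \o f x)) ->
  (forall x y : R, is_derive x 1 (f ^~ y) (df x y)) ->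
  (forall y, 0 <= G y) -> gauss.-integrable [set: R] (EFin \o G) ->
  (forall x y, `|x - a| < 1 -> `|df x y| <= G y) ->
  is_derive a 1 (fun x => gmean (f x)) (gmean (df a)).
Proof.
move=> fi fd G0 Gi dfG.
have dE x y : partial1of2 f x y = df x y.
  by rewrite partial1of2E; exact: derive_val.
have H0 : (`]a - 1, a + 1[%classic : set R) a by rewrite /= in_itv/=; lra.
have H1 x y : (`]a - 1, a + 1[%classic : set R) x -> [set: R] y ->
  derivable (f ^~ y) x 1 by move=> _ _; have := fd x y => -[].
have H2 x y : (`]a - 1, a + 1[%classic : set R) x -> [set: R] y ->
    `|partial1of2 f x y| <= G y.
  rewrite /= in_itv/= => ax _; rewrite dE dfG//.
  by rewrite ltr_norml; lra.
have D := @derivable_under_integral R _ _ gauss f setT measurableT a _ _ H0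
  (fun x _ => fi x) H1 G G0 Gi H2.
have E := @differentiation_under_integral R _ _ gauss f setT measurableT a _ _ H0
  (fun x _ => fi x) H1 G G0 Gi H2.
apply: DeriveDef; first exact: D.
rewrite -derive1E E; apply: eq_Rintegral => y _; exact: dE.
Qed.

Lemma integrable_gauss_exp t :
  gauss.-integrable [set: R] (EFin \o (fun x : R => expR (t * x))).
Proof.
apply/integrableP; split.
  by apply/measurable_EFinP/measurableT_comp => //; exact: measurable_funM.
under eq_integral do rewrite /= ger0_norm ?expR_ge0//.
by rewrite gauss_exp_moment// ltry.
Qed.

Let cosh2 (c y : R) : expR (c * `|y|) <= expR (c * y) + expR (- c * y).
Proof.
have [y0|y0] := leP 0 y; first by rewrite ger0_norm// lerDl expR_ge0.
by rewrite ltr0_norm// mulrN -mulNr lerDr expR_ge0.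
Qed.

Let integrable_cosh2 k c : gauss.-integrable [set: R]
  (EFin \o (fun y : R => k * (expR (c * y) + expR (- c * y)))).
Proof.
rewrite (_ : _ \o _ = fun y => (k%:E * ((expR (c * y))%:E + (expR (- c * y))%:E))%E)//.
apply: integrableZl => //; apply: integrableD => //; exact: integrable_gauss_exp.
Qed.

Lemma gmean_sin s : gmean (fun z => sin (s * z)) = 0.
Proof.
have b1 : bmeas (fun z : R => 1 + sin (s * z)) by apply: bmeasD => //; exact: bmeas_sin.
have s0 z : 0 <= 1 + sin (s * z) by have := sin_geN1 (s * z); lra.
have /(_ s0) := @gmean_opp _ _ beta_gt0 _ b1.
have -> : (fun z => 1 + sin (s * - z)) = (fun z => 1 + (-1) * sin (s * z)).
  by apply/funext => z; rewrite mulrN sinN mulN1r.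
have bs := bmeas_sin s.
by rewrite !gmeanD ?gmeanZ//; [lra|exact: bmeasZ].
Qed.

(** Gaussian integration by parts. The mean of [sin (s * (z + h))] is differentiated at [h = 0] in
    two ways: the addition formula gives the left-hand side, the Cameron-Martin density of the shift
    by [h] gives the right-hand side. *)
Let stein s :
  s * gmean (fun z => cos (s * z)) = beta * gmean (fun z => z * sin (s * z)).
Proof.
pose f h z := sin (s * z) * expR (beta * h * z - beta / 2 * h ^+ 2).
pose df h z := sin (s * z) * (expR (beta * h * z - beta / 2 * h ^+ 2) *
   (beta * z - beta * h)).
have mf h : measurable_fun [set: R] (f h).
  apply: measurable_funM; first by have [] := bmeas_sin s.
  by apply: measurableT_comp => //; exact: measurable_funB.
have me h : gauss.-integrable [set: R]
    (EFin \o (fun z : R => expR (beta * h * z - beta / 2 * h ^+ 2))).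
  rewrite (_ : _ \o _ = fun z =>
      ((expR (- (beta / 2 * h ^+ 2)))%:E * (expR (beta * h * z))%:E)%E); last first.
    by apply/funext => z /=; rewrite -EFinM -expRD addrC.
  by apply: integrableZl => //; exact: integrable_gauss_exp.
have fi h : gauss.-integrable [set: R] (EFin \o f h).
  apply: (le_integrable measurableT _ _ (me h)) => /=.
    by apply/measurable_EFinP; exact: mf.
  move=> z _ /=; rewrite lee_fin normrM ler_piMl//.
  by rewrite ler_norml sin_geN1 sin_le1.
have fE h : gmean (f h) = sin (s * h) * gmean (fun z => cos (s * z)).
  (* The shift formula is for nonnegative functions, hence [1 + sin], with the [1] subtracted
     afterwards. *)
  have b1 : bmeas (fun z : R => 1 + sin (s * z)) by apply: bmeasD => //; exact: bmeas_sin.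
  have s0 z : 0 <= 1 + sin (s * z) by have := sin_geN1 (s * z); lra.
  transitivity (gmean (fun z => (1 + sin (s * (z + h))) - 1)); last first.
    transitivity (gmean (fun z => sin (s * h) * cos (s * z) +
        cos (s * h) * sin (s * z))).
      by congr gmean; apply/funext => z; rewrite mulrDr sinD; ring.
    rewrite gmeanD; [|by apply: bmeasZ; exact: bmeas_cos|by apply: bmeasZ; exact: bmeas_sin].
    rewrite !gmeanZ; [|exact: bmeas_sin|exact: bmeas_cos].
    by rewrite gmean_sin mulr0 addr0.
  have e0 : gmean (fun z => expR (beta * h * z - beta / 2 * h ^+ 2)) = 1.
    have := @ge0_gauss_shift _ _ beta_gt0 (cst 1%E) h
      (@measurable_cst _ _ _ _ _ 1%E) (fun=> lee01).
    under [X in _ = X -> _]eq_integral do rewrite mul1e.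
    rewrite integral_cst// mul1e [X in X = _ -> _](_ : _ = 1%E); last first.
      exact: (@probability_setT _ _ _ gauss).
    by rewrite /gmean /Rintegral => <-.
  rewrite (_ : (fun z => _ - 1) = (fun z => 1 + sin (s * (z + h)) + (- 1)))//.
  rewrite gmeanD//; last first.
    under eq_fun do rewrite addrC.
    apply: (@bmeas_comp _ (fun z => sin (s * z) + 1) (fun z => z + h)) => //.
      exact: measurable_funD.
    by under eq_fun do rewrite addrC.
  rewrite gmean_cst.
  have -> : gmean (fun z => 1 + sin (s * (z + h))) =
      gmean (fun z => (1 + sin (s * z)) * expR (beta * h * z - beta / 2 * h ^+ 2)).
    rewrite /gmean /Rintegral; congr fine.
    have /= -> := @ge0_gauss_shift _ _ beta_gt0 (fun z => (1 + sin (s * z))%:E) h => //.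
    by apply/measurable_EFinP; case: b1.
  under eq_fun do rewrite mulrDl mul1r.
  rewrite /gmean in e0 *; rewrite RintegralD//; last exact: fi.
  by rewrite e0 addrAC subrr add0r.
have D1 : is_derive (0 : R) 1 (fun h => gmean (f h)) (gmean (df 0)).
  (* For [|h| < 1] the density is at most [expR (beta * |y|)], and its logarithmic derivative in [h]
     at most [beta * (1 + |y|)], hence at most [beta * expR |y|]; the sum of two exponentials
     dominates [expR ((beta + 1) * |y|)]. *)
  apply: (@is_derive_gmean _ _ _ (fun y => beta * (expR ((beta + 1) * y) + expR (- (beta + 1) * y)))) => //.
  - by move=> h z; rewrite /f /df; apply: is_derive_eq; rewrite /GRing.scale/=; field.
  - by move=> y; rewrite mulr_ge0 ?(ltW beta_gt0)// addr_ge0// expR_ge0.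
  - move=> h z; rewrite subr0 => h1; rewrite /df !normrM.
    apply: (@le_trans _ _ (expR (beta * `|z|) * (beta * expR `|z|))); last first.
      by rewrite mulrCA -expRD ler_pM2l// -{2}[`|z|]mul1r -mulrDl cosh2.
    rewrite -[leRHS]mul1r ler_pM ?mulr_ge0//.
      by rewrite ler_norml sin_geN1 sin_le1.
    apply: ler_pM => //.
      rewrite ger0_norm ?expR_ge0// ler_expR.
      apply: (@le_trans _ _ (beta * h * z)).
        by rewrite gerDl oppr_le0 mulr_ge0 ?sqr_ge0// divr_ge0// ltW.
      rewrite -mulrA ler_pM2l// (le_trans (ler_norm _))// normrM.
      by rewrite ler_piMl// ltW.
    rewrite -mulrBr normrM gtr0_norm// ler_pM2l//.
    apply: (@le_trans _ _ (1 + `|z|)); last exact: expR_ge1Dx.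
    by rewrite (le_trans (ler_normB _ _))// addrC lerD2r ltW.
have D2 : is_derive (0 : R) 1 (fun h => gmean (f h))
    (s * gmean (fun z => cos (s * z))).
  under eq_fun do rewrite fE.
  by apply: is_derive_eq; rewrite /GRing.scale/= !mulr0 cos0; ring.
rewrite -(@derive_val _ _ _ _ _ _ _ D2) (@derive_val _ _ _ _ _ _ _ D1).
rewrite /gmean -RintegralZl//.
  apply: eq_Rintegral => z _; rewrite /df; rewrite !mulr0 !mul0r expr0n/= mulr0 subr0 expR0.
  by ring.
apply: (le_integrable measurableT _ _ (integrable_cosh2 1 1)).
  apply/measurable_EFinP; apply: measurable_funM => //; by have [] := bmeas_sin s.
move=> z _ /=; rewrite lee_fin mul1r [leRHS]ger0_norm ?addr_ge0 ?expR_ge0//.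
apply: le_trans (cosh2 1 z); rewrite normrM mul1r.
apply: (@le_trans _ _ `|z|); last by have := expR_ge1Dx `|z|; lra.
by rewrite ler_piMr// ler_norml sin_geN1 sin_le1.
Qed.

(** [stein] turns the derivative of the mean into [- (s / beta)] times the mean, a linear
    differential equation whose solution is [1] at [s = 0]. *)
Lemma gmean_cos s : gmean (fun z => cos (s * z)) = expR (- (s ^+ 2 / (beta *+ 2))).
Proof.
pose F s := gmean (fun z => cos (s * z)).
have dF (t : R) : is_derive t 1 F (- gmean (fun z => z * sin (t * z))).
  have := @is_derive_gmean (fun t z => cos (t * z)) (fun t z => - (z * sin (t * z))) t
    (fun y => 1 * (expR (1 * y) + expR (- 1 * y))).
  rewrite (_ : gmean (fun z => - _) = - gmean (fun z => z * sin (t * z))); last first.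
    rewrite /gmean -[RHS]mulN1r -RintegralZl//.
      by apply: eq_Rintegral => z _; rewrite mulN1r.
    apply: (le_integrable measurableT _ _ (integrable_cosh2 1 1)).
      by apply/measurable_EFinP; apply: measurable_funM => //; case: (bmeas_sin t).
    move=> z _ /=; rewrite lee_fin mul1r [leRHS]ger0_norm ?addr_ge0 ?expR_ge0//.
    apply: le_trans (cosh2 1 z); rewrite normrM mul1r.
    apply: (@le_trans _ _ `|z|); last by have := expR_ge1Dx `|z|; lra.
    by rewrite ler_piMr// ler_norml sin_geN1 sin_le1.
  apply => //.
  - by move=> x; apply: bmeas_integrable; exact: bmeas_cos.
  - by move=> x y; apply: is_derive_eq; rewrite /GRing.scale/=; ring.
  - move=> x z _; rewrite mul1r; apply: le_trans (cosh2 1 z); rewrite normrN normrM mul1r.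
    apply: (@le_trans _ _ `|z|); last by have := expR_ge1Dx `|z|; lra.
    by rewrite ler_piMr// ler_norml sin_geN1 sin_le1.
have b0 : beta != 0 by rewrite gt_eqF.
have dG (t : R) : is_derive t 1 (fun t => F t * expR (t ^+ 2 / (beta *+ 2))) 0.
  have S := stein t.
  have SF : gmean (fun z => z * sin (t * z)) = t / beta * F t.
    by apply: (mulfI b0); rewrite -S /F; field.
  have := dF t; rewrite SF => dFt.
  apply: is_derive_eq; rewrite /GRing.scale/=; field.
  exact: b0.
have := @is_derive_0_is_cst R (fun t => F t * expR (t ^+ 2 / (beta *+ 2))) s 0 dG.
rewrite expr0n/= mul0r expR0 mulr1 {2}/F.
under [X in _ = gmean X -> _]eq_fun do rewrite mul0r cos0.
rewrite gmean_cst => h.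
by rewrite expRN -[RHS]mul1r -h mulfK// gt_eqF// expR_gt0.
Qed.

Lemma avg_cos s psi : avg (fun z => cos (s * z)) psi =
  cos (s * psi) * expR (- (s ^+ 2 / (beta *+ 2))).
Proof.
rewrite -gmean_cos /avg -gmeanZ; last exact: bmeas_cos.
have -> : (fun z => cos (s * (psi + z))) =
    (fun z => cos (s * psi) * cos (s * z) + (- sin (s * psi)) * sin (s * z)).
  by apply/funext => z; rewrite mulrDr cosD mulNr.
rewrite gmeanD; [|by apply: bmeasZ; exact: bmeas_cos|by apply: bmeasZ; exact: bmeas_sin].
by rewrite [X in _ + X]gmeanZ ?gmean_sin ?mulr0 ?addr0//; exact: bmeas_sin.
Qed.

Lemma avg_sin s psi : avg (fun z => sin (s * z)) psi =
  sin (s * psi) * expR (- (s ^+ 2 / (beta *+ 2))).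
Proof.
rewrite -gmean_cos /avg -gmeanZ; last exact: bmeas_cos.
have -> : (fun z => sin (s * (psi + z))) =
    (fun z => sin (s * psi) * cos (s * z) + cos (s * psi) * sin (s * z)).
  by apply/funext => z; rewrite mulrDr sinD.
rewrite gmeanD; [|by apply: bmeasZ; exact: bmeas_cos|by apply: bmeasZ; exact: bmeas_sin].
by rewrite [X in _ + X]gmeanZ ?gmean_sin ?mulr0 ?addr0//; exact: bmeas_sin.
Qed.

End gaussian_characteristic_function.

(** * Gaussian odds under small translations *)

Section gaussian_domination.
Context (R : realType) (beta : R).
Hypothesis beta_gt0 : 0 < beta.
Local Notation mu := (@lebesgue_measure R).
Local Notation gmean := (gmean beta).

Lemma bmeas_indic (A : set R) : measurable A -> bmeas (\1_A : R -> R).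
Proof.
move=> mA; split; first exact: measurable_indic.
by exists 1 => x; rewrite indicE; case: (_ \in _); rewrite ?normr1 ?normr0.
Qed.

Lemma bmeas_indicM (A : set R) (h : R -> R) : measurable A -> bmeas h ->
  bmeas (fun x => h x * \1_A x).
Proof. by move=> mA bh; apply: bmeasM => //; exact: bmeas_indic. Qed.

Definition Phi (s : R) : R := gmean \1_`]-oo, s].

Lemma Phi_ge0 s : 0 <= Phi s.
Proof. by apply: gmean_ge0 => x; rewrite indicE. Qed.

Lemma Phi_le1 s : Phi s <= 1.
Proof.
rewrite -(gmean_cst beta 1); by apply: gmean_le => //; exact: bmeas_indic.
Qed.

Lemma PhiB a c : a <= c -> Phi c - Phi a = gmean \1_`]a, c].
Proof.
move=> ac; apply/eqP; rewrite subr_eq addrC -gmeanD; [|exact: bmeas_indic..].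
apply/eqP; congr gmean; apply/funext => x; rewrite !indicE !mem_setE !in_itv/=.
by have [xa|xa] := leP x a; rewrite /= ?add0r// (le_trans xa ac) addr0.
Qed.

Lemma Phi_mono a c : a <= c -> Phi a <= Phi c.
Proof.
by move=> ac; rewrite -subr_ge0 PhiB//; apply: gmean_ge0 => x; rewrite indicE.
Qed.

Lemma gmean_itv a c : (gmean \1_`]a, c])%:E =
  (\int[mu]_(x in `]a, c]) (gw beta x / gauss_mass beta)%:E)%E.
Proof.
rewrite EFin_gmean//; last exact: bmeas_indic.
rewrite ge0_integral_gauss//; last first.
  by apply/measurable_EFinP; exact: measurable_indic.
rewrite [RHS]integral_mkcond; apply: eq_integral => x _.
by rewrite patchE indicE; case: ifPn => _; rewrite ?mul1e ?mul0e.
Qed.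

Lemma PhiB_ge a c m : a <= c -> (forall x, a < x <= c -> m <= gw beta x) -> 0 <= m ->
  m / gauss_mass beta * (c - a) <= Phi c - Phi a.
Proof.
move=> ac mx m0; rewrite -lee_fin PhiB// gmean_itv.
have M0 : 0 <= (gauss_mass beta)^-1 by rewrite invr_ge0 ltW// gauss_mass_gt0.
have -> : (m / gauss_mass beta * (c - a))%:E =
    (\int[mu]_(x in `]a, c]) (m / gauss_mass beta)%:E)%E.
  rewrite integral_cst//= lebesgue_measure_itv/= lte_fin.
  move: ac; rewrite le_eqVlt => /orP[/eqP->|->]; last by rewrite -EFinB -EFinM.
  by rewrite ltxx subrr mulr0 mule0.
apply: ge0_le_integral => //.
- by move=> x _; rewrite lee_fin mulr_ge0.
- apply/measurable_EFinP; apply: measurable_funM => //.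
  by apply: measurable_funTS; exact: measurable_gw.
- by move=> x; rewrite /= in_itv/= => /mx ?; rewrite lee_fin ler_wpM2r.
Qed.

Lemma PhiB_le a c m : a <= c -> (forall x, a < x <= c -> gw beta x <= m) ->
  Phi c - Phi a <= m / gauss_mass beta * (c - a).
Proof.
move=> ac mx; rewrite -lee_fin PhiB// gmean_itv.
have M0 : 0 <= (gauss_mass beta)^-1 by rewrite invr_ge0 ltW// gauss_mass_gt0.
have -> : (m / gauss_mass beta * (c - a))%:E =
    (\int[mu]_(x in `]a, c]) (m / gauss_mass beta)%:E)%E.
  rewrite integral_cst//= lebesgue_measure_itv/= lte_fin.
  move: ac; rewrite le_eqVlt => /orP[/eqP->|->]; last by rewrite -EFinB -EFinM.
  by rewrite ltxx subrr mulr0 mule0.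
apply: ge0_le_integral => //.
- by move=> x _; rewrite lee_fin mulr_ge0// gw_ge0.
- apply/measurable_EFinP; apply: measurable_funM => //.
  by apply: measurable_funTS; exact: measurable_gw.
- by move=> x; rewrite /= in_itv/= => /mx ?; rewrite lee_fin ler_wpM2r.
Qed.

Lemma Phi_lipschitz a c : a <= c -> Phi c - Phi a <= (c - a) / gauss_mass beta.
Proof.
move=> ac; rewrite mulrC -[X in X * _]mul1r; apply: PhiB_le => // x _.
exact: gw_le1.
Qed.

Lemma PhiC s : 1 - Phi s = gmean \1_`]s, +oo[.
Proof.
apply/eqP; rewrite subr_eq -gmeanD; [|exact: bmeas_indic..].
rewrite -[X in X == _](gmean_cst beta 1); apply/eqP; congr gmean.
apply/funext => x; rewrite !indicE !mem_setE !in_itv/= andbT.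
by case: ltP => _; rewrite ?addr0 ?add0r.
Qed.

(** Reflection exchanges the two half-lines up to the endpoint [- s], a null set. *)
Lemma Phi_opp s : Phi (- s) = 1 - Phi s.
Proof.
have b1 : bmeas (\1_`]s, +oo[ : R -> R) by exact: bmeas_indic.
rewrite PhiC -(gmean_opp beta_gt0 b1)//.
rewrite /gmean /Rintegral; congr fine.
apply: ae_eq_integral => //.
- by apply/measurable_EFinP; exact: measurable_indic.
- apply/measurable_EFinP; apply: measurableT_comp; last exact: measurable_funN.
  exact: measurable_indic.
exists [set - s]; split => //.
  have /null_content_dominatesP := normal_prob_dominates 0 (Num.sqrt beta^-1).
  by apply => //; exact: lebesgue_measure_set1.
move=> x /= h; apply: contra_notP h => xs _; congr EFin.
rewrite !indicE !mem_setE !in_itv/= andbT ltrNr lt_neqAle.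
by have /eqP -> := xs.
Qed.

Lemma Phi_lt1 s : Phi s < 1.
Proof.
apply: (@lt_le_trans _ _ (Phi (s + 1))); last exact: Phi_le1.
rewrite -subr_gt0; pose m := gw beta (`|s| + 1).
apply: (@lt_le_trans _ _ (m / gauss_mass beta * (s + 1 - s))).
  by rewrite addrAC subrr add0r mulr1 divr_gt0// ?gauss_mass_gt0// gw_gt0.
apply: PhiB_ge; [lra| |exact: gw_ge0].
move=> x sx; rewrite ler_expR lerN2 ler_pM2l ?divr_gt0//.
have s1 := ler_norm s; have s2 : - s <= `|s| by rewrite -normrN ler_norm.
rewrite -(real_normK (num_real x)) lerXn2r ?nnegrE ?addr_ge0// ler_norml.
by lra.
Qed.

Let r := expR (- (beta / 2)).

Let r_lt1 : r < 1.
Proof. by rewrite -expR0 ltr_expR oppr_lt0 divr_gt0. Qed.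

(** After a shift by [-1] the Cameron-Martin density is [expR (- beta * x - beta / 2)], at most [r]
    on the half-line, where [x > s >= 0]. *)
Let tail_shift s : 0 <= s -> 1 - Phi (s + 1) <= r * (1 - Phi s).
Proof.
move=> s0; rewrite !PhiC -gmeanZ; last exact: bmeas_indic.
rewrite -lee_fin !EFin_gmean; [|exact/bmeasZ/bmeas_indic|exact: bmeas_indic].
have := @ge0_gauss_shift _ _ beta_gt0 (EFin \o \1_`]s, +oo[) (-1).
rewrite (_ : (fun x => _) = (fun x : R => (\1_`]s + 1, +oo[ x)%:E)); last first.
  by apply/funext => x /=; rewrite !indicE !mem_setE !in_itv/= !andbT ltrBrDr.
move=> ->; [|by apply/measurable_EFinP; exact: measurable_indic
  |by move=> x; rewrite lee_fin indicE].
have mi : measurable_fun [set: R] (\1_`]s, +oo[ : R -> R) by exact: measurable_indic.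
apply: ge0_le_integral => //.
- by move=> x _; rewrite -EFinM lee_fin mulr_ge0 ?expR_ge0// indicE.
- apply/measurable_EFinP; apply: measurable_funM => //.
  by apply: measurableT_comp => //; exact: measurable_funB.
- by apply/measurable_EFinP; exact: measurable_funM.
- move=> x _; rewrite -EFinM lee_fin mulrC !indicE mem_setE in_itv/= andbT.
  case: ltP => sx; rewrite ?mulr0// !mulr1 ler_expR.
  rewrite sqrrN expr1n mulr1 mulrN1.
  have : 0 <= beta * x by rewrite mulr_ge0 ?(ltW beta_gt0)// ltW// (le_lt_trans s0).
  by lra.
Qed.

(** On the positive half-line the Gaussian density decreases, so the increment over a length
    [d <= 1] is at least [d] times the increment over length [1]; [tail_shift] bounds the latter
    from below. *)
Let Phi_increment_ge s d : 0 <= s -> 0 <= d <= 1 ->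
  d * (1 - r) * (1 - Phi s) <= Phi (s + d) - Phi s.
Proof.
move=> s0 d01; have T1 := tail_shift s0.
have M0 := gauss_mass_gt0 beta_gt0.
have gwd x y : 0 <= x <= y -> gw beta y <= gw beta x.
  move=> xy; rewrite ler_expR lerN2 ler_pM2l ?divr_gt0// lerXn2r ?nnegrE//; lra.
have h1 : gw beta (s + d) / gauss_mass beta * d <= Phi (s + d) - Phi s.
  rewrite [X in _ * X](_ : d = s + d - s); last by ring.
  apply: PhiB_ge; [lra| |exact: gw_ge0] => x xs; apply: gwd; lra.
have h2 : Phi (s + 1) - Phi (s + d) <= gw beta (s + d) / gauss_mass beta * (1 - d).
  rewrite [X in _ * X](_ : 1 - d = s + 1 - (s + d)); last by ring.
  apply: PhiB_le; first lra.
  by move=> x xs; apply: gwd; lra.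
set g := gw _ _ / _ in h1 h2.
have : d * (Phi (s + 1) - Phi s) <= Phi (s + d) - Phi s by nra.
by nra.
Qed.

(* Moving by [d] multiplies the odds [Phi / (1 - Phi)] by at least
   [1 + hazard * d]: this is what absorbs a density of ratio [1 + C] between
   its extreme values into a translation by [C / hazard]. *)
Definition hazard : R := Num.min (1 - r) (gw beta 1 / gauss_mass beta).

Lemma hazard_gt0 : 0 < hazard.
Proof.
by rewrite lt_min subr_gt0 r_lt1 divr_gt0// ?gw_gt0// gauss_mass_gt0.
Qed.

(** Three positions of the interval from [s] to [s + d]: to the right of [0], where the tail decays;
    to the left of [0], by reflection; or around [0], and then inside [[-1, 1]], where the density
    is at least [gw 1 / gauss_mass]. The two terms of the minimum [hazard] serve these cases. *)
Lemma Phi_odds_small s d : 0 <= d <= 1 ->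
  (1 + hazard * d) * (Phi s * (1 - Phi (s + d))) <= Phi (s + d) * (1 - Phi s).
Proof.
move=> d01; suff : hazard * d * (Phi s * (1 - Phi (s + d))) <= Phi (s + d) - Phi s by lra.
have P0 := Phi_ge0 s; have P1 := Phi_le1 s.
have Q0 := Phi_ge0 (s + d); have Q1 := Phi_le1 (s + d).
have H0 := hazard_gt0.
have PQ : Phi s <= Phi (s + d) by apply: Phi_mono; lra.
have c1 : hazard <= 1 - r by rewrite /hazard ge_min lexx.
have c2 : hazard <= gw beta 1 / gauss_mass beta by rewrite /hazard ge_min lexx orbT.
have [s0|s0] := leP 0 s.
  have := Phi_increment_ge s0 d01.
  apply: le_trans.
  apply: (@le_trans _ _ (d * hazard * (1 - Phi s))); last first.
    by rewrite ler_wpM2r ?subr_ge0// ler_wpM2l; lra.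
  rewrite [hazard * d]mulrC ler_wpM2l ?mulr_ge0//; [lra..|nra].
have [sd0|sd0] := leP (s + d) 0.
  have sd0' : 0 <= - (s + d) by lra.
  have := Phi_increment_ge sd0' d01.
  rewrite !Phi_opp (_ : - (s + d) + d = - s) ?Phi_opp; last by ring.
  rewrite (_ : 1 - Phi s - (1 - Phi (s + d)) = Phi (s + d) - Phi s); last by ring.
  rewrite opprB addrCA subrr addr0.
  apply: le_trans.
  apply: (@le_trans _ _ (d * hazard * Phi (s + d))); last first.
    by rewrite ler_wpM2r// ler_wpM2l; lra.
  rewrite [hazard * d]mulrC ler_wpM2l ?mulr_ge0//; [lra..|nra].
apply: (@le_trans _ _ (gw beta 1 / gauss_mass beta * (s + d - s))); last first.
  apply: PhiB_ge; [lra| |exact: gw_ge0] => x xs.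
  rewrite ler_expR lerN2 ler_pM2l ?divr_gt0//.
  have x1 : 0 <= (1 - x) * (1 + x) by apply: mulr_ge0; lra.
  by rewrite expr1n; nra.
have h1 : hazard * d <= gw beta 1 / gauss_mass beta * d by rewrite ler_wpM2r//; lra.
have h2 : Phi s * (1 - Phi (s + d)) <= 1 by apply: mulr_ile1; lra.
rewrite (_ : s + d - s = d); last by ring.
apply: le_trans h1; rewrite -[leRHS]mulr1 ler_wpM2l// mulr_ge0//; lra.
Qed.

End gaussian_domination.

(** * Replacing a tilt of the Gaussian by a translation *)

Section gaussian_domination_monotone.
Context (R : realType) (beta : R).
Hypothesis beta_gt0 : 0 < beta.
Local Notation mu := (@lebesgue_measure R).
Local Notation gauss := (gauss beta).
Local Notation gmean := (gmean beta).
Local Notation Phi := (Phi beta).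
Local Notation hazard := (hazard beta).

Lemma indic_le (A B : set R) x : (A x -> B x) -> \1_A x <= \1_B x :> R.
Proof.
move=> AB; rewrite !indicE; case: (boolP (x \in A)) => //.
by rewrite inE => /AB Bx; rewrite mem_set.
Qed.

Lemma Phi_gt0 s : 0 < Phi s.
Proof. by have := Phi_lt1 beta_gt0 (- s); rewrite Phi_opp//; lra. Qed.

(** The odds gains of successive steps of length at most [1] multiply, and
    [(1 + hazard * (d - 1)) * (1 + hazard)] is at least [1 + hazard * d]. *)
Lemma Phi_odds s d : 0 <= d ->
  (1 + hazard * d) * (Phi s * (1 - Phi (s + d))) <= Phi (s + d) * (1 - Phi s).
Proof.
move=> d0; have [n dn] : exists n : nat, d <= n%:R.
  by exists (Num.bound d); apply/ltW/archi_boundP.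
elim: n s d d0 dn => [|n ih] s d d0 dn.
  by apply: Phi_odds_small => //; lra.
have [d1|d1] := leP d 1; first by apply: Phi_odds_small => //; lra.
have H0 := hazard_gt0 beta_gt0.
have IH : (1 + hazard * (d - 1)) * (Phi s * (1 - Phi (s + (d - 1))))
    <= Phi (s + (d - 1)) * (1 - Phi s).
  by apply: ih; rewrite ?lerBlDr -?natr1//; lra.
have := @Phi_odds_small _ _ beta_gt0 (s + (d - 1)) 1.
rewrite (_ : s + (d - 1) + 1 = s + d); last by ring.
rewrite mulr1 => /(_ _)/wrap[|S]; first by lra.
move: IH S; set A := Phi s; set B := Phi (s + (d - 1)); set C := Phi (s + d) => IH S.
have A0 : 0 < A by exact: Phi_gt0.
have B0 : 0 < B by exact: Phi_gt0.
have C0 : 0 < C by exact: Phi_gt0.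
have A1 : A < 1 by exact: Phi_lt1.
have B1 : B < 1 by exact: Phi_lt1.
have C1 : C < 1 by exact: Phi_lt1.
(* The two odds inequalities share the intermediate point; multiplying by [B * (1 - B)] clears its
   odds. *)
have BB : 0 < B * (1 - B) by rewrite mulr_gt0// subr_gt0.
rewrite -(ler_pM2r BB).
apply: (@le_trans _ _ ((B * (1 - A)) * (C * (1 - B)))); last first.
  by rewrite le_eqVlt; apply/orP; left; apply/eqP; ring.
apply: le_trans (ler_pM _ _ IH S).
- rewrite [leRHS](_ : _ = (1 + hazard * (d - 1)) * (1 + hazard) *
    (A * (1 - C)) * (B * (1 - B))); last by ring.
  rewrite ler_wpM2r ?(ltW BB)// ler_wpM2r ?mulr_ge0 ?(ltW A0)//; first by lra.
  have : 0 <= hazard * (hazard * (d - 1)) by rewrite !mulr_ge0//; lra.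
  by lra.
- rewrite !mulr_ge0//; [|lra|lra].
  have : 0 <= hazard * (d - 1) by rewrite mulr_ge0//; lra.
  by lra.
- by rewrite !mulr_ge0//; lra.
Qed.

(** The Gaussian has no atom. This is needed because a down-set need not contain its supremum. *)
Lemma Phi_open s : gmean \1_`]-oo, s[ = Phi s.
Proof.
rewrite -[in RHS](opprK s) Phi_opp//.
have b1 : bmeas (\1_`]-oo, - s] : R -> R) by exact: bmeas_indic.
have -> : Phi (- s) = gmean (fun x => \1_`]-oo, - s] (- x)) by rewrite gmean_opp.
rewrite -[X in X - _](gmean_cst beta 1).
have b2 : bmeas (fun x : R => \1_`]-oo, - s] (- x) : R).
  by apply: (@bmeas_comp _ _ -%R) b1; exact: measurable_funN.
rewrite -[X in _ - X]mul1r -mulNr -gmeanZ// -gmeanD//; last exact: bmeasZ.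
congr gmean; apply/funext => x; rewrite !indicE !mem_setE !in_itv/= lerN2 mulN1r.
by case: ltP; rewrite ?subr0 ?subrr.
Qed.

(** Chosen so that [1 + hazard * domination_shift rho = rho]. *)
Definition domination_shift (rho : R) : R := (rho - 1) / hazard.

Lemma domination_shift_ge0 rho : 1 <= rho -> 0 <= domination_shift rho.
Proof. by move=> h; rewrite divr_ge0 ?subr_ge0// ltW// hazard_gt0. Qed.

Section domination.
Variables (h : R -> R) (rho : R).
Hypotheses (bh : bmeas h) (h_ge0 : forall x, 0 <= h x).
Hypotheses (h_rho : forall x y, h x <= rho * h y) (rho_ge1 : 1 <= rho).
Let delta := domination_shift rho.

(** The tilted mass [a] of the half-line is at most [rho * h y * Phi s] for every [y]. Integrating
    this over [y > s] bounds the tilted odds [a / e] by [rho] times the Gaussian odds at [s], hence,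
    by [Phi_odds], by the Gaussian odds at [s + delta]. *)
Let domination_halfline s :
  gmean (fun x => h x * \1_`]-oo, s] x) <= gmean h * Phi (s + delta).
Proof.
have bL : bmeas (fun x => h x * \1_`]-oo, s] x) by exact: bmeas_indicM.
have bU : bmeas (fun x => h x * \1_`]s, +oo[ x) by exact: bmeas_indicM.
set a := gmean _; pose e := gmean (fun x => h x * \1_`]s, +oo[ x).
have ae : gmean h = a + e.
  rewrite -gmeanD//; congr gmean; apply/funext => x.
  rewrite -mulrDr !indicE !mem_setE !in_itv/= andbT.
  by case: leP => _; rewrite ?addr0 ?add0r mulr1.
have a_le y : a <= rho * h y * Phi s.
  rewrite -gmeanZ; last exact: bmeas_indic.
  by apply: gmean_le => //; [exact/bmeasZ/bmeas_indic|move=> x; rewrite ler_wpM2r].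
have aT : a * (1 - Phi s) <= rho * Phi s * e.
  rewrite PhiC -(gmeanZ _ a) -1?(gmeanZ _ (rho * Phi s))//; last exact: bmeas_indic.
  apply: gmean_le; [exact/bmeasZ/bmeas_indic|exact: bmeasZ|] => y.
  rewrite mulrA ler_wpM2r//.
  by rewrite mulrAC.
have d0 : 0 <= delta by exact: domination_shift_ge0.
have := Phi_odds s d0.
have -> : 1 + hazard * delta = rho.
  by rewrite /delta /domination_shift; field; rewrite gt_eqF// hazard_gt0.
have A0 := Phi_gt0 s; have A1 := Phi_lt1 beta_gt0 s.
have P1 := Phi_lt1 beta_gt0 (s + delta).
rewrite ae; move: aT; set A := Phi s; set P := Phi (s + delta) => aT odds.
have e0 : 0 <= e by apply: gmean_ge0 => x; rewrite mulr_ge0.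
suff : a * (1 - P) <= e * P by lra.
have T0 : 0 < 1 - A by rewrite subr_gt0.
rewrite -(ler_pM2r T0) mulrAC.
apply: (@le_trans _ _ (rho * A * e * (1 - P))).
  by rewrite ler_wpM2r// subr_ge0 ltW.
rewrite (_ : _ * (1 - P) = e * (rho * (A * (1 - P)))); last by ring.
by rewrite -mulrA ler_wpM2l.
Qed.

(** A down-set is empty, the whole line, or a half-line ending at its supremum, with or without the
    endpoint. *)
Let domination_down (A : set R) : measurable A ->
  (forall x y, x <= y -> A y -> A x) ->
  gmean (fun x => h x * \1_A x) <= gmean h * gmean (fun x => \1_A (x - delta)).
Proof.
move=> mA dA.
have bA : bmeas (\1_A : R -> R) by exact: bmeas_indic.
have bAd : bmeas (fun x => \1_A (x - delta) : R).
  by apply: (@bmeas_comp _ _ (fun x => x - delta)) bA; exact: measurable_funB.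
have [[M MA]|nA] := pselect (exists M, ~ A M); last first.
  have AT : A = setT.
    by apply/seteqP; split => // x _; apply: contra_notP nA; exists x.
  rewrite AT; under eq_fun do rewrite indicT mulr1.
  by under [X in _ * gmean X]eq_fun do rewrite indicT; rewrite gmean_cst mulr1.
have [A0|/set0P[x0 Ax0]] := eqVneq A set0.
  rewrite A0; under eq_fun do rewrite indic0 mulr0.
  by rewrite gmean_cst mulr_ge0// gmean_ge0.
have hs : has_sup A.
  split; first by exists x0.
  by exists M => y Ay; rewrite leNgt; apply/negP => /ltW /dA /(_ Ay).
apply: (@le_trans _ _ (gmean (fun x => h x * \1_`]-oo, sup A] x))).
  apply: gmean_le; [exact: bmeas_indicM..|] => x.
  rewrite ler_wpM2l//; apply: indic_le => Ax.
  by rewrite /= in_itv/=; exact: sup_upper_bound.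
apply: (le_trans (domination_halfline _)).
rewrite ler_wpM2l ?gmean_ge0// -Phi_open.
apply: gmean_le => //; first exact: bmeas_indic.
move=> x; apply: (@indic_le `]-oo, _[ [set x | A (x - delta)]).
rewrite /= in_itv/= -ltrBlDr => /sup_gt[|y Ay xy]; first by exists x0.
exact: dA (ltW xy) Ay.
Qed.

Variable F : R -> R.
Hypotheses (bF : bmeas F) (F01 : forall x, 0 <= F x <= 1).
Hypothesis F_noninc : forall x y, x <= y -> F y <= F x.

(** Indicator of the region under the graph of [g], read jointly in the point and the level:
    integrating out the level gives [g] back, which is the layer-cake formula. *)
Let layer (g : R -> R) (z t : R) : R := ((0 < t) && (t < g z))%:R.

Let layer_ge0 g z t : 0 <= layer g z t. Proof. exact: ler0n. Qed.

Let measurable_layer g : measurable_fun [set: R] g ->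
  measurable_fun [set: measurableTypeR R * measurableTypeR R]
    (fun p => layer g p.1 p.2).
Proof.
move=> mg; rewrite (_ : (fun p => _) =
    \1_((fun p : R * R => (0 < p.2) && (p.2 < g p.1)) @^-1` [set true])); last first.
  apply/funext => p; rewrite indicE /layer; congr ((nat_of_bool _)%:R).
  by apply/idP/idP; rewrite inE.
apply: measurable_indic; rewrite -[X in measurable X]setTI.
apply: measurable_and => //; apply: measurable_fun_ltr => //.
by apply: measurableT_comp => //.
Qed.

Let integral_layer g z : 0 <= g z ->
  (\int[mu]_t (layer g z t)%:E = (g z)%:E)%E.
Proof.
move=> gz; rewrite (_ : (fun t => _) = EFin \o \1_`]0, g z[); last first.
  by apply/funext => t /=; rewrite indicE mem_setE in_itv.
rewrite integral_indic//= setIT lebesgue_measure_itv/= lte_fin.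
move: gz; rewrite le_eqVlt => /orP[/eqP<-|->]; first by rewrite ltxx.
by rewrite sube0.
Qed.

Let bmeas_layer (k g : R -> R) t : bmeas k -> bmeas g ->
  bmeas (fun z => k z * layer g z t).
Proof.
move=> bk [mg _]; apply: bmeasM => //; split; last first.
  by exists 1 => z; rewrite /layer; case: (_ && _); rewrite ?normr0 ?normr1.
exact: (measurableT_comp (measurable_layer mg) (measurable_pair2 t)).
Qed.

Let layer_cake (k g : R -> R) : bmeas k -> (forall x, 0 <= k x) ->
  bmeas g -> (forall x, 0 <= g x) ->
  (gmean (fun z => k z * g z))%:E =
  (\int[mu]_t (gmean (fun z => (k z * layer g z t)%R))%:E)%E.
Proof.
move=> bk k0 bg g0; have [mg _] := bg; have [mk _] := bk.
have bl t : bmeas (fun z => k z * layer g z t) by exact: bmeas_layer.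
rewrite EFin_gmean; last exact: bmeasM.
under [RHS]eq_integral do rewrite EFin_gmean//.
rewrite -(@fubini_tonelli _ _ (measurableTypeR R) (measurableTypeR R) R gauss mu
  (fun p => (k p.1 * layer g p.1 p.2)%:E))/=.
- apply: eq_integral => z _; under [RHS]eq_integral do rewrite EFinM.
  rewrite ge0_integralZl//; first by rewrite integral_layer.
  + apply/measurable_EFinP.
    exact: (measurableT_comp (measurable_layer mg) (measurable_pair1 z)).
  + by move=> t _; rewrite lee_fin.
  + by rewrite lee_fin.
- apply/measurable_EFinP; apply: measurable_funM; last exact: measurable_layer.
  exact: measurableT_comp.
- by move=> p; rewrite lee_fin mulr_ge0.
Qed.

Let measurable_layer_mean (k g : R -> R) : bmeas k -> (forall x, 0 <= k x) ->
  bmeas g ->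
  measurable_fun [set: R] (fun t => (gmean (fun z => (k z * layer g z t)%R))%:E).
Proof.
move=> bk k0 bg; have [mg _] := bg; have [mk _] := bk.
rewrite (_ : (fun t => _) = fun t => (\int[gauss]_z (k z * layer g z t)%:E)%E); last first.
  by apply/funext => t; rewrite EFin_gmean//; exact: bmeas_layer.
apply: (@measurable_fun_fubini_tonelli_G _ _ (measurableTypeR R)
  (measurableTypeR R) R gauss (fun p => (k p.1 * layer g p.1 p.2)%:E)).
  apply/measurable_EFinP; apply: measurable_funM; last exact: measurable_layer.
  exact: measurableT_comp.
by move=> p; rewrite lee_fin mulr_ge0.
Qed.

(** The superlevel sets of the nonincreasing [F] are down-sets; [domination_down] is integrated over
    the levels. *)
Lemma gauss_domination_le :
  gmean (fun x => h x * F x) <= gmean h * gmean (fun x => F (x - delta)).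
Proof.
have F0 x : 0 <= F x by have /andP[] := F01 x.
have bFd : bmeas (fun x => F (x - delta)).
  by apply: (@bmeas_comp _ _ (fun x => x - delta)) bF; exact: measurable_funB.
have bFd' : bmeas (fun x => gmean h * F (x - delta)) by exact: bmeasZ.
rewrite -gmeanZ// -lee_fin !layer_cake//; last by move=> x; exact: gmean_ge0.
apply: ge0_le_integral => //.
- by move=> t _; rewrite lee_fin gmean_ge0// => z; rewrite mulr_ge0.
- exact: measurable_layer_mean.
- by apply: measurable_layer_mean => // x; exact: gmean_ge0.
move=> t _; rewrite lee_fin gmeanZ; last first.
  have := @bmeas_layer (fun=> 1) _ t (bmeas_cst 1) bFd.
  by under eq_fun do rewrite mul1r.
have [t0|t0] := leP t 0.
  rewrite /layer ltNge t0/=; under eq_fun do rewrite mulr0.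
  by rewrite gmean_cst mulr_ge0 ?gmean_ge0.
have mA : measurable [set z | t < F z].
  have [mF _] := bF; rewrite -[X in measurable X]setTI.
  rewrite (_ : [set z | t < F z] = F @^-1` `]t, +oo[); last first.
    by apply/seteqP; split => z /=; rewrite in_itv/= andbT.
  exact: mF.
have := @domination_down _ mA.
have lE (g : R -> R) z : layer g z t = \1_[set z | t < g z] z.
  rewrite /layer t0/= indicE; congr ((nat_of_bool _)%:R).
  by apply/idP/idP; rewrite inE.
rewrite (_ : (fun z => h z * _) = (fun z => h z * \1_[set z | t < F z] z)); last first.
  by apply/funext => z; rewrite lE.
rewrite (_ : (fun z => layer _ z t) = (fun z => \1_[set z | t < F z] (z - delta))); last first.
  by apply/funext => z; rewrite lE.
apply.
by move=> x y xy /= /lt_le_trans; apply; exact: F_noninc.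
Qed.

End domination.

(** The upper bound applied to [1 - F (- x)], which is again nonincreasing with values in [[0, 1]],
    and to the reflected density. *)
Lemma gauss_domination_ge (h F : R -> R) (rho : R) :
  bmeas h -> (forall x, 0 <= h x) -> (forall x y, h x <= rho * h y) -> 1 <= rho ->
  bmeas F -> (forall x, 0 <= F x <= 1) -> (forall x y, x <= y -> F y <= F x) ->
  gmean h * gmean (fun x => F (x + domination_shift rho)) <=
  gmean (fun x => h x * F x).
Proof.
move=> bh h0 hrho rho1 bF F01 Fn; set d := domination_shift rho.
have mN : measurable_fun [set: R] (-%R : R -> R) by exact: measurable_funN.
have bh' : bmeas (fun x => h (- x)) by exact: (bmeas_comp mN bh).
have bF' : bmeas (fun x => 1 - F (- x)).
  by apply: bmeasB => //; exact: (bmeas_comp mN bF).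
have F01' x : 0 <= 1 - F (- x) <= 1 by have := F01 (- x); lra.
have bhF : bmeas (fun x => h x * (1 - F x)) by apply: bmeasM => //; exact: bmeasB.
have bhF' : bmeas (fun x => h x * F x) by exact: bmeasM.
have bFd : bmeas (fun x => F (x + d)).
  by apply: (@bmeas_comp _ F (fun x => x + d)) bF; exact: measurable_funD.
have bG : bmeas (fun x => 1 - F (x + d)) by exact: bmeasB.
have := @gauss_domination_le _ _ bh' (fun x => h0 (- x)) (fun x y => hrho (- x) (- y))
  rho1 _ bF' F01'.
rewrite -/d gmean_opp//.
rewrite (@gmean_opp _ _ beta_gt0 (fun x => h x * (1 - F x)))//; last first.
  by move=> x; rewrite mulr_ge0//; have := F01 x; lra.
rewrite (_ : (fun x => 1 - F (- (x - d))) = (fun x => 1 - F (- x + d))); last first.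
  by apply/funext => x; congr (1 - F _); ring.
rewrite (@gmean_opp _ _ beta_gt0 (fun x => 1 - F (x + d)))//; last first.
  by move=> x; have := F01 (x + d); lra.
have -> : gmean (fun x => h x * (1 - F x)) = gmean h - gmean (fun x => h x * F x).
  rewrite -[X in _ - X]mul1r -mulNr -gmeanZ// -gmeanD//; last exact: bmeasZ.
  by congr gmean; apply/funext => x; ring.
have -> : gmean (fun x => 1 - F (x + d)) = 1 - gmean (fun x => F (x + d)).
  rewrite -[X in _ - X]mul1r -mulNr -gmeanZ// -{2}(gmean_cst beta 1) -gmeanD//.
    by congr gmean; apply/funext => x; ring.
  exact: bmeasZ.
rewrite mulrBr mulr1 => H.
suff /H : forall x y, x <= y -> 1 - F (- y) <= 1 - F (- x) by lra.
by move=> x y xy; rewrite lerD2l lerN2 Fn// lerN2.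
Qed.

End gaussian_domination_monotone.

(** * Trigonometric polynomials with decaying coefficient ratios *)

Section trigonometric_class.
Context (R : realType).
Implicit Types (p q : {poly R}) (F : nat -> R).

(** The linear functional sending ['X^i] to [F i]. With a cosine for [F i], the polynomial is a
    finite list of Fourier coefficients, and multiplying polynomials is convolution. *)
Definition coef_eval F p : R := \sum_(i < size p) p`_i * F i.

Lemma coef_eval_wide F p N : (size p <= N)%N ->
  coef_eval F p = \sum_(i < N) p`_i * F i.
Proof.
move=> pN; rewrite /coef_eval.
rewrite -(big_mkord xpredT (fun i => p`_i * F i)) -(big_mkord xpredT (fun i => p`_i * F i)).
rewrite (big_cat_nat _ pN)//= [X in _ + X]big1_seq ?addr0//.
by move=> i /andP[_]; rewrite mem_index_iota => /andP[ip _]; rewrite nth_default ?mul0r.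
Qed.

Lemma coef_evalD F p q : coef_eval F (p + q) = coef_eval F p + coef_eval F q.
Proof.
have h := size_polyD p q.
rewrite (coef_eval_wide _ h) (coef_eval_wide F (leq_maxl (size p) (size q))).
rewrite (coef_eval_wide F (leq_maxr (size p) (size q))) -big_split/=.
by apply: eq_bigr => i _; rewrite coefD mulrDl.
Qed.

Lemma coef_evalZ F c p : coef_eval F (c *: p) = c * coef_eval F p.
Proof.
rewrite (coef_eval_wide _ (size_scale_leq c p)) mulr_sumr.
by apply: eq_bigr => i _; rewrite coefZ mulrA.
Qed.

Lemma coef_eval0 F : coef_eval F 0 = 0.
Proof. by rewrite /coef_eval size_poly0 big_ord0. Qed.

Lemma coef_eval_sum F I (s : seq I) (f : I -> {poly R}) :
  coef_eval F (\sum_(i <- s) f i) = \sum_(i <- s) coef_eval F (f i).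
Proof.
elim: s => [|i s ih]; first by rewrite !big_nil coef_eval0.
by rewrite !big_cons coef_evalD ih.
Qed.

Lemma coef_evalMXn F k q : coef_eval F ('X^k * q) = coef_eval (fun l => F (k + l)%N) q.
Proof.
have h : (size ('X^k * q)%R <= k + size q)%N.
  by apply: (leq_trans (size_polyMleq _ _)); rewrite size_polyXn.
rewrite (coef_eval_wide _ h) big_split_ord/= big1 ?add0r.
  by apply: eq_bigr => i _; rewrite coefXnM ltnNge leq_addr/= addKn.
by move=> i _; rewrite coefXnM ltn_ord mul0r.
Qed.

Lemma coef_evalM F p q : coef_eval F (p * q) =
  coef_eval (fun i => coef_eval (fun l => F (i + l)%N) q) p.
Proof.
rewrite -{1}[p]coefK poly_def mulr_suml coef_eval_sum.
by apply: eq_bigr => i _; rewrite -scalerAl coef_evalZ coef_evalMXn.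
Qed.

Lemma eq_coef_eval F G p : F =1 G -> coef_eval F p = coef_eval G p.
Proof. by move=> FG; apply: eq_bigr => i _; rewrite FG. Qed.

Lemma coef_evalZF F c p : coef_eval (fun i => F i * c) p = coef_eval F p * c.
Proof. by rewrite /coef_eval mulr_suml; apply: eq_bigr => i _; rewrite mulrA. Qed.

(** The offset [M] stores negative frequencies in a polynomial: the exponent [M] is the constant
    mode. *)
Definition frequency (M i : nat) : R := 2 * pi * (i%:R - M%:R).

(* The phase [a] encodes at once that the cosine sum is [f] and that the sine
   sum vanishes. *)
Definition trig_poly p M (f : R -> R) := forall a psi,
  coef_eval (fun i => cos (a + frequency M i * psi)) p = cos a * f psi.

Definition peaked (r : R) p M := [/\ forall i, 0 <= p`_i,
  forall i, (M <= i)%N -> p`_i.+1 <= r * p`_i &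
  forall i, (i < M)%N -> p`_i <= r * p`_i.+1].

Definition trig_class r f := exists p M, peaked r p M /\ trig_poly p M f.

Lemma trig_polyM p q M N f g : trig_poly p M f -> trig_poly q N g ->
  trig_poly (p * q) (M + N) (fun x => f x * g x).
Proof.
move=> pf qg a psi; rewrite coef_evalM.
rewrite mulrA -pf -coef_evalZF; apply: eq_coef_eval => i.
rewrite -qg; apply: eq_coef_eval => l; congr cos.
by rewrite /frequency !natrD; ring.
Qed.

(** Consider a term [p_i * q_l] of a product coefficient with [i + l = j + 1], where [j >= M + N].
    Either [i > M], and lowering [i] costs a factor [r], or [l > N], and lowering [l] costs a factor
    [s]. Each of the two moves reaches every term of the coefficient [j] at most once, whence the
    factor [r + s]. The other side of the centre is symmetric. *)
Lemma peakedM r s p q M N : 0 <= r -> 0 <= s -> peaked r p M -> peaked s q N ->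
  peaked (r + s) (p * q) (M + N).
Proof.
move=> r0 s0 [p0 pu pd] [q0 qu qd].
have pq0 i l : 0 <= p`_i * q`_l by rewrite mulr_ge0.
split=> [j|j MNj|j jMN].
- by rewrite coefM sumr_ge0.
- rewrite !coefM mulrDl !mulr_sumr.
  rewrite [X in _ <= X + _](_ : _ =
    \sum_(i < j.+2) (if (0 < i)%N then r * (p`_i.-1 * q`_(j.+1 - i)) else 0)); last first.
    by rewrite [RHS]big_ord_recl/= add0r; apply: eq_bigr => i _; rewrite /bump/= add1n.
  rewrite [X in _ <= _ + X](_ : _ =
    \sum_(i < j.+2) (if (i <= j)%N then s * (p`_i * q`_(j - i)) else 0)); last first.
    rewrite [RHS]big_ord_recr/= ltnn addr0; apply: eq_bigr => i _.
    by rewrite -ltnS ltn_ord.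
  rewrite -big_split/=; apply: ler_sum => i _.
  have [Mi|iM] := ltnP M i.
    have i0 : (0 < i)%N by apply: leq_ltn_trans Mi.
    rewrite i0 -[leLHS]addr0 lerD//; last by case: ifP => // _; rewrite mulr_ge0.
    rewrite mulrA ler_wpM2r//; have := pu i.-1; rewrite prednK//; apply.
    by rewrite -ltnS prednK.
  have ij : (i <= j)%N by apply: leq_trans iM (leq_trans (leq_addr _ _) MNj).
  rewrite ij -[leLHS]add0r lerD//; first by case: ifP => // _; rewrite mulr_ge0.
  rewrite mulrCA ler_wpM2l// subSn// qu//.
  by rewrite leq_subRL// (leq_trans _ MNj)// leq_add2r.
- rewrite !coefM mulrDl.
  have : \sum_(i < j.+1) p`_i * q`_(j - i) <=
     \sum_(i < j.+1) (r * (p`_i.+1 * q`_(j - i)) + s * (p`_i * q`_(j.+1 - i))).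
    apply: ler_sum => i _; have ij : (i <= j)%N by rewrite -ltnS.
    have [iM|Mi] := ltnP i M.
      rewrite -[leLHS]addr0 lerD//; last by rewrite mulr_ge0.
      by rewrite mulrA ler_wpM2r// pd.
    rewrite -[leLHS]add0r lerD//; first by rewrite mulr_ge0.
    rewrite mulrCA ler_wpM2l// subSn// qd// ltn_subLR//.
    by rewrite (leq_trans jMN)// leq_add2r.
  move=> /le_trans; apply; rewrite big_split/= -!mulr_sumr; apply: lerD.
    by rewrite ler_wpM2l// [leRHS]big_ord_recl/= lerDr.
  by rewrite ler_wpM2l// [leRHS]big_ord_recr/= lerDl.
Qed.

Lemma trig_classM r s f g : 0 <= r -> 0 <= s -> trig_class r f -> trig_class s g ->
  trig_class (r + s) (fun x => f x * g x).
Proof.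
move=> r0 s0 [p [M [pp pf]]] [q [N [qq qg]]]; exists (p * q), (M + N)%N; split.
  exact: peakedM.
exact: trig_polyM.
Qed.

Lemma trig_class1 : trig_class 0 (fun=> 1).
Proof.
exists 1, 0%N; split.
  split=> [i|i _|i]; [by rewrite coef1 ler0n|by rewrite coef1 mul0r|by rewrite ltn0].
move=> a psi; rewrite /coef_eval size_poly1 big_ord1 coef1 /= /frequency.
by rewrite subrr mulr0 mul0r addr0 mul1r mulr1.
Qed.

Lemma trig_classX r f n : 0 <= r -> trig_class r f ->
  trig_class (n%:R * r) (fun x => f x ^+ n).
Proof.
move=> r0 cf; elim: n => [|n ih].
  rewrite mul0r; under eq_fun do rewrite expr0.
  exact: trig_class1.
under eq_fun do rewrite exprS.
by rewrite -natr1 mulrDl mul1r addrC; apply: trig_classM => //; rewrite mulr_ge0.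
Qed.

Lemma trig_classZ c r f : 0 <= c -> trig_class r f -> trig_class r (fun x => c * f x).
Proof.
move=> c0 [p [M [[p0 pu pd] pf]]]; exists (c *: p), M; split.
  split=> i; rewrite ?coefZ ?mulr_ge0// => Mi; rewrite mulrCA ler_wpM2l//; auto.
by move=> a psi; rewrite coef_evalZ pf mulrCA.
Qed.

Lemma trig_class_bmeas r f : trig_class r f -> bmeas f.
Proof.
move=> [p [M [_ pf]]]; have -> : f = fun x => \sum_(i < size p) p`_i * cos (frequency M i * x).
  apply/funext => x; have := pf 0 x; rewrite cos0 mul1r => <-.
  by apply: eq_bigr => i _; rewrite add0r.
by apply: bmeas_sum => i; apply: bmeasZ; exact: bmeas_cos.
Qed.

(** With [T] the total of the off-centre coefficients, [f] lies between [p_M - T] and [p_M + T].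
    Summing geometric series on both sides gives [T <= 2 r / (1 - r) * p_M], and then the extreme
    values have ratio at most [(1 + r) / (1 - 3 r)]. *)
Lemma trig_class_osc r f x y : 0 <= r -> 3 * r <= 1 -> trig_class r f ->
  (1 - 3 * r) * f x <= (1 + r) * f y.
Proof.
move=> r0 r1 [p [M [[p0 pu pd] pf]]].
pose N := (M + size p).+1.
have pN : (size p <= N)%N by rewrite leqW// leq_addl.
have MN : (M < N)%N by rewrite ltnS leq_addr.
pose T := \sum_(0 <= i < M) p`_i + \sum_(M.+1 <= i < N) p`_i.
have fE z : f z = \sum_(i < N) p`_i * cos (frequency M i * z).
  have := pf 0 z; rewrite cos0 mul1r => <-; rewrite (coef_eval_wide _ pN).
  by apply: eq_bigr => i _; rewrite add0r.
have fE' z : f z = \sum_(0 <= i < M) p`_i * cos (frequency M i * z) + (p`_M +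
    \sum_(M.+1 <= i < N) p`_i * cos (frequency M i * z)).
  rewrite fE -(big_mkord xpredT (fun i => p`_i * cos (frequency M i * z))).
  rewrite (big_cat_nat _ (ltnW MN))//= [in X in _ + X]big_ltn//.
  by rewrite {2}/frequency subrr mulr0 mul0r cos0 mulr1.
have fu z : f z <= p`_M + T.
  rewrite fE' addrCA lerD2l /T lerD//; apply: ler_sum => i _;
  by rewrite ler_piMr// cos_le1.
have fl z : p`_M - T <= f z.
  rewrite fE' addrCA lerD2l /T opprD -!sumrN lerD//; apply: ler_sum => i _;
  by rewrite -mulrN1 ler_wpM2l// cos_geN1.
(* Moving each coefficient one place towards the centre bounds either side sum by [r] times itself
   plus the central coefficient. *)
have T_le : (1 - r) * T <= 2 * r * p`_M.
  have T1 : \sum_(0 <= i < M) p`_i <= r * (\sum_(0 <= i < M) p`_i + p`_M).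
    apply: (@le_trans _ _ (\sum_(0 <= i < M) r * p`_i.+1)).
      rewrite big_nat_cond [leRHS]big_nat_cond; apply: ler_sum => i /andP[/andP[_ iM] _].
      exact: pd.
    rewrite -mulr_sumr ler_wpM2l// -big_nat_recr//= big_nat_recl//.
    by rewrite lerDr.
  have T2 : \sum_(M.+1 <= i < N) p`_i <= r * (p`_M + \sum_(M.+1 <= i < N) p`_i).
    rewrite big_add1 /=.
    apply: (@le_trans _ _ (\sum_(M <= i < N.-1) r * p`_i)).
      rewrite big_nat_cond [leRHS]big_nat_cond; apply: ler_sum => i /andP[/andP[Mi _] _].
      exact: pu.
    rewrite -mulr_sumr ler_wpM2l//=.
    rewrite -(big_add1 _ _ M N xpredT (fun i => p`_i)) -big_ltn// /N big_nat_recr/=.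
      by rewrite lerDl.
    exact: leq_addr.
  by rewrite /T; lra.
have := fu x; have := fl y => l u.
apply: (@le_trans _ _ ((1 - 3 * r) * (p`_M + T))).
  by rewrite ler_wpM2l// subr_ge0.
apply: (@le_trans _ _ ((1 + r) * (p`_M - T))); last by rewrite ler_wpM2l// addr_ge0.
by lra.
Qed.

End trigonometric_class.

(** * Effect of Gaussian smoothing on the coefficient ratios *)

Section trigonometric_smoothing.
Context (R : realType) (beta : R).
Hypothesis beta_gt0 : 0 < beta.
Local Notation gmean := (gmean beta).
Local Notation avg := (avg beta).

Lemma gmean_cvg (f_ : nat -> R -> R) (f : R -> R) (C : R) :
  (forall n, bmeas (f_ n)) -> bmeas f -> (forall n x, `|f_ n x| <= C) ->
  (forall x, f_ ^~ x @ \oo --> f x) -> gmean (f_ n) @[n --> \oo] --> gmean f.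
Proof.
move=> bf_ bf fC f_f.
have mE (k : R -> R) : bmeas k -> measurable_fun [set: R] (EFin \o k).
  by move=> [mk _]; exact/measurable_EFinP.
have fE x : (EFin \o f_ ^~ x) @ \oo --> (f x)%:E.
  by apply: cvg_EFin; [exact: nearW|exact: f_f].
have : (\int[gauss beta]_x (f_ n x)%:E)%E @[n --> \oo] -->
    (\int[gauss beta]_x (f x)%:E)%E.
  have [] // := @dominated_convergence _ _ _ (gauss beta) setT measurableT
    (fun n => EFin \o f_ n) (EFin \o f) (cst C%:E).
  - by move=> n; exact: mE.
  - exact: mE.
  - by apply: aeW => x _; exact: fE.
  - exact: (bmeas_integrable _ (bmeas_cst C)).
  - by apply: aeW => x n _; exact: fC.
by rewrite -EFin_gmean// => /fine_cvg.
Qed.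

Lemma avg_cvg (f_ : nat -> R -> R) (f : R -> R) (C : R) :
  (forall n, bmeas (f_ n)) -> bmeas f -> (forall n x, `|f_ n x| <= C) ->
  (forall x, f_ ^~ x @ \oo --> f x) ->
  forall psi, avg (f_ n) psi @[n --> \oo] --> avg f psi.
Proof.
move=> bf_ bf fC f_f psi; apply: (@gmean_cvg (fun n z => f_ n (psi + z)) _ C) => //.
- by move=> n; exact: bmeas_shift.
- exact: bmeas_shift.
Qed.

Lemma avg_cos_phase a s psi : avg (fun z => cos (a + s * z)) psi =
  cos (a + s * psi) * expR (- (s ^+ 2 / (beta *+ 2))).
Proof.
have -> : (fun z => cos (a + s * z)) =
    (fun z => cos a * cos (s * z) + (- sin a) * sin (s * z)).
  by apply/funext => z; rewrite cosD mulNr.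
rewrite avgD; [|exact/bmeasZ/bmeas_cos|exact/bmeasZ/bmeas_sin].
rewrite avgZ; last exact: bmeas_cos.
rewrite avgZ; last exact: bmeas_sin.
by rewrite avg_cos// avg_sin// cosD; ring.
Qed.

(** The Gaussian multiplier of the lowest nonzero frequency [2 * pi]. *)
Definition contraction : R := expR (- (2 * pi ^+ 2 / beta)).

(** Smoothing multiplies the mode of frequency [2 * pi * k] by [contraction ^ (k ^ 2)], so the ratio
    from [k] to [k + 1] gains [contraction ^ (2 k + 1)], at most [contraction], with equality next
    to the centre. *)
Lemma trig_class_avg r f : 0 <= r -> trig_class r f ->
  trig_class (contraction * r) (avg f).
Proof.
move=> r0 cf; have bf := trig_class_bmeas cf; have [p [M [[p0 pu pd] pf]]] := cf.
pose w i := expR (- (frequency R M i ^+ 2 / (beta *+ 2))).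
have w0 i : 0 <= w i by exact: expR_ge0.
pose q := \poly_(i < size p) (p`_i * w i).
have qE i : q`_i = p`_i * w i.
  by rewrite coef_poly; case: ltnP => // pi; rewrite nth_default ?mul0r.
have wu i : (M <= i)%N -> w i.+1 <= contraction * w i.
  move=> Mi; rewrite -expRD ler_expR -(subnK Mi); set k := (i - M)%N.
  rewrite /frequency -addSn !natrD !addrK -[k.+1%:R]natr1.
  rewrite -subr_ge0 [X in 0 <= X](_ : _ = 4 * pi ^+ 2 * k%:R / beta).
    by rewrite divr_ge0 ?(ltW beta_gt0)// mulr_ge0 ?ler0n// mulr_ge0 ?ler0n// sqr_ge0.
  by field; rewrite gt_eqF.
have wd i : (i < M)%N -> w i <= contraction * w i.+1.
  move=> iM; rewrite -expRD ler_expR -(subnK iM); set k := (M - i.+1)%N.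
  rewrite /frequency natrD -[i.+1%:R]natr1.
  rewrite -subr_ge0 [X in 0 <= X](_ : _ = 4 * pi ^+ 2 * k%:R / beta).
    by rewrite divr_ge0 ?(ltW beta_gt0)// mulr_ge0 ?ler0n// mulr_ge0 ?ler0n// sqr_ge0.
  by field; rewrite gt_eqF.
exists q, M; split.
  split=> i; rewrite !qE ?mulr_ge0// => Mi.
    rewrite (_ : contraction * r * _ = (r * p`_i) * (contraction * w i)); last by ring.
    by rewrite ler_pM//; auto.
  rewrite (_ : contraction * r * _ = (r * p`_i.+1) * (contraction * w i.+1)); last by ring.
  by rewrite ler_pM//; auto.
move=> a psi; rewrite (coef_eval_wide _ (size_poly _ _)) -avgZ//.
under [X in _ = avg X _]eq_fun do rewrite -pf.
have bc i : bmeas (fun z => cos (a + frequency R M i * z)).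
  under eq_fun do rewrite cosD.
  apply: bmeasB; apply: bmeasZ; [exact: bmeas_cos|exact: bmeas_sin].
rewrite /avg gmean_sum; last by move=> i; apply: bmeasZ; exact: (bmeas_shift psi (bc i)).
apply: eq_bigr => i _; rewrite qE gmeanZ; last exact: (bmeas_shift psi (bc i)).
by rewrite -/(avg (fun z => cos (a + frequency R M i * z)) psi) avg_cos_phase// mulrAC mulrA.
Qed.

(** The real part, with phase [a], of the identity between [(1 + exp (2 i x)) ^ n] and
    [exp (i n x) * (2 cos x) ^ n]. *)
Lemma cos_pow_eval n (a x : R) :
  coef_eval (fun i => cos (a + i%:R * (2 * x))) ((1 + 'X) ^+ n) =
  cos (a + n%:R * x) * (2 * cos x) ^+ n.
Proof.
elim: n a => [|n ih] a.
  rewrite !expr0 mulr1 /coef_eval size_poly1 big_ord1 coef1 /=.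
  by rewrite !mul0r mul1r.
have e1 (G : nat -> R) : coef_eval G (1 + 'X) = G 0%N + G 1%N.
  rewrite coef_evalD /coef_eval size_poly1 size_polyX big_ord1 !big_ord_recl big_ord0.
  by rewrite !coef1 !coefX/= !mul1r mul0r add0r addr0.
rewrite exprS coef_evalM e1 ih.
rewrite (@eq_coef_eval _ _ (fun l => cos (a + 2 * x + l%:R * (2 * x)))); last first.
  by move=> l; congr cos; rewrite add1n -natr1; ring.
rewrite ih -mulrDl [in RHS]exprS mulrA; congr (_ * _).
have -> : a + n.+1%:R * x = a + (n%:R * x + x) by rewrite -[n.+1%:R]natr1; ring.
have -> : a + n%:R * x = a + (n%:R * x + x) - x by ring.
have -> : a + 2 * x + n%:R * x = a + (n%:R * x + x) + x by ring.
set u := a + (n%:R * x + x).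
by rewrite cosB cosD; ring.
Qed.

(** The coefficients are the binomials ['C(2 * N, i)], largest at [i = N]. The even exponent
    provides a central coefficient and makes the function [1]-periodic. *)
Lemma trig_class_cos_pow N : trig_class 1 (fun t : R => cos (pi * t) ^+ (2 * N)).
Proof.
have -> : (fun t : R => cos (pi * t) ^+ (2 * N)) =
    (fun t => (2 ^+ (2 * N))^-1 * (2 * cos (pi * t)) ^+ (2 * N)).
  by apply/funext => t; rewrite exprMn mulKf// expf_neq0.
apply: trig_classZ; first by rewrite invr_ge0 exprn_ge0.
exists ((1 + 'X) ^+ (2 * N)), N; split; last first.
  move=> a psi; have := cos_pow_eval (2 * N) (a - 2 * pi * N%:R * psi) (pi * psi).
  rewrite [in RHS](_ : a - _ + _ = a); last by rewrite natrM; ring.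
  by move=> <-; apply: eq_coef_eval => i; congr cos; rewrite /frequency; ring.
have cE i : ((1 + 'X : {poly R}) ^+ (2 * N))`_i = 'C(2 * N, i)%:R.
  rewrite addrC exprD1n coef_sum.
  under eq_bigr do rewrite coefMn coefXn.
  have [iN|Ni] := ltnP i (2 * N).+1.
    rewrite (bigD1 (Ordinal iN))//= eqxx big1 ?addr0//.
    by move=> k; rewrite -val_eqE/= eq_sym => /negbTE ->; rewrite mul0rn.
  rewrite bin_small// big1// => k _.
  by rewrite gtn_eqF ?mul0rn// (leq_trans _ Ni).
have h i : (i.+1 * 'C(2 * N, i.+1) = (2 * N - i) * 'C(2 * N, i))%N by exact: mul_bin_left.
split=> [i|i Ni|i iN]; rewrite !cE ?ler0n// mul1r ler_nat.
  rewrite -(leq_pmul2l (ltn0Sn i)) h leq_mul2r; apply/orP; right.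
  by rewrite leq_subLR mul2n -addnn (leq_trans (leq_add Ni Ni))// leq_add2l.
rewrite -(@leq_pmul2l (2 * N - i)); last by rewrite subn_gt0 mul2n -addnn ltn_addr.
rewrite -h leq_mul2r; apply/orP; right.
have iN2 : (i <= 2 * N)%N by rewrite mul2n -addnn (leq_trans (ltnW iN))// leq_addr.
by rewrite leq_subRL// mul2n -addnn leq_add// ltnW.
Qed.

(** Bounded pointwise limits suffice: powers and, by dominated convergence, Gaussian averages
    commute with them, and the oscillation inequality passes to the limit. No coefficients are
    attached to [f] itself. *)
Definition trig_limit r (f : R -> R) := bmeas f /\
  exists (g : nat -> R -> R) (C : R), [/\ forall n, trig_class r (g n),
    forall n x, `|g n x| <= C & forall x, g ^~ x @ \oo --> f x].

Lemma trig_limit_avgX n r f : 0 <= r -> trig_limit r f ->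
  trig_limit (contraction * (n%:R * r)) (avg (fun x => f x ^+ n)).
Proof.
move=> r0 [bf [g [C [gr gC gf]]]]; split; first exact/bmeas_avg/bmeasX.
have C0 : 0 <= C by rewrite (le_trans _ (gC 0%N 0)).
exists (fun k => avg (fun x => g k x ^+ n)), (C ^+ n); split.
- by move=> k; apply: trig_class_avg; [rewrite mulr_ge0|exact: trig_classX].
- move=> k x; have bg := bmeasX n (trig_class_bmeas (gr k)).
  have gn z : `|g k z ^+ n| <= C ^+ n by rewrite normrX lerXn2r ?nnegrE.
  rewrite ler_norml -{1}(avg_cst beta (- C ^+ n) x) -{2}(avg_cst beta (C ^+ n) x).
  by rewrite !avg_le// => z; have := gn z; rewrite ler_norml => /andP[].
- apply: (@avg_cvg _ _ (C ^+ n)).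
  + by move=> k; apply: bmeasX; exact: trig_class_bmeas.
  + exact: bmeasX.
  + by move=> k z; rewrite normrX lerXn2r ?nnegrE.
  + by move=> x; have := cvg_comp _ _ (gf x) (@exprn_continuous R n (f x)).
Qed.

Lemma trig_limit_osc r f x y : 0 <= r -> 3 * r <= 1 -> trig_limit r f ->
  (1 - 3 * r) * f x <= (1 + r) * f y.
Proof.
move=> r0 r1 [_ [g [C [gr gC gf]]]].
apply: (@ler_cvg_to _ \oo _ R (fun n => (1 - 3 * r) * g n x) (fun n => (1 + r) * g n y)).
- by apply: cvgMl_tmp; exact: gf.
- by apply: cvgMl_tmp; exact: gf.
- by apply: nearW => n; exact: trig_class_osc.
Qed.

End trigonometric_smoothing.

(** * Sums over the integers as counting integrals *)

Section integer_sums.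
Context (R : realType).
Local Notation mu := (@lebesgue_measure R).
Local Notation cnt := (@counting int R).
Local Open Scope ereal_scope.

Lemma counting_int1 (k : int) : cnt [set k] = 1.
Proof. by rewrite /counting asboolT//= fset_set1 finmap.cardfs1. Qed.

Lemma card_eq_counting (A B : set int) : (A #= B)%card -> cnt A = cnt B.
Proof.
move=> AB; rewrite /counting (_ : `[< finite_set A >] = `[< finite_set B >]); last first.
  by apply/asboolP/asboolP; rewrite (eq_finite_set AB).
case: asboolP => // fB; have fA : finite_set A by rewrite (eq_finite_set AB).
have [n Bn] := fB; rewrite (card_fset_set Bn) (@card_fset_set _ A n)//.
exact: card_eq_trans Bn.
Qed.

Lemma measurable_int d (T : measurableType d) (f : int -> T) :
  measurable_fun [set: int] f.
Proof. by []. Qed.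

Lemma measurable_intX (f : R -> \bar R) : measurable_fun [set: R] f ->
  measurable_fun [set: int * measurableTypeR R] (fun p => f (p.1%:~R + p.2)%R).
Proof.
move=> mf; apply: (measurableT_comp mf); apply: measurable_funD => //.
exact: (measurableT_comp (@measurable_int _ _ (fun m : int => m%:~R : R))).
Qed.

(** The integrand is multiplied by the sum over [m] of the indicators of the translated windows,
    exactly one of which contains [x], for [m] the floor of [x - c]; Tonelli and a translation by
    [m] do the rest. *)
Lemma integral_unfold (f : R -> \bar R) (c : R) :
  measurable_fun [set: R] f -> (forall x, 0 <= f x) ->
  \int[mu]_x f x = \int[mu]_(s in `[c, (c + 1)%R[) \int[cnt]_m f (m%:~R + s)%R.
Proof.
move=> mf f0; pose I : set R := `[c, (c + 1)%R[%classic.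
have mI : measurable_fun [set: R] (fun x => (\1_I x : R)%:E).
  by apply/measurable_EFinP/measurable_indic; exact: measurable_itv.
have I0 x : 0 <= (\1_I x : R)%:E by rewrite lee_fin.
transitivity (\int[mu]_x \int[cnt]_m (f x * (\1_I (- m%:~R + x)%R : R)%:E)).
  apply: eq_integral => x _.
  rewrite ge0_integralZl//.
  transitivity (f x * cnt [set Num.floor (x - c)%R]); last first.
    rewrite -[X in cnt X]setIT -integral_indic//; congr (_ * _).
    apply: eq_integral => m _; congr EFin; rewrite !indicE; congr ((nat_of_bool _)%:R).
    apply/idP/idP => /set_mem h; apply/mem_set; move: h; rewrite /I/= in_itv/=.
      by move=> ->; have := floor_itv (x - c); rewrite intrD; lra.
    by move=> h; apply/esym/floor_def; rewrite intrD; lra.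
  by rewrite counting_int1 mule1.
rewrite [RHS]integral_mkcond.
rewrite (@fubini_tonelli _ _ (measurableTypeR R) int R mu cnt
  (fun p => f p.1 * (\1_I (- p.2%:~R + p.1)%R : R)%:E)); last 2 first.
- apply: emeasurable_funM; first exact: measurableT_comp.
  apply: (measurableT_comp mI); apply: measurable_funD => //; apply: measurable_funN.
  exact: (measurableT_comp (@measurable_int _ _ (fun m : int => m%:~R : R))).
- by move=> p; rewrite mule_ge0.
transitivity (\int[cnt]_m \int[mu]_x (f (m%:~R + x)%R * (\1_I x : R)%:E)).
  apply: eq_integral => m _.
  rewrite -[RHS](@ge0_integral_lebesgue_shift _ _ (- m%:~R)%R); last 2 first.
  - apply: emeasurable_funM => //.
    apply: (measurableT_comp mf).
    exact: measurable_funD.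
  - by move=> x; rewrite mule_ge0.
  by apply: eq_integral => x _ /=; congr (f _ * (\1_I _)%:E); ring.
rewrite -(@fubini_tonelli _ _ (measurableTypeR R) int R mu cnt
  (fun p => f (p.2%:~R + p.1)%R * (\1_I p.1 : R)%:E)); last 2 first.
- apply: emeasurable_funM; last by apply: (measurableT_comp mI).
  apply: (measurableT_comp mf); apply: measurable_funD => //.
  exact: (measurableT_comp (@measurable_int _ _ (fun m : int => m%:~R : R))).
- by move=> p; rewrite mule_ge0.
apply: eq_integral => x _; rewrite patchE -/I /=.
under eq_integral do rewrite indicE.
case: ifPn => _; first by apply: eq_integral => m _; rewrite mule1.
by under eq_integral do rewrite mule0; rewrite integral0.
Qed.

Lemma ge0_integral_int_shift (f : int -> \bar R) (k : int) : (forall m, 0 <= f m) ->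
  \int[cnt]_m f (m + k)%R = \int[cnt]_m f m.
Proof.
move=> f0; pose s : int -> int := (+%R^~ k)%R.
pose s' := mfun_Sub (mem_set (@measurable_int _ _ s)).
transitivity (\int[pushforward cnt s']_x f x).
  by rewrite ge0_integral_pushforward.
apply: eq_measure_integral => A mA _; apply: card_eq_counting.
have -> : s' @^-1` A = (+%R^~ (- k))%R @` A.
  apply/seteqP; split => [m /= Am|_ [m Am <-]]; first by exists (m + k)%R; rewrite ?addrK.
  by rewrite /= /s subrK.
by apply: inj_card_eq => m1 m2 _ _; exact: addIr.
Qed.

End integer_sums.

(** * The leaf weights of the integer-valued field *)

Section theta_function.
Context (R : realType).
Local Notation mu := (@lebesgue_measure R).
Local Notation cnt := (@counting int R).
Implicit Types beta u psi : R.

(** Halving [beta] leaves room for a displacement by at most [1]. This one bound compares sums over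
    integers with integrals and dominates [gw] locally uniformly in its centre. *)
Lemma gw_half_ge beta x s : 0 < beta -> `|s| <= 1 ->
  gw beta x <= expR (beta / 2) * gw (beta / 2) (x + s).
Proof.
move=> b0 s1; rewrite -expRD ler_expR.
have s2 : s ^+ 2 <= 1.
  by rewrite -(real_normK (num_real s)) -[leRHS](expr1n _ 2) lerXn2r ?nnegrE.
rewrite -subr_ge0 [X in 0 <= X](_ : _ = beta / 4 * ((x - s) ^+ 2 + 2 * (1 - s ^+ 2))).
  apply: mulr_ge0; first by rewrite divr_ge0// ltW.
  by rewrite addr_ge0 ?sqr_ge0// mulr_ge0// subr_ge0.
by field.
Qed.

Lemma continuous_gw beta : continuous (gw beta).
Proof.
move=> x; apply: continuous_comp; last exact: continuous_expR.
apply: continuousN; apply: continuousM; first exact: cst_continuous.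
exact: exprn_continuous.
Qed.

Definition theta beta psi : R := \int[cnt]_m gw beta (m%:~R - psi).

Definition theta_below beta u psi : R :=
  \int[cnt]_m (gw beta (m%:~R - psi) * (m%:~R <= u :> R)%:R).

Definition theta_ub beta : R := expR (beta / 2) * gauss_mass (beta / 2).

(** Each term is compared with the same term displaced by [s], at half the [beta]; averaging over
    [s] in [[0, 1)] turns the sum into a full Gaussian integral. *)
Let theta_finite beta psi : 0 < beta ->
  (\int[cnt]_m (gw beta (m%:~R - psi))%:E <= (theta_ub beta)%:E)%E.
Proof.
move=> b0; have b20 : 0 < beta / 2 by rewrite divr_gt0.
have mg : measurable_fun [set: R] (fun x => (gw (beta / 2) (x - psi))%:E).
  apply/measurable_EFinP; apply: (measurableT_comp (measurable_gw _)).
  exact: measurable_funB.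
have e0 : 0 <= expR (beta / 2) by exact: expR_ge0.
rewrite /theta_ub EFinM -integral_gw//.
rewrite -(@ge0_integral_lebesgue_shift _ (EFin \o gw (beta / 2)) (- psi))//=; last 2 first.
- by apply/measurable_EFinP; exact: measurable_gw.
- by move=> x; rewrite lee_fin gw_ge0.
rewrite (@integral_unfold _ _ 0)//; last by move=> x; rewrite lee_fin gw_ge0.
have mS : measurable_fun [set: R] (fun s : measurableTypeR R =>
    (\int[cnt]_m (gw (beta / 2) (m%:~R + s - psi))%:E)%E).
  apply: (@measurable_fun_fubini_tonelli_G _ _ int (measurableTypeR R) R cnt
    (fun p => (gw (beta / 2) (p.1%:~R + p.2 - psi))%:E)).
    exact: (measurable_intX mg).
  by move=> p; rewrite lee_fin gw_ge0.
rewrite -ge0_integralZl//; last 2 first.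
- exact: measurable_funTS.
- by move=> s _; apply: integral_ge0 => m _; rewrite lee_fin gw_ge0.
have -> : (\int[cnt]_m (gw beta (m%:~R - psi))%:E =
    \int[mu]_(s in `[0%R, (0 + 1)%R[) (\int[cnt]_m (gw beta (m%:~R - psi))%:E))%E.
  by rewrite integral_cst//= lebesgue_measure_itv/= add0r lte01 sube0 mule1.
apply: ge0_le_integral => //.
- by move=> s _; apply: integral_ge0 => m _; rewrite lee_fin gw_ge0.
- by apply: measurable_funTS; apply: measurable_funeM.
- move=> s; rewrite /= in_itv/= add0r => /andP[s0 s1].
  rewrite -ge0_integralZl//; last by move=> m _; rewrite lee_fin gw_ge0.
  apply: ge0_le_integral => //.
  + by move=> m _; rewrite lee_fin gw_ge0.
  + move=> m _; rewrite -EFinM lee_fin.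
    rewrite (_ : m%:~R + s - psi = m%:~R - psi + s); last by ring.
    by apply: gw_half_ge => //; rewrite ger0_norm// ltW.
Qed.

Lemma integrable_gw_int beta psi : 0 < beta ->
  cnt.-integrable [set: int] (EFin \o (fun m : int => gw beta (m%:~R - psi))).
Proof.
move=> b0; apply/integrableP; split; first exact: measurable_int.
under eq_integral do rewrite /= ger0_norm ?gw_ge0//.
by rewrite (le_lt_trans (theta_finite _ b0))// ltry.
Qed.

Lemma integrable_gw_int_below beta u psi : 0 < beta -> cnt.-integrable [set: int]
  (EFin \o (fun m : int => gw beta (m%:~R - psi) * (m%:~R <= u :> R)%:R)).
Proof.
move=> b0; apply: (le_integrable measurableT _ _ (integrable_gw_int psi b0)).
  exact: measurable_int.
move=> m _ /=; rewrite lee_fin normrM ler_piMr// ger0_norm// lern1.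
by case: (_ <= _).
Qed.

Lemma EFin_theta beta psi : 0 < beta ->
  (theta beta psi)%:E = (\int[cnt]_m (gw beta (m%:~R - psi))%:E)%E.
Proof.
move=> b0; rewrite /theta /Rintegral fineK//; apply: integrable_fin_num => //.
exact: integrable_gw_int.
Qed.

Lemma EFin_theta_below beta u psi : 0 < beta -> (theta_below beta u psi)%:E =
  (\int[cnt]_m (gw beta (m%:~R - psi) * (m%:~R <= u :> R)%:R)%:E)%E.
Proof.
move=> b0; rewrite /theta_below /Rintegral fineK//; apply: integrable_fin_num => //.
exact: integrable_gw_int_below.
Qed.

Lemma theta_le_ub beta psi : 0 < beta -> theta beta psi <= theta_ub beta.
Proof. by move=> b0; rewrite -lee_fin EFin_theta// theta_finite. Qed.

(** The single term at the floor of [psi], within distance [1], is enough. *)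
Lemma theta_ge beta psi : 0 < beta -> gw beta 1 <= theta beta psi.
Proof.
move=> b0; rewrite -lee_fin EFin_theta//; pose k := Num.floor psi.
have h0 m : (0 <= (gw beta (m%:~R - psi))%:E)%E by rewrite lee_fin gw_ge0.
apply: (@le_trans _ _ (\int[cnt]_(m in [set k]) (gw beta (m%:~R - psi))%:E)%E); last first.
  exact: ge0_subset_integral.
rewrite (eq_integral (cst (gw beta (k%:~R - psi))%:E)); last first.
  by move=> m /set_mem ->.
rewrite integral_cst// [X in (_ * X)%E](_ : _ = 1%E); last exact: counting_int1.
rewrite mule1 lee_fin ler_expR lerN2 ler_pM2l ?divr_gt0// expr1n.
have := floor_itv psi; rewrite intrD => /andP[k1 k2].
have : 0 <= (1 - (psi - k%:~R)) * (1 + (psi - k%:~R)) by apply: mulr_ge0; rewrite /k; lra.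
by rewrite -/k; nra.
Qed.

Lemma theta_gt0 beta psi : 0 < beta -> 0 < theta beta psi.
Proof. by move=> b0; apply: (lt_le_trans (gw_gt0 beta 1)); exact: theta_ge. Qed.

Lemma theta_below_ge0 beta u psi : 0 <= theta_below beta u psi.
Proof. by apply: Rintegral_ge0 => m _; rewrite mulr_ge0 ?gw_ge0. Qed.

Lemma theta_below_le beta u psi : 0 < beta ->
  theta_below beta u psi <= theta beta psi.
Proof.
move=> b0; apply: le_Rintegral => //; [exact: integrable_gw_int_below|exact: integrable_gw_int|].
by move=> m _; rewrite ler_piMr ?gw_ge0// lern1; case: (_ <= _).
Qed.

Lemma theta_below_mono beta u v psi : 0 < beta -> u <= v ->
  theta_below beta u psi <= theta_below beta v psi.
Proof.
move=> b0 uv; apply: le_Rintegral => //; [exact: integrable_gw_int_below..|].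
move=> m _; rewrite ler_wpM2l ?gw_ge0// ler_nat.
by case: leP => //= mu; rewrite (le_trans mu uv).
Qed.

Lemma theta_belowD1 beta u psi :
  theta_below beta (u + 1) (psi + 1) = theta_below beta u psi.
Proof.
rewrite /theta_below /Rintegral; congr fine.
rewrite -[LHS](@ge0_integral_int_shift _ _ 1); last first.
  by move=> m; rewrite lee_fin mulr_ge0 ?gw_ge0.
by apply: eq_integral => m _; rewrite intrD lerD2r opprD addrACA subrr addr0.
Qed.

Lemma theta_periodic beta psi : theta beta (psi + 1) = theta beta psi.
Proof.
rewrite /theta /Rintegral; congr fine.
rewrite -[LHS](@ge0_integral_int_shift _ _ 1); last first.
  by move=> m; rewrite lee_fin gw_ge0.
by apply: eq_integral => m _; rewrite intrD opprD addrACA subrr addr0.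
Qed.

Lemma continuous_theta beta : 0 < beta -> continuous (theta beta).
Proof.
move=> b0 a; have b20 : 0 < beta / 2 by rewrite divr_gt0.
have := @continuity_under_integral R _ int cnt
  (fun psi m => gw beta (m%:~R - psi)) setT measurableT (a - 1) (a + 1) _ _
  (fun m => expR (beta / 2) * gw (beta / 2) (m%:~R - a)) _ _ a.
apply => //.
- by move=> x _; exact: integrable_gw_int.
- apply: aeW => m _ x _.
  apply: (@continuous_comp _ _ _ (fun y : R => m%:~R - y) (gw beta)).
    apply: continuousB; [exact: cst_continuous|exact: cvg_id].
  exact: continuous_gw.
- rewrite (_ : _ \o _ = fun m : int => ((expR (beta / 2))%:E * (gw (beta / 2) (m%:~R - a))%:E)%E)//.
  by apply: integrableZl => //; exact: integrable_gw_int.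
- move=> x; rewrite /= in_itv/= => xa; apply: aeW => m _.
  rewrite ger0_norm ?gw_ge0// (_ : m%:~R - a = m%:~R - x + (x - a)); last by ring.
  by apply: gw_half_ge => //; rewrite ler_norml; lra.
- by apply/mem_set; rewrite /= in_itv/=; lra.
Qed.

Lemma bmeas_theta beta : 0 < beta -> bmeas (theta beta).
Proof.
move=> b0; split.
  by apply: continuous_measurable_fun; exact: continuous_theta.
exists (theta_ub beta) => x; rewrite ger0_norm; last exact/ltW/theta_gt0.
exact: theta_le_ub.
Qed.

Lemma bmeas_theta_below beta u : 0 < beta -> bmeas (theta_below beta u).
Proof.
move=> b0; split; last first.
  exists (theta_ub beta) => x; rewrite ger0_norm ?theta_below_ge0//.
  by rewrite (le_trans (theta_below_le _ _ b0))// theta_le_ub.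
apply/measurable_EFinP.
rewrite (_ : _ \o _ = fun psi => \int[cnt]_m (gw beta (m%:~R - psi) * (m%:~R <= u :> R)%:R)%:E)%E; last first.
  by apply/funext => psi /=; rewrite EFin_theta_below.
apply: (@measurable_fun_fubini_tonelli_G _ _ int (measurableTypeR R) R cnt
  (fun p => (gw beta (p.1%:~R - p.2) * (p.1%:~R <= u :> R)%:R)%:E)).
  apply/measurable_EFinP; apply: measurable_funM.
    apply: (measurableT_comp (measurable_gw _)); apply: measurable_funB => //.
    exact: (measurableT_comp (@measurable_int _ _ (fun m : int => m%:~R : R))).
  exact: (measurableT_comp (@measurable_int _ _ (fun m : int => (m%:~R <= u :> R)%:R : R))).
by move=> p; rewrite lee_fin mulr_ge0 ?gw_ge0.
Qed.

End theta_function.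

(** * Comparison of the integer leaf with the Gaussian leaf *)

Section theta_ratio.
Context (R : realType) (beta : R).
Hypothesis beta_gt0 : 0 < beta.
Local Notation mu := (@lebesgue_measure R).
Local Notation cnt := (@counting int R).
Local Notation mass := (gauss_mass beta).
Local Notation theta := (theta beta).
Local Notation theta_below := (theta_below beta).

Let mass_gt0 : 0 < mass. Proof. exact: gauss_mass_gt0. Qed.

Let mass_inv_gt0 : 0 < mass^-1. Proof. by rewrite invr_gt0. Qed.

Lemma avg_unfold (k : R -> R) (psi c : R) : bmeas k -> (forall x, 0 <= k x) ->
  (avg beta k psi)%:E = (\int[mu]_(s in `[c, (c + 1)%R[)
    \int[cnt]_m (k (m%:~R + s)%R * gw beta (m%:~R + s - psi) / mass)%:E)%E.
Proof.
move=> bk k0; have [mk _] := bk.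
have mf : measurable_fun [set: R] (fun x => (k x * gw beta (x - psi) / mass)%:E).
  apply/measurable_EFinP; apply: measurable_funM => //; apply: measurable_funM => //.
  by apply: (measurableT_comp (measurable_gw _)); exact: measurable_funB.
have f0 x : (0 <= (k x * gw beta (x - psi) / mass)%:E)%E.
  by rewrite lee_fin mulr_ge0 ?invr_ge0 ?(ltW mass_gt0)// mulr_ge0 ?gw_ge0.
rewrite EFin_avg// ge0_integral_gauss//; last 2 first.
- by apply/measurable_EFinP; case: (bmeas_shift psi bk).
- by move=> x; rewrite lee_fin.
rewrite -(@integral_unfold _ (fun x => (k x * gw beta (x - psi) / mass)%:E) c)//.
rewrite -[RHS](@ge0_integral_lebesgue_shift _ _ psi)//.
apply: eq_integral => x _; rewrite -EFinM mulrA addrK [psi + x]addrC.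
by [].
Qed.

(** [theta / mass] is the density of the Gaussian wrapped around the circle. *)
Lemma avg_periodic (k : R -> R) (psi c : R) : bmeas k -> (forall x, 0 <= k x) ->
  (forall (m : int) x, k (m%:~R + x) = k x) ->
  (avg beta k psi)%:E =
  (\int[mu]_(s in `[c, (c + 1)%R[) (k s * (theta (psi - s) / mass))%:E)%E.
Proof.
move=> bk k0 kp; rewrite (avg_unfold psi c bk k0); apply: eq_integral => s _.
have h (m : int) : gw beta (m%:~R + s - psi) = gw beta (m%:~R - (psi - s)).
  by congr gw; ring.
under eq_integral do rewrite kp h mulrAC EFinM.
rewrite ge0_integralZl//.
- by rewrite -EFin_theta// -EFinM mulrAC mulrA.
- by move=> m _; rewrite lee_fin gw_ge0.
- by rewrite lee_fin mulr_ge0// invr_ge0 ltW.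
Qed.

(** A Gaussian variable centred at [psi] is split into an integer and a fractional part [s]; given
    [s], the integer part carries the weights of an integer leaf at [psi - s]. *)
Lemma Phi_unfold u psi : (Phi beta (u - psi))%:E =
  (\int[mu]_(s in `[0%R, (0 + 1)%R[) (theta_below (u - s) (psi - s) / mass)%:E)%E.
Proof.
have -> : Phi beta (u - psi) = avg beta \1_`]-oo, u] psi.
  congr gmean; apply/funext => x; rewrite !indicE !mem_setE !in_itv/=.
  by rewrite lerBrDl.
rewrite (avg_unfold psi 0)//; [|exact: bmeas_indic].
apply: eq_integral => s _.
have h (m : int) : gw beta (m%:~R + s - psi) = gw beta (m%:~R - (psi - s)).
  by congr gw; ring.
have h' (m : int) : \1_`]-oo, u] (m%:~R + s) = (m%:~R <= u - s :> R)%:R :> R.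
  by rewrite indicE mem_setE in_itv/= lerBrDr.
under eq_integral do rewrite h h' mulrC [X in _ * X]mulrC EFinM.
rewrite ge0_integralZl//.
- by rewrite -EFin_theta_below// -EFinM mulrC.
- by move=> m _; rewrite lee_fin mulr_ge0 ?gw_ge0.
- by rewrite lee_fin invr_ge0 ltW.
Qed.

Lemma integral_theta psi :
  (\int[mu]_(s in `[0%R, (0 + 1)%R[) (theta (psi - s) / mass)%:E = 1)%E.
Proof.
have := @avg_periodic (fun=> 1) psi 0 (bmeas_cst 1) (fun=> ler01) (fun _ _ => erefl).
by rewrite avg_cst => ->; apply: eq_integral => s _; rewrite mul1r.
Qed.

Definition theta_ratio u psi : R := theta_below u psi / theta psi.

(* Likelihood ratio: for [m <= u < m'] and [psi <= psi'], the product of the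
   weights of [m] at [psi'] and of [m'] at [psi] is the smaller one. *)
Lemma theta_ratio_noninc u psi psi' : psi <= psi' ->
  theta_ratio u psi' <= theta_ratio u psi.
Proof.
move=> pp; have t0 x : 0 < theta x by exact: theta_gt0.
rewrite /theta_ratio ler_pdivrMr// mulrAC ler_pdivlMr//.
pose above x : R := \int[cnt]_m (gw beta (m%:~R - x) * (u < m%:~R :> R)%:R).
have ia x : cnt.-integrable [set: int]
    (EFin \o (fun m : int => gw beta (m%:~R - x) * (u < m%:~R :> R)%:R)).
  apply: (le_integrable measurableT _ _ (integrable_gw_int x beta_gt0)).
    exact: measurable_int.
  move=> m _ /=; rewrite lee_fin normrM ler_piMr// ger0_norm// lern1.
  by case: (_ < _).
have ib x := integrable_gw_int_below u x beta_gt0.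
have tE x : theta x = theta_below u x + above x.
  rewrite /theta_below /above -RintegralD//; apply: eq_Rintegral => m _.
  by rewrite -mulrDr; case: leP => _; rewrite ?addr0 ?add0r mulr1.
suff : theta_below u psi' * above psi <= theta_below u psi * above psi'.
  by rewrite !tE; lra.
rewrite -RintegralZl// -RintegralZl//; apply: le_Rintegral => //.
- rewrite (_ : _ \o _ = fun m : int => ((theta_below u psi')%:E *
    (gw beta (m%:~R - psi) * (u < m%:~R :> R)%:R)%:E)%E)//.
  by apply: integrableZl => //; exact: ia.
- rewrite (_ : _ \o _ = fun m : int => ((theta_below u psi)%:E *
    (gw beta (m%:~R - psi') * (u < m%:~R :> R)%:R)%:E)%E)//.
  by apply: integrableZl => //; exact: ia.
move=> m _; have [um|um] := ltP u m%:~R; last by rewrite !mulr0.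
rewrite !mulr1 /theta_below -RintegralZr// -RintegralZr//; apply: le_Rintegral => //.
- rewrite (_ : _ \o _ = fun l : int => ((gw beta (l%:~R - psi') * (l%:~R <= u :> R)%:R)%:E *
    (gw beta (m%:~R - psi))%:E)%E)//.
  by apply: integrableZr => //; exact: ib.
- rewrite (_ : _ \o _ = fun l : int => ((gw beta (l%:~R - psi) * (l%:~R <= u :> R)%:R)%:E *
    (gw beta (m%:~R - psi'))%:E)%E)//.
  by apply: integrableZr => //; exact: ib.
move=> l _; have [lu|lu] := leP l%:~R u; last by rewrite !mulr0 !mul0r.
rewrite !mulr1 -!expRD ler_expR -subr_ge0.
rewrite [X in 0 <= X](_ : _ = beta * ((m%:~R - l%:~R) * (psi' - psi))); last by field.
by rewrite mulr_ge0 ?(ltW beta_gt0)// mulr_ge0 ?subr_ge0// (le_trans lu)// ltW.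
Qed.

Let measurable_theta_shift x : measurable_fun [set: R] (fun s => (theta (x - s) / mass)%:E).
Proof.
have [mt _] := bmeas_theta beta_gt0.
apply/measurable_EFinP; apply: measurable_funM => //.
by apply: (measurableT_comp mt); exact: measurable_funB.
Qed.

Let measurable_below_diag u x :
  measurable_fun [set: R] (fun s => (theta_below (u - s) (x - s) / mass)%:E).
Proof.
apply/measurable_EFinP; apply: measurable_funM => //; apply/measurable_EFinP.
rewrite (_ : _ \o _ = fun s => \int[cnt]_m
    (gw beta (m%:~R - (x - s)) * (m%:~R <= u - s :> R)%:R)%:E)%E; last first.
  by apply/funext => s /=; rewrite EFin_theta_below.
apply: (@measurable_fun_fubini_tonelli_G _ _ int (measurableTypeR R) R cnt
  (fun p => (gw beta (p.1%:~R - (x - p.2)) * (p.1%:~R <= u - p.2 :> R)%:R)%:E)).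
  have mf : measurable_fun [set: R] (fun y => (gw beta (y - x) * \1_`]-oo, u] y)%:E).
    apply/measurable_EFinP; apply: measurable_funM.
      by apply: (measurableT_comp (measurable_gw _)); exact: measurable_funB.
    exact: measurable_indic.
  apply: eq_measurable_fun (measurable_intX mf) => p _.
  rewrite indicE mem_setE in_itv/= lerBrDr; congr (gw _ _ * _)%:E; ring.
by move=> p; rewrite lee_fin mulr_ge0 ?gw_ge0.
Qed.

Let below_div_ge0 u x : (0 <= (theta_below u x / mass)%:E)%E.
Proof. by rewrite lee_fin divr_ge0 ?theta_below_ge0// ltW. Qed.

(** [Phi_unfold] at [psi + 1] bounds the Gaussian probability by an average of
    [theta_ratio u (psi + 1 - s)] whose weights have total mass [1]. As [psi + 1 - s >= psi],
    monotonicity in [psi] concludes. *)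
Lemma theta_ratio_ge u psi : Phi beta (u - 1 - psi) <= theta_ratio u psi.
Proof.
have t0 x : 0 < theta x by exact: theta_gt0.
have p0 : 0 <= theta_ratio u psi by rewrite divr_ge0 ?theta_below_ge0// ltW.
rewrite (_ : u - 1 - psi = u - (psi + 1)); last by ring.
rewrite -lee_fin Phi_unfold -[leRHS]mule1 -(integral_theta (psi + 1)).
rewrite -ge0_integralZl//; last 2 first.
- by apply: measurable_funTS; exact: measurable_theta_shift.
- by move=> s _; rewrite lee_fin divr_ge0 ?ltW.
apply: ge0_le_integral => //.
- by apply: measurable_funTS; exact: measurable_below_diag.
- by apply: measurable_funTS; apply: measurable_funeM; exact: measurable_theta_shift.
move=> s; rewrite /= in_itv/= add0r => /andP[s0 s1].
rewrite -EFinM lee_fin mulrA ler_pM2r ?mass_inv_gt0//.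
rewrite -ler_pdivrMr//; apply: (@le_trans _ _ (theta_ratio u (psi + 1 - s))).
  by rewrite ler_pM2r ?invr_gt0// theta_below_mono// gerDl oppr_le0.
by apply: theta_ratio_noninc; lra.
Qed.

(** The same average at [psi - 1]: lowering [u - s] to [u - 1] allows [u] and [psi] to be moved
    together by one lattice spacing, after which the ratio is read at [psi - s <= psi]. *)
Lemma theta_ratio_le u psi : theta_ratio u psi <= Phi beta (u + 1 - psi).
Proof.
have t0 x : 0 < theta x by exact: theta_gt0.
have p0 : 0 <= theta_ratio u psi by rewrite divr_ge0 ?theta_below_ge0// ltW.
rewrite (_ : u + 1 - psi = u - (psi - 1)); last by ring.
rewrite -lee_fin Phi_unfold -[leLHS]mule1 -(integral_theta (psi - 1)).
rewrite -ge0_integralZl//; last 2 first.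
- by apply: measurable_funTS; exact: measurable_theta_shift.
- by move=> s _; rewrite lee_fin divr_ge0 ?ltW.
apply: ge0_le_integral => //.
- by move=> s _; rewrite mule_ge0 ?lee_fin// divr_ge0 ?ltW.
- by apply: measurable_funTS; apply: measurable_funeM; exact: measurable_theta_shift.
- by apply: measurable_funTS; exact: measurable_below_diag.
move=> s; rewrite /= in_itv/= add0r => /andP[s0 s1].
rewrite -EFinM lee_fin mulrA ler_pM2r ?mass_inv_gt0//.
apply: (@le_trans _ _ (theta_below (u - 1) (psi - 1 - s))); last first.
  by apply: theta_below_mono => //; lra.
rewrite -ler_pdivlMr//.
have -> : theta_below (u - 1) (psi - 1 - s) = theta_below u (psi - s).
  by rewrite -(theta_belowD1 beta (u - 1)) subrK (_ : psi - 1 - s + 1 = psi - s)//; ring.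
rewrite -(theta_periodic beta (psi - 1 - s)) (_ : psi - 1 - s + 1 = psi - s); last by ring.
by apply: theta_ratio_noninc; lra.
Qed.

End theta_ratio.

(** * [theta] as a limit of trigonometric polynomials *)

Section theta_trigonometric.
Context (R : realType) (beta : R).
Hypothesis beta_gt0 : 0 < beta.
Local Notation mu := (@lebesgue_measure R).
Local Notation mass := (gauss_mass beta).
Local Notation theta := (theta beta).

(** The period is centred at [0], where the kernel [k N] concentrates. *)
Let c0 : R := - 2^-1.
Let D : set R := [set` `[c0, (c0 + 1)%R[].
Let k N (s : R) : R := cos (pi * s) ^+ (2 * N).
Let I N : R := \int[mu]_(s in D) k N s.

Let measD : measurable D. Proof. exact: measurable_itv. Qed.

Let muD : mu D = 1%E.
Proof.
rewrite /D lebesgue_measure_itv/= lte_fin ltrDl ltr01 -EFinB.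
by congr EFin; ring.
Qed.

Let integrableD (f : R -> R) : bmeas f -> mu.-integrable D (EFin \o f).
Proof.
move=> [mf [M fM]]; apply: measurable_bounded_integrable => //.
- by apply: (@eq_ind_r _ 1%E (fun z => (z < +oo)%E)) muD; exact: ltry.
- exact: measurable_funTS.
- by exists M; split; [exact: num_real | move=> N MN x _ /=; exact/(le_trans (fM _))/ltW].
Qed.

Let bk N : bmeas (k N).
Proof. by apply: bmeasX; exact: bmeas_cos. Qed.

Let k_ge0 N s : 0 <= k N s.
Proof. by rewrite /k exprM exprn_ge0// sqr_ge0. Qed.

Lemma cos_pi_sqr_periodic (m : int) (x : R) :
  cos (pi * (m%:~R + x)) ^+ 2 = cos (pi * x) ^+ 2.
Proof.
have h (n : nat) (y : R) : cos (pi * (n%:R + y)) ^+ 2 = cos (pi * y) ^+ 2.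
  elim: n => [|n ih]; first by rewrite add0r.
  rewrite -ih (_ : pi * (n.+1%:R + y) = pi * (n%:R + y) + pi); last first.
    by rewrite -[n.+1%:R]natr1; ring.
  by rewrite cosDpi sqrrN.
case: m => n; first by rewrite -pmulrn h.
by rewrite -(h n.+1) NegzE mulrNz -pmulrn addrA subrr add0r.
Qed.

Let k_periodic N (m : int) (s : R) : k N (m%:~R + s) = k N s.
Proof. by rewrite /k !exprM cos_pi_sqr_periodic. Qed.

Let cos_pi_lt (x y : R) : 0 <= x -> x < y -> y <= 1 -> cos (pi * y) < cos (pi * x).
Proof.
move=> x0 xy y1; have p0 := pi_gt0 R.
have hx : 0 <= pi * x by rewrite mulr_ge0 ?(ltW p0).
have hxy : pi * x < pi * y by rewrite ltr_pM2l.
have hy : pi * y <= pi by rewrite ler_piMr ?(ltW p0).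
by rewrite ltr_cos// in_itv/=; lra.
Qed.

Let cos_pi_le (x y : R) : 0 <= x -> x <= y -> y <= 1 -> cos (pi * y) <= cos (pi * x).
Proof.
move=> x0; rewrite le_eqVlt => /orP[/eqP->//|xy y1]; exact/ltW/cos_pi_lt.
Qed.

Let cos_half_ge0 (d : R) : 0 <= d <= 2^-1 -> 0 <= cos (pi * d).
Proof.
move=> d01; have p0 := pi_gt0 R; apply: cos_ge0_pihalf.
have : 0 <= pi * d by rewrite mulr_ge0 ?(ltW p0)//; lra.
have : pi * d <= pi / 2 by rewrite ler_pM2l//; lra.
by lra.
Qed.

Let cos_half_gt0 (d : R) : 0 <= d < 2^-1 -> 0 < cos (pi * d).
Proof.
move=> d01; have p0 := pi_gt0 R; apply: cos_gt0_pihalf.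
have : 0 <= pi * d by rewrite mulr_ge0 ?(ltW p0)//; lra.
have : pi * d < pi / 2 by rewrite ltr_pM2l//; lra.
by lra.
Qed.

Let k_tail N (s d : R) : 0 <= d -> d <= `|s| -> D s -> k N s <= (cos (pi * d) ^+ 2) ^+ N.
Proof.
move=> d0 ds; rewrite /D/= in_itv/= => sD.
have s2 : `|s| <= 2^-1 by rewrite ler_norml; move: sD; rewrite /c0; lra.
have cs : cos (pi * s) = cos (pi * `|s|).
  by case: (ger0P s) => // _; rewrite mulrN cosN.
rewrite /k exprM cs lerXn2r ?nnegrE ?sqr_ge0//.
have c1 : 0 <= cos (pi * `|s|) by apply: cos_half_ge0; lra.
have c2 : cos (pi * `|s|) <= cos (pi * d) by apply: cos_pi_le => //; lra.
by rewrite lerXn2r ?nnegrE// (le_trans c1).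
Qed.

Let I_ge N (d : R) : 0 < d < 2^-1 -> d * (cos (pi * d) ^+ 2) ^+ N <= I N.
Proof.
move=> d01; have p0 := pi_gt0 R; rewrite -lee_fin.
have -> : (I N)%:E = (\int[mu]_(s in D) (k N s)%:E)%E.
  by rewrite /I /Rintegral fineK//; apply: integrable_fin_num => //; exact: integrableD.
have [mk _] := bk N.
have cd := cos_half_gt0.
apply: (@le_trans _ _ (\int[mu]_(s in `[0%R, d]) (k N s)%:E)%E); last first.
  apply: ge0_subset_integral => //.
  - by apply/measurable_EFinP; exact: measurable_funTS.
  - by move=> s _; rewrite lee_fin.
  - by move=> s /=; rewrite /D /= !in_itv/= /c0; lra.
have -> : (d * (cos (pi * d) ^+ 2) ^+ N)%:E =
    (\int[mu]_(s in `[0%R, d]) ((cos (pi * d) ^+ 2) ^+ N)%:E)%E.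
  rewrite integral_cst//= lebesgue_measure_itv/= lte_fin.
  have -> : 0 < d by lra.
  by rewrite sube0 -EFinM mulrC.
apply: ge0_le_integral => //.
- by move=> s _; rewrite lee_fin exprn_ge0// sqr_ge0.
- by apply/measurable_EFinP; exact: measurable_funTS.
move=> s; rewrite /= in_itv/= => sd; rewrite lee_fin /k exprM.
have c1 : 0 < cos (pi * s) by apply: cd; lra.
have c2 : 0 < cos (pi * d) by apply: cd; lra.
rewrite lerXn2r ?nnegrE ?sqr_ge0// lerXn2r ?nnegrE ?(ltW c1) ?(ltW c2)//.
by apply: cos_pi_le; lra.
Qed.

Let I_gt0 N : 0 < I N.
Proof.
have d01 : 0 < (4^-1 : R) < 2^-1 by lra.
have c : 0 < cos (pi * (4^-1 : R)) by apply: cos_half_gt0; lra.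
by apply: lt_le_trans (I_ge N d01); rewrite mulr_gt0 ?exprn_gt0.
Qed.

(* [cos (pi s) ^ (2 N) / I N] approximates the Dirac comb, whose Gaussian average
   is [theta / mass]. *)
Let g N psi : R := mass / I N * avg beta (k N) psi.

Let bmeas_kt N psi : bmeas (fun s => k N s * theta (psi - s)).
Proof.
apply: bmeasM => //; have bt := bmeas_theta beta_gt0.
by apply: (@bmeas_comp _ _ (fun s => psi - s)) bt; exact: measurable_funB.
Qed.

Let gE N psi : g N psi = (\int[mu]_(s in D) (k N s * theta (psi - s))) / I N.
Proof.
have m0 : mass != 0 by rewrite gt_eqF// gauss_mass_gt0.
have -> : \int[mu]_(s in D) (k N s * theta (psi - s)) = mass * avg beta (k N) psi.
  have := avg_periodic beta_gt0 psi c0 (bk N) (k_ge0 N) (k_periodic N).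
  move=> /(congr1 fine) /= ->; rewrite -/(Rintegral mu D _) -RintegralZl//.
    by apply: eq_Rintegral => s _; rewrite mulrCA; congr (_ * _); field.
  apply: integrableD; under eq_fun do rewrite mulrA mulrC.
  exact: bmeasZ.
by rewrite /g mulrAC.
Qed.

(** Usual approximate-identity estimate: near [0] continuity gives [e], away from [0] the kernel is
    at most [cos (pi d) ^ (2 N)]. Its mass [I N] is bounded below on [[0, d / 2]], which leaves a
    geometric error of ratio less than [1]. *)
Let g_dist N (psi e d : R) : 0 <= e -> 0 < d < 2^-1 ->
  (forall s, `|s| < d -> `|theta (psi - s) - theta psi| <= e) ->
  `|g N psi - theta psi| <=
  e + 4 * theta_ub beta / d * (cos (pi * d) ^+ 2 / cos (pi * (d / 2)) ^+ 2) ^+ N.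
Proof.
move=> e0 d01 ed; have IN := I_gt0 N.
pose T := 2 * theta_ub beta * (cos (pi * d) ^+ 2) ^+ N.
have tu x : 0 <= theta x <= theta_ub beta.
  by rewrite theta_le_ub// andbT ltW// theta_gt0.
have u0 : 0 <= theta_ub beta by have := tu 0; lra.
have T0 : 0 <= T by apply: mulr_ge0; [exact: mulr_ge0|rewrite exprn_ge0 ?sqr_ge0].
have bd : bmeas (fun s => k N s * theta (psi - s) + (- theta psi) * k N s).
  by apply: bmeasD; [exact: bmeas_kt|exact: bmeasZ].
have -> : g N psi - theta psi =
    (\int[mu]_(s in D) (k N s * theta (psi - s) + (- theta psi) * k N s)) / I N.
  rewrite gE RintegralD//; [|exact/integrableD/bmeas_kt|exact/integrableD/bmeasZ].
  rewrite RintegralZl//; last exact: integrableD.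
  by rewrite -/(I N); field; rewrite gt_eqF.
rewrite normrM [X in _ * X]gtr0_norm ?invr_gt0// ler_pdivrMr//.
apply: (@le_trans _ _ (e * I N + T)).
  apply: le_trans; first by apply: le_normr_Rintegral => //; exact: integrableD.
  have -> : e * I N + T = \int[mu]_(s in D) (e * k N s + T).
    rewrite RintegralD//; [|exact/integrableD/bmeasZ|exact/integrableD/bmeas_cst].
    rewrite RintegralZl//; last exact: integrableD.
    rewrite Rintegral_cst// (_ : fine _ = 1) ?mulr1//.
    by rewrite -[RHS]/(fine 1%E); congr fine; exact: muD.
  apply: le_Rintegral => //.
  - by apply: integrable_norm; exact: integrableD.
  - by apply: integrableD; apply: bmeasD => //; exact: bmeasZ.
  move=> s Ds; rewrite (_ : _ + _ = k N s * (theta (psi - s) - theta psi)); last by ring.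
  rewrite normrM ger0_norm//.
  have [sd|ds] := ltP `|s| d.
    by rewrite -[leLHS]addr0 lerD// mulrC ler_wpM2r// ed.
  rewrite -[leLHS]add0r lerD ?mulr_ge0//.
  apply: (@le_trans _ _ ((cos (pi * d) ^+ 2) ^+ N * (2 * theta_ub beta))).
    rewrite ler_pM//; first by apply: k_tail => //; lra.
    by have := tu (psi - s); have := tu psi; rewrite ler_norml; lra.
  by rewrite mulrC.
rewrite mulrDl lerD2l.
have d2 : 0 < d / 2 < 2^-1 by lra.
have c2 : 0 < cos (pi * (d / 2)) ^+ 2 by rewrite exprn_gt0// cos_half_gt0//; lra.
apply: (@le_trans _ _ (4 * theta_ub beta / d * (cos (pi * d) ^+ 2 / cos (pi * (d / 2)) ^+ 2) ^+ N *
  (d / 2 * (cos (pi * (d / 2)) ^+ 2) ^+ N))); last first.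
  rewrite ler_wpM2l ?I_ge// mulr_ge0//.
    by apply: divr_ge0; [exact: mulr_ge0|lra].
  by rewrite exprn_ge0// divr_ge0 ?sqr_ge0.
rewrite le_eqVlt; apply/orP; left; apply/eqP; rewrite /T expr_div_n.
have qn : (cos (pi * (d / 2)) ^+ 2) ^+ N != 0 by rewrite gt_eqF// (exprn_gt0 N c2).
have dn : d != 0 by rewrite gt_eqF//; lra.
set q := (cos (pi * (d / 2)) ^+ 2) ^+ N in qn *; set p := (cos (pi * d) ^+ 2) ^+ N.
by field; rewrite dn qn.
Qed.

(** This takes the place of Poisson summation. The kernel has coefficient ratios at most [1], and
    one Gaussian average lowers them to [contraction]. *)
Lemma trig_limit_theta : trig_limit (contraction beta) theta.
Proof.
split; first exact: bmeas_theta.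
have m0 := gauss_mass_gt0 beta_gt0.
exists g, (theta_ub beta); split.
- move=> N; apply: trig_classZ; first by rewrite divr_ge0 ?ltW.
  rewrite -[contraction beta]mulr1; apply: trig_class_avg => //.
  exact: trig_class_cos_pow.
- move=> N x; rewrite gE normrM [X in _ * X]gtr0_norm ?invr_gt0// ler_pdivrMr//.
  have tu y : 0 <= theta y <= theta_ub beta.
    by rewrite theta_le_ub// andbT ltW// theta_gt0.
  rewrite ger0_norm; last first.
    by apply: Rintegral_ge0 => s _; rewrite mulr_ge0//; have := tu (x - s); lra.
  rewrite -RintegralZl//; last exact: integrableD.
  apply: le_Rintegral => //; [exact/integrableD/bmeas_kt|exact/integrableD/bmeasZ|].
  by move=> s _; rewrite mulrC ler_wpM2r//; have := tu (x - s); lra.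
move=> psi; apply/cvgrPdist_le => e e0.
have e20 : 0 < e / 2 by lra.
have /cvgrPdist_le/(_ _ e20) := @continuous_theta R beta beta_gt0 psi.
move=> /nbhs_ballP[d /= d0 dP].
(* The cap [4^-1] keeps [d'] below [2^-1], where the cosines involved are positive. *)
pose d' := Num.min d 4^-1.
have d'd : d' <= d by rewrite /d' ge_min lexx.
have d'4 : d' <= 4^-1 by rewrite /d' ge_min lexx orbT.
have d'0 : 0 < d' by rewrite /d' lt_min d0/=; lra.
have d'01 : 0 < d' < 2^-1 by lra.
have ed s : `|s| < d' -> `|theta (psi - s) - theta psi| <= e / 2.
  move=> sd; rewrite distrC; apply: dP; rewrite /ball/=.
  by rewrite opprB addrCA subrr addr0 (lt_le_trans sd).
set q := cos (pi * d') ^+ 2 / cos (pi * (d' / 2)) ^+ 2.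
have q1 : `|q| < 1.
  have c1 : 0 < cos (pi * d') by apply: cos_half_gt0; lra.
  have c2 : 0 < cos (pi * (d' / 2)) by apply: cos_half_gt0; lra.
  have p0 := pi_gt0 R.
  rewrite ger0_norm ?divr_ge0 ?sqr_ge0// ltr_pdivrMr ?exprn_gt0// mul1r.
  by rewrite ltrXn2r ?nnegrE ?(ltW c1) ?(ltW c2)//= cos_pi_lt//; lra.
have := @cvg_geometric R (4 * theta_ub beta / d') q q1.
move=> /cvgrPdist_le/(_ _ e20) H; near=> N.
rewrite distrC (le_trans (g_dist N (ltW e20) d'01 ed))// -/q.
have : `|0 - geometric (4 * theta_ub beta / d') q N| <= e / 2 by near: N.
rewrite sub0r normrN /geometric/= => /(le_trans (ler_norm _)).
by lra.
Unshelve. all: by end_near. Qed.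

End theta_trigonometric.

(** * The renormalization map and the distribution function of the GFF maximum *)

Section renormalization.
Context (R : realType) (b : nat) (beta : R).
Hypotheses (b_gt1 : (1 < b)%N) (beta_gt0 : 0 < beta).
Local Notation Phi := (Phi beta).
Local Notation avg := (avg beta).
Local Notation gmean := (gmean beta).

Definition rg (f : R -> R) : R -> R := avg (fun x => f x ^+ b).

Lemma bmeas_iter_rg n f : bmeas f -> bmeas (iter n rg f).
Proof. by move=> bf; elim: n => //= n ih; exact/bmeas_avg/bmeasX. Qed.

Lemma rg_le f g : bmeas f -> bmeas g -> (forall x, 0 <= f x <= g x) ->
  forall x, 0 <= rg f x <= rg g x.
Proof.
move=> bf bg fg x; apply/andP; split.
  by apply: avg_ge0 => z; rewrite exprn_ge0//; have /andP[] := fg z.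
apply: avg_le; [exact: bmeasX..|] => z; have /andP[f0 fgz] := fg z.
by rewrite lerXn2r ?nnegrE// (le_trans f0).
Qed.

Lemma iter_rg_le n f g : bmeas f -> bmeas g -> (forall x, 0 <= f x <= g x) ->
  forall x, 0 <= iter n rg f x <= iter n rg g x.
Proof.
by move=> bf bg fg; elim: n => //= n ih; apply: rg_le => //; exact: bmeas_iter_rg.
Qed.

Lemma rg1 n x : iter n rg (fun=> 1) x = 1.
Proof.
elim: n x => //= n ih x; rewrite /rg -[RHS](avg_cst beta 1 x); congr (avg _ _).
by apply/funext => z; rewrite ih expr1n.
Qed.

Lemma iter_rg_shift n f c x : iter n rg (fun z => f (z + c)) x = iter n rg f (x + c).
Proof.
elim: n x => //= n ih x; rewrite /rg -avg_shift; congr (avg _ _).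
by apply/funext => z; rewrite ih.
Qed.

Lemma iter_rg_gt0 n f (c : R) : bmeas f -> 0 < c -> (forall x, c <= f x) ->
  exists2 c', 0 < c' & forall x, c' <= iter n rg f x.
Proof.
move=> bf c0 cf; elim: n => [|n [c' c'0 c'f]]; first by exists c.
exists (c' ^+ b) => /=; first exact: exprn_gt0.
move=> x; rewrite -(avg_cst beta (c' ^+ b) x); apply: avg_le => //.
  exact/bmeasX/bmeas_iter_rg.
by move=> z; rewrite lerXn2r ?nnegrE ?(ltW c'0)// (le_trans (ltW c'0)).
Qed.

(** [Phi (u - psi)] accounts for the additional Gaussian at a leaf reached with value [psi]; the
    walk starts from [0]. *)
Definition gff_cdf n u : R := iter n rg (fun psi => Phi (u - psi)) 0.

Lemma bmeas_Phi : bmeas Phi.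
Proof.
split; last first.
  by exists 1 => x; rewrite ger0_norm ?Phi_ge0// Phi_le1.
by apply: nondecreasing_measurable => // x y *; exact: Phi_mono.
Qed.

Lemma bmeas_Phi_sub u : bmeas (fun psi => Phi (u - psi)).
Proof. by apply: (@bmeas_comp _ _ (fun x => u - x)) bmeas_Phi; exact: measurable_funB. Qed.

Lemma gff_cdfE n u psi : iter n rg (fun z => Phi (u - z)) psi = gff_cdf n (u - psi).
Proof.
rewrite /gff_cdf -{1}[psi]add0r -iter_rg_shift.
by congr (iter _ _ _ _); apply/funext => z; congr Phi; ring.
Qed.

Lemma gff_cdf01 n u : 0 <= gff_cdf n u <= 1.
Proof.
rewrite -[X in _ <= _ <= X](rg1 n 0); apply: iter_rg_le => //.
  exact: bmeas_Phi_sub.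
by move=> x; rewrite Phi_ge0 Phi_le1.
Qed.

Lemma gff_cdf_mono n u v : u <= v -> gff_cdf n u <= gff_cdf n v.
Proof.
move=> uv; have H x : 0 <= Phi (u - x) <= Phi (v - x).
  by rewrite Phi_ge0 Phi_mono// lerD2r.
by have /andP[] := @iter_rg_le n _ _ (bmeas_Phi_sub u) (bmeas_Phi_sub v) H 0.
Qed.

Lemma bmeas_gff_cdf n : bmeas (gff_cdf n).
Proof.
split; last by exists 1 => x; have /andP[h1 h2] := gff_cdf01 n x; rewrite ger0_norm.
by apply: nondecreasing_measurable => // x y *; exact: gff_cdf_mono.
Qed.

Lemma gff_cdfS n u : gff_cdf n.+1 u = gmean (fun z => gff_cdf n (u - z) ^+ b).
Proof.
by rewrite /gff_cdf /= /rg /avg; congr gmean; apply/funext => z; rewrite gff_cdfE add0r.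
Qed.

(** On [[0, 1]] the [b]-th power is [b]-Lipschitz, and averaging preserves Lipschitz constants. The
    bound worsens with [n], but only continuity at fixed [n] is drawn from it. *)
Lemma gff_cdf_lipschitz n u v : u <= v ->
  gff_cdf n v - gff_cdf n u <= b%:R ^+ n * ((v - u) / gauss_mass beta).
Proof.
elim: n u v => [|n ih] u v uv.
  by rewrite mul1r /gff_cdf /= !subr0; exact: Phi_lipschitz.
have bs w : bmeas (fun z => gff_cdf n (w - z) ^+ b).
  apply: bmeasX.
  by apply: (@bmeas_comp _ _ (fun x => w - x)) (bmeas_gff_cdf n); exact: measurable_funB.
rewrite !gff_cdfS -[X in _ - X]mul1r -mulNr -gmeanZ// -gmeanD//; last exact: bmeasZ.
rewrite -[leRHS](gmean_cst beta); apply: gmean_le => //.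
  by apply: bmeasD => //; exact: bmeasZ.
move=> z; rewrite mulN1r exprS -mulrA.
have := ih (u - z) (v - z).
rewrite lerD2r => /(_ uv).
rewrite (_ : v - z - (u - z) = v - u); last by ring.
have xy : gff_cdf n (u - z) <= gff_cdf n (v - z) by rewrite gff_cdf_mono// lerD2r.
have /andP[x0 x1] := gff_cdf01 n (u - z); have /andP[y0 y1] := gff_cdf01 n (v - z).
move: (gff_cdf n (u - z)) (gff_cdf n (v - z)) xy x0 x1 y0 y1 => x y xy x0 x1 y0 y1 H.
rewrite addrC [- _ + _]addrC subrXX.
apply: (@le_trans _ _ (b%:R * (y - x))); last by rewrite ler_wpM2l.
rewrite mulrC ler_wpM2r ?subr_ge0//.
rewrite (le_trans (_ : _ <= \sum_(i < b) 1))//; last by rewrite sumr_const card_ord.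
by apply: ler_sum => i _; rewrite mulr_ile1 ?exprn_ge0// exprn_ile1.
Qed.

End renormalization.

(** * Flattening of the partition functions and the sandwich *)

Section flattening.
Context (R : realType) (b : nat) (beta : R).
Hypotheses (b_gt1 : (1 < b)%N) (beta_gt0 : 0 < beta).
Hypothesis beta_lt : beta < beta_c R b.
Local Notation theta := (theta beta).
Local Notation theta_below := (theta_below beta).
Local Notation gmean := (gmean beta).
Local Notation rg := (rg b beta).
Local Notation gff_cdf := (gff_cdf b beta).

Let q : R := contraction beta * b%:R.

Let q_gt0 : 0 < q.
Proof. by rewrite mulr_gt0 ?expR_gt0// ltr0n ltnW. Qed.

(** The condition [beta < beta_c] says exactly that [ln b < 2 pi^2 / beta]. *)
Let q_lt1 : q < 1.
Proof.
have b0 : 0 < b%:R :> R by rewrite ltr0n ltnW.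
have lb : 0 < ln (b%:R : R) by rewrite ln_gt0// ltr1n.
rewrite /q -[X in _ * X]lnK ?posrE// -expRD -[ltRHS]expR0 ltr_expR.
rewrite addrC subr_lt0 ltr_pdivlMr//.
by move: beta_lt; rewrite /beta_c ltr_pdivlMr// mulrC.
Qed.

Let v n := iter n rg theta.

Let bv n : bmeas (v n).
Proof. by apply: bmeas_iter_rg; exact: bmeas_theta. Qed.

Let v_gt0 n x : 0 < v n x.
Proof.
have [c c0 H] := @iter_rg_gt0 R b beta n _ _ (bmeas_theta beta_gt0) (gw_gt0 beta 1)
  (fun x => theta_ge x beta_gt0).
exact: lt_le_trans (H x).
Qed.

Let trig_limit_v n : trig_limit (q ^+ n * contraction beta) (v n).
Proof.
elim: n => [|n ih]; first by rewrite mul1r; exact: trig_limit_theta.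
have r0 : 0 <= q ^+ n * contraction beta.
  by rewrite mulr_ge0 ?exprn_ge0 ?(ltW q_gt0)// expR_ge0.
have := trig_limit_avgX beta_gt0 b r0 ih; rewrite exprS mulrA -/q.
by rewrite -!mulrA.
Qed.

(** The chord of the convex function [(1 + 8 r) ^ n] between [r = 0] and [r = 1]. *)
Let pow_bound (r : R) n : 0 <= r <= 1 -> (1 + 8 * r) ^+ n <= 1 + (9 ^+ n - 1) * r.
Proof.
move=> r01; elim: n => [|n ih]; first by rewrite !expr0; lra.
rewrite !exprS; have n9 : 1 <= 9 ^+ n :> R by rewrite exprn_ege1//; lra.
apply: (@le_trans _ _ ((1 + 8 * r) * (1 + (9 ^+ n - 1) * r))).
  by rewrite ler_wpM2l//; lra.
have : 0 <= (9 ^+ n - 1) * r * (1 - r) by rewrite !mulr_ge0//; lra.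
by lra.
Qed.

Let ratio_tail n x y : q ^+ n <= 6^-1 ->
  v n x ^+ b <= (1 + 9 ^+ b * q ^+ n) * v n y ^+ b.
Proof.
move=> q6; set r := q ^+ n * contraction beta.
have c0 : 0 < contraction beta by exact: expR_gt0.
have c1 : contraction beta <= 1.
  rewrite -expR0 ler_expR oppr_le0; apply: divr_ge0; last exact: ltW.
  by apply: mulr_ge0 => //; exact: sqr_ge0.
have qn : 0 < q ^+ n by rewrite exprn_gt0.
have r0 : 0 <= r by rewrite mulr_ge0 ?ltW.
have rq : r <= q ^+ n by rewrite /r ler_piMr// ltW.
have r6 : r <= 6^-1 by exact: le_trans q6.
have osc : (1 - 3 * r) * v n x <= (1 + r) * v n y.
  by apply: (trig_limit_osc _ _ r0 _ (trig_limit_v n)); lra.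
have vx := v_gt0 n x; have vy := v_gt0 n y.
(* [(1 + r) / (1 - 3 r) <= 1 + 8 r] amounts to [24 r ^ 2 <= 4 r], hence the threshold [6^-1]. *)
have H : v n x <= (1 + 8 * r) * v n y.
  rewrite -(@ler_pM2l _ (1 - 3 * r)); last by lra.
  apply: (le_trans osc); rewrite mulrA ler_pM2r//.
  by have : 0 <= r * (6^-1 - r) by [rewrite mulr_ge0// subr_ge0]; lra.
apply: (@le_trans _ _ (((1 + 8 * r) * v n y) ^+ b)).
  by rewrite lerXn2r ?nnegrE ?(ltW vx)// mulr_ge0 ?(ltW vy)//; lra.
rewrite exprMn ler_wpM2r ?exprn_ge0 ?(ltW vy)//.
apply: (le_trans (pow_bound _ _)); first by lra.
have n9 : 1 <= 9 ^+ b :> R by rewrite exprn_ege1//; lra.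
rewrite lerD2l; apply: (@le_trans _ _ (9 ^+ b * r)); first by lra.
by rewrite ler_wpM2l//; lra.
Qed.

Let ratio_exists n : exists2 C, 0 <= C & forall x y, v n x <= C * v n y.
Proof.
have [c c0 H] := @iter_rg_gt0 R b beta n _ _ (bmeas_theta beta_gt0) (gw_gt0 beta 1)
  (fun x => theta_ge x beta_gt0).
have [_ [M vM]] := bv n; exists (`|M| / c); first by apply: divr_ge0 => //; exact: ltW.
move=> x y; rewrite mulrAC ler_pdivlMr//.
rewrite ler_pM ?(ltW (v_gt0 _ _)) ?(ltW c0)//; last exact: H.
by rewrite (le_trans (ler_norm _))// (le_trans (vM x))// ler_norm.
Qed.

(** From some [N] on, [q ^ n <= 6^-1] and [ratio_tail] applies. Below [N], induction on [N] enlarges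
    [C] by [D ^ b / q ^ N] for each remaining level, [D] being any bound on the ratio of values
    there. *)
Let flattening : exists2 C, 0 <= C &
  forall n x y, v n x ^+ b <= (1 + C * q ^+ n) * v n y ^+ b.
Proof.
have q60 : 0 < 6^-1 :> R by lra.
have qq : `|q| < 1 by rewrite gtr0_norm.
have /cvgrPdist_le/(_ _ q60)[N _ HN] := cvg_expr qq.
have tail n : (N <= n)%N -> q ^+ n <= 6^-1.
  by move=> /HN; rewrite sub0r normrN ger0_norm// exprn_ge0// ltW.
suff [C C0 HC] : exists2 C, 0 <= C & forall n, (n < N)%N -> forall x y,
    v n x ^+ b <= (1 + C * q ^+ n) * v n y ^+ b.
  exists (C + 9 ^+ b) => [|n x y]; first by rewrite addr_ge0 ?exprn_ge0.
  have qn : 0 < q ^+ n by rewrite exprn_gt0.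
  have n9 : 0 <= 9 ^+ b :> R by rewrite exprn_ge0.
  have vy : 0 <= v n y ^+ b by rewrite exprn_ge0// ltW.
  have [nN|Nn] := ltnP n N.
    apply: le_trans (HC _ nN x y) _; rewrite ler_wpM2r// lerD2l ler_pM2r//; lra.
  apply: le_trans (ratio_tail x y (tail _ Nn)) _; rewrite ler_wpM2r// lerD2l ler_pM2r//; lra.
elim: N {HN tail} => [|N [C C0 HC]]; first by exists 0.
have [D D0 HD] := ratio_exists N.
have qN : 0 < q ^+ N by rewrite exprn_gt0.
have E0 : 0 <= D ^+ b / q ^+ N by apply: divr_ge0; [exact: exprn_ge0|exact: ltW].
exists (C + D ^+ b / q ^+ N) => [|n nN x y]; first by rewrite addr_ge0.
have qn : 0 < q ^+ n by rewrite exprn_gt0.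
have vy : 0 <= v n y ^+ b by rewrite exprn_ge0// ltW.
move: nN; rewrite ltnS leq_eqVlt => /predU1P[nN|nN]; last first.
  apply: le_trans (HC _ nN x y) _; rewrite ler_wpM2r// lerD2l ler_pM2r//; lra.
apply: (@le_trans _ _ ((D * v n y) ^+ b)).
  have vy' := v_gt0 n y; have vx' := v_gt0 n x.
  by rewrite lerXn2r ?nnegrE ?mulr_ge0 ?(ltW vy') ?(ltW vx')// nN HD.
rewrite exprMn ler_wpM2r// nN mulrDl divfK ?gt_eqF//.
have : 0 <= C * q ^+ N by rewrite mulr_ge0// ltW.
by lra.
Qed.

Let geometric_sum n : (1 - q) * \sum_(i < n) q ^+ i <= 1.
Proof.
have := subrX1 q n; set S := \sum_(i < n) _ => h.
have : 0 <= q ^+ n by rewrite exprn_ge0// ltW.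
by rewrite -opprB mulNr -h; lra.
Qed.

Definition dg_cdf n u : R := iter n rg (theta_below u) 0 / iter n rg theta 0.

Let bd n u : bmeas (iter n rg (theta_below u)).
Proof. by apply: bmeas_iter_rg; exact: bmeas_theta_below. Qed.

(** Conditional distribution function of the maximum over a subtree of depth [n], given the value
    [psi] at its root. The induction needs it for all [psi], although [dg_cdf] only uses
    [psi = 0]. *)
Let ratio n u psi := iter n rg (theta_below u) psi / v n psi.

Let ratio01 n u psi : 0 <= ratio n u psi <= 1.
Proof.
have H x : 0 <= theta_below u x <= theta x by rewrite theta_below_ge0 theta_below_le.
have /andP[h0 h1] := @iter_rg_le R b beta n _ _ (bmeas_theta_below u beta_gt0) (bmeas_theta beta_gt0) H psi.
by rewrite /ratio divr_ge0//= ?(ltW (v_gt0 _ _))// ler_pdivrMr ?v_gt0// mul1r.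
Qed.

Let ratio_step n u psi : iter n.+1 rg (theta_below u) psi =
  gmean (fun z => v n (psi + z) ^+ b * ratio n u (psi + z) ^+ b).
Proof.
congr gmean; apply/funext => z; rewrite /= -exprMn; congr (_ ^+ _).
by rewrite /ratio mulrC divfK// gt_eqF.
Qed.

(** The new ratio is the mean of the [b]-th power of the old one under the Gaussian step tilted by
    [h]. The hypothesis replaces the old ratio by [gff_cdf], monotone in the step, and domination
    trades the tilt for a translation by [C / hazard]; what is left is the recursion [gff_cdfS]. *)
Let sandwich_step C n u psi K : 0 <= C ->
  (forall x y, v n x ^+ b <= (1 + C) * v n y ^+ b) ->
  (forall x, gff_cdf n (u - x - K) <= ratio n u x <= gff_cdf n (u - x + K)) ->
  gff_cdf n.+1 (u - psi - (K + C / hazard beta)) <= ratio n.+1 u psi <=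
    gff_cdf n.+1 (u - psi + (K + C / hazard beta)).
Proof.
move=> C0 HC HK; set d := C / hazard beta.
have dE : d = domination_shift beta (1 + C) by rewrite /domination_shift addrAC subrr add0r.
pose h z := v n (psi + z) ^+ b.
have bh : bmeas h by apply: bmeasX; apply: bmeas_shift; exact: bv.
have h0 z : 0 <= h z by rewrite exprn_ge0// ltW.
have hC x y : h x <= (1 + C) * h y by exact: HC.
have C1 : 1 <= 1 + C by lra.
have vE : v n.+1 psi = gmean h by [].
have G0 x : 0 <= gff_cdf n x by have /andP[] := gff_cdf01 b beta n x.
have bF w : bmeas (fun z => gff_cdf n (w - z) ^+ b).
  apply: bmeasX; apply: (@bmeas_comp _ _ (fun x => w - x)); first exact: measurable_funB.
  exact: bmeas_gff_cdf.
have F01 w z : 0 <= gff_cdf n (w - z) ^+ b <= 1.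
  by have /andP[x0 x1] := gff_cdf01 b beta n (w - z); rewrite exprn_ge0// exprn_ile1.
have Fn w x y : x <= y -> gff_cdf n (w - y) ^+ b <= gff_cdf n (w - x) ^+ b.
  move=> xy; rewrite lerXn2r ?nnegrE//; apply: gff_cdf_mono.
  by rewrite lerD2l lerN2.
have br : bmeas (fun z => h z * ratio n u (psi + z) ^+ b).
  rewrite (_ : (fun z => _) = fun z => iter n rg (theta_below u) (psi + z) ^+ b).
    by apply: bmeasX; apply: bmeas_shift; exact: bd.
  apply/funext => z; rewrite /h -exprMn /ratio mulrC divfK// gt_eqF//.
have hpos : 0 < gmean h by rewrite -vE v_gt0.
have -> : ratio n.+1 u psi = gmean (fun z => h z * ratio n u (psi + z) ^+ b) / gmean h.
  by rewrite {1}/ratio ratio_step vE.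
rewrite ler_pdivlMr// ler_pdivrMr//.
rewrite !gff_cdfS; apply/andP; split.
- pose w := u - psi - K.
  apply: (@le_trans _ _ (gmean (fun z => h z * gff_cdf n (w - z) ^+ b))); last first.
    apply: gmean_le => //; first exact: bmeasM.
    move=> z; rewrite ler_wpM2l//; have /andP[] := ratio01 n u (psi + z) => r0 _.
    rewrite lerXn2r ?nnegrE//; have /andP[+ _] := HK (psi + z).
    by rewrite (_ : u - (psi + z) - K = w - z)// /w; ring.
  have := gauss_domination_ge beta_gt0 bh h0 hC C1 (bF w) (F01 w) (Fn w).
  have eG z : u - psi - (K + d) - z = w - (z + d) by rewrite /w; ring.
  by rewrite -dE mulrC; under [X in _ -> gmean X * _ <= _]eq_fun do rewrite eG.
- pose w := u - psi + K.
  apply: (@le_trans _ _ (gmean (fun z => h z * gff_cdf n (w - z) ^+ b))).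
    apply: gmean_le => //; first exact: bmeasM.
    move=> z; rewrite ler_wpM2l//; have /andP[] := ratio01 n u (psi + z) => r0 _.
    rewrite lerXn2r ?nnegrE//; have /andP[_ +] := HK (psi + z).
    by rewrite (_ : u - (psi + z) + K = w - z)// /w; ring.
  have := gauss_domination_le beta_gt0 bh h0 hC C1 (bF w) (F01 w) (Fn w).
  have eG z : u - psi + (K + d) - z = w - (z - d) by rewrite /w; ring.
  by rewrite -dE mulrC; under [X in _ -> _ <= gmean X * _]eq_fun do rewrite eG.
Qed.

Lemma cdf_sandwich : exists2 K, 0 < K & forall n u,
  gff_cdf n (u - K) <= dg_cdf n u <= gff_cdf n (u + K).
Proof.
have [C C0 HC] := flattening; have H0 := hazard_gt0 beta_gt0.
(* The leading [1] is the cost of the integer leaf; level [i] then adds [C * q ^ i / hazard]. *)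
pose Ks n := 1 + C / hazard beta * \sum_(i < n) q ^+ i.
have main n u psi : gff_cdf n (u - psi - Ks n) <= ratio n u psi <= gff_cdf n (u - psi + Ks n).
  elim: n u psi => [|n ih] u psi.
    rewrite /Ks big_ord0 mulr0 addr0 /gff_cdf /= !subr0.
    have := theta_ratio_ge beta_gt0 u psi; have := theta_ratio_le beta_gt0 u psi.
    rewrite /ratio /theta_ratio /= (_ : u + 1 - psi = u - psi + 1); last by ring.
    by rewrite (_ : u - 1 - psi = u - psi - 1); [move=> -> ->|ring].
  have C0' : 0 <= C * q ^+ n by rewrite mulr_ge0 ?exprn_ge0 ?(ltW q_gt0).
  have := sandwich_step psi C0' (HC n) (ih u).
  rewrite (_ : Ks n + C * q ^+ n / hazard beta = Ks n.+1)//.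
  by rewrite /Ks big_ord_recr/=; ring.
have q1 : 0 < 1 - q by rewrite subr_gt0.
have CH : 0 <= C / hazard beta by apply: divr_ge0 => //; exact: ltW.
pose K := 1 + C / hazard beta * (1 - q)^-1.
have KsK n : Ks n <= K.
  rewrite /Ks /K lerD2l ler_wpM2l// -[leRHS]mul1r ler_pdivlMr// mulrC.
  exact: geometric_sum.
exists K; first by rewrite ltr_pwDl// mulr_ge0// invr_ge0 ltW.
move=> n u; have /andP[l r] := main n u 0; rewrite /dg_cdf -/(ratio n u 0).
rewrite subr0 in l r; apply/andP; split.
  by apply: le_trans l; apply: gff_cdf_mono; rewrite lerD2l lerN2.
by apply: (le_trans r); apply: gff_cdf_mono; rewrite lerD2l.
Qed.

End flattening.

(** * Integrals against product measures *)

Section product_power_integral.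
Context d (T : measurableType d) (R : realType).
Variable nu : {sigma_finite_measure set T -> \bar R}.
Local Open Scope ereal_scope.

Lemma measurable_prod_tnth n (h : 'I_n -> T -> R) :
  (forall i, measurable_fun [set: T] (h i)) ->
  measurable_fun [set: n.-tuple T] (fun phi => \prod_(i < n) h i (tnth phi i))%R.
Proof.
move=> mh; apply: measurable_prod => i _.
by apply: (measurableT_comp (mh i)); exact: measurable_tnth.
Qed.

Lemma integral_product_power n (h : 'I_n -> T -> R) (H : 'I_n -> R) :
  (forall i, measurable_fun [set: T] (h i)) -> (forall i t, 0 <= h i t)%R ->
  (forall i, \int[nu]_t (h i t)%:E = (H i)%:E) ->
  \int[product_power nu n]_phi (\prod_(i < n) h i (tnth phi i))%:E =
  (\prod_(i < n) H i)%:E.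
Proof.
elim: n h H => [|n ih] h H mh h0 hH.
  rewrite big_ord0 /=; under eq_integral do rewrite big_ord0.
  by rewrite integral_cst// mul1e; exact: diracT.
rewrite [product_power _ _]/=.
have G0 t : (0 <= \prod_(i < n) h (lift ord0 i) (tnth t i))%R by exact: prodr_ge0.
have mG : measurable_fun [set: n.-tuple T]
    (fun t => \prod_(i < n) h (lift ord0 i) (tnth t i))%R.
  by apply: (@measurable_prod_tnth n (fun i => h (lift ord0 i))) => i; exact: mh.
transitivity (\int[nu \x product_power nu n]_z
    (h ord0 z.1 * \prod_(i < n) h (lift ord0 i) (tnth z.2 i))%:E).
  rewrite ge0_integral_pushforward//.
  - apply: eq_integral => z _ /=; rewrite big_ord_recl; congr (_ * _)%:E.
    by apply: eq_bigr => i _; rewrite tnthS.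
  - by apply/measurable_EFinP; exact: measurable_prod_tnth.
  - by move=> t _; rewrite lee_fin prodr_ge0.
rewrite fubini_tonelli1.
- rewrite big_ord_recl EFinM -(hH ord0) -ge0_integralZr//.
  + apply: eq_integral => x _ /=; rewrite -(ih _ _ _ _ (fun i => hH (lift ord0 i)))//.
    rewrite -ge0_integralZl//.
    * exact/measurable_EFinP.
    * by move=> t _; rewrite lee_fin.
    * by rewrite lee_fin.
  + exact/measurable_EFinP.
  + by move=> x _; rewrite lee_fin.
  + rewrite lee_fin prodr_ge0// => i _; rewrite -lee_fin -hH.
    by apply: integral_ge0 => t _; rewrite lee_fin.
- apply/measurable_EFinP; apply: measurable_funM; first exact: measurableT_comp.
  exact: (measurableT_comp mG).
- by move=> z; rewrite lee_fin mulr_ge0.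
Qed.

End product_power_integral.

Section product_sigma_finite.
Context d1 d2 (T1 : measurableType d1) (T2 : measurableType d2) (R : realType).
Context (m1 : {sigma_finite_measure set T1 -> \bar R}).
Context (m2 : {sigma_finite_measure set T2 -> \bar R}).
Local Open Scope ereal_scope.

(** A named copy of the product to which sigma-finiteness is attached, so that [product_power] can
    be applied to it again at the next tree level. *)
Definition pair_measure : set (T1 * T2) -> \bar R := m1 \x m2.

HB.instance Definition _ := Measure.on pair_measure.

Lemma sigma_finite_pair_measure : sigma_finite [set: T1 * T2] pair_measure.
Proof.
have /sigma_finiteP[F [FT ndF Foo]] := sigma_finiteT m1.
have /sigma_finiteP[G [GT ndG Goo]] := sigma_finiteT m2.
exists (fun n => F n `*` G n) => [|n].
  apply/esym/seteqP; split => // -[x y] _.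
  have [i _ Fi] : (\bigcup_i F i) x by rewrite -FT.
  have [j _ Gj] : (\bigcup_j G j) y by rewrite -GT.
  exists (maxn i j) => //; split => /=.
  - by move: x Fi; exact/subsetPset/ndF/leq_maxl.
  - by move: y Gj; exact/subsetPset/ndG/leq_maxr.
have [mF Fn] := Foo n; have [mG Gn] := Goo n; split; first exact: measurableX.
by rewrite /pair_measure product_measure1E// lte_mul_pinfty// ge0_fin_numE.
Qed.

HB.instance Definition _ :=
  Measure_isSigmaFinite.Build _ _ _ pair_measure sigma_finite_pair_measure.

End product_sigma_finite.

(** * Branching random walk with leaf-dependent weights *)

Section tree_average.
Context (R : realType) (b : nat) (beta : R).
Hypotheses (beta_gt0 : 0 < beta).
Implicit Types w : seq 'I_b -> R -> R.
Local Notation avg := (avg beta).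

(** Generalizes the iterates of [rg] to weights that differ between leaves. Leaves are words read
    from the root, as untyped sequences, so that passing to a subtree only prepends a letter. *)
Fixpoint tree_avg n w : R -> R :=
  if n is m.+1 then avg (fun x => \prod_(c < b) tree_avg m (fun t => w (c :: t)) x)
  else w [::].

Lemma bmeas_tree_avg n w : (forall t, bmeas (w t)) -> bmeas (tree_avg n w).
Proof.
elim: n w => [|n ih] w bw //=; apply: bmeas_avg; apply: bmeas_prod => c.
by apply: ih.
Qed.

Lemma tree_avg_cst n (f : R -> R) : tree_avg n (fun=> f) = iter n (rg b beta) f.
Proof.
elim: n => //= n ->; congr (avg _); apply/funext => x.
by rewrite prodr_const card_ord.
Qed.

Lemma big_tuple_cons (V : Type) (idx : V) (op : Monoid.com_law idx) n
  (F : seq 'I_b -> V) :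
  \big[op/idx]_(x : n.+1.-tuple 'I_b) F x =
  \big[op/idx]_(c < b) \big[op/idx]_(t : n.-tuple 'I_b) F (c :: t).
Proof.
rewrite pair_big/=.
rewrite (reindex (fun p : 'I_b * n.-tuple 'I_b => [tuple of p.1 :: p.2]))/=.
  by apply: eq_bigr => -[].
exists (fun x => (thead x, [tuple of behead x])) => [[c t] _|x _] /=.
  by rewrite theadE; congr pair; exact/val_inj.
by rewrite [RHS]tuple_eta.
Qed.

Lemma big_tuple0 (V : Type) (idx : V) (op : Monoid.com_law idx) (F : seq 'I_b -> V) :
  \big[op/idx]_(x : 0.-tuple 'I_b) F x = F [::].
Proof.
rewrite (big_pred1 [tuple]) // => x; apply/esym/eqP; exact: tuple0.
Qed.

(* [om x] is the displacement, from the root to the leaf [x], of a branching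
   random walk with Gaussian steps. *)
Lemma tree_avg_branching n :
  exists d (Om : measurableType d) (P : {sigma_finite_measure set Om -> \bar R})
    (om : seq 'I_b -> Om -> R),
  (forall t, measurable_fun [set: Om] (om t)) /\
  forall w, (forall t, bmeas (w t)) -> (forall t x, 0 <= w t x) -> forall psi,
    (tree_avg n w psi)%:E =
    (\int[P]_o (\prod_(x : n.-tuple 'I_b) w x (psi + om x o))%:E)%E.
Proof.
elim: n => [|n [d [Om [P [om [mom ih]]]]]].
  exists _, (measurableTypeR R), (gauss beta), (fun _ _ => 0); split => // w bw w0 psi.
  under eq_integral do rewrite (big_tuple0 _ (fun x => w x (psi + 0))).
  rewrite integral_cst// [X in (_ * X)%E](_ : _ = 1%E); first by rewrite mule1 addr0.
  exact: (@probability_setT _ _ _ (gauss beta)).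
(* All children share the Gaussian step [o.1], and each then follows its own copy of the smaller
   tree. The value on the empty word is never read, leaves having length [n + 1]. *)
pose om' (t : seq 'I_b) (o : measurableTypeR R * b.-tuple Om) : R :=
  if t is c :: t' then o.1 + om t' (tnth o.2 c) else 0.
exists _, (measurableTypeR R * b.-tuple Om)%type,
  (pair_measure (gauss beta) (product_power P b)), om'; split.
  case=> [|c t]; first exact: measurable_cst.
  apply: measurable_funD => //; apply: (measurableT_comp (mom t)).
  exact: (measurableT_comp (@measurable_tnth _ Om b c)).
move=> w bw w0 psi.
have mprod c x : measurable_fun [set: Om]
    (fun o => \prod_(t : n.-tuple 'I_b) w (c :: t) (x + om t o)).
  apply: measurable_prod => t _; apply: (measurableT_comp (bw _).1).
  exact: measurable_funD.
rewrite /= EFin_avg; last by apply: bmeas_prod => c; exact: bmeas_tree_avg.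
transitivity (\int[pair_measure (gauss beta) (product_power P b)]_o
   (\prod_(c < b) \prod_(t : n.-tuple 'I_b) w (c :: t) (psi + o.1 + om t (tnth o.2 c)))%:E)%E; last first.
  apply: eq_integral => o _; congr EFin.
  rewrite (big_tuple_cons _ n (fun x => w x (psi + om' x o)))/=.
  by apply: eq_bigr => c _; apply: eq_bigr => t _; rewrite addrA.
rewrite /pair_measure fubini_tonelli1.
- apply: eq_integral => z _ /=.
  rewrite -(@integral_product_power _ _ _ P b
    (fun c o => \prod_(t : n.-tuple 'I_b) w (c :: t) (psi + z + om t o))
    (fun c => tree_avg n (fun t => w (c :: t)) (psi + z)))//.
  + by move=> c o; apply: prodr_ge0.
  + by move=> c; rewrite ih.
- apply/measurable_EFinP; apply: measurable_prod => c _; apply: measurable_prod => t _.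
  apply: (measurableT_comp (bw _).1); apply: measurable_funD; first exact: measurable_funD.
  apply: (measurableT_comp (mom t)); apply: (measurableT_comp (@measurable_tnth _ Om b c)) => //.
- by move=> o; rewrite lee_fin; do 2 (apply: prodr_ge0 => ? _).
Qed.

End tree_average.

(** * The quadratic form of the hierarchical Laplacian *)

Section hierarchical_energy.
Context (R : realType) (b : nat) (beta : R).
Hypotheses (b_gt1 : (1 < b)%N) (beta_gt0 : 0 < beta).
Implicit Types g : seq 'I_b -> R.

Definition geom k : R := \sum_(0 <= j < k) b%:R ^+ j.

Definition leaf_sum n g : R := \sum_(x : n.-tuple 'I_b) g x.

(** The form [- (g, Delta g)] organized along the tree: each level couples the subtrees only through
    the total sum over the leaves. *)
Fixpoint energy n g : R :=
  if n is m.+1 then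
    \sum_(c < b) energy m (fun t => g (c :: t)) -
    ((geom n)^-1 - (geom n.+1)^-1) / b%:R ^+ n * leaf_sum n g ^+ 2
  else g [::] ^+ 2.

Let b_gt0 : 0 < b%:R :> R. Proof. by rewrite ltr0n ltnW. Qed.

Lemma geom_gt0 k : 0 < geom k.+1.
Proof.
rewrite /geom big_nat_recl//= expr0 ltr_pwDl// sumr_ge0//.
Qed.

Lemma geomS k : geom k.+1 = geom k + b%:R ^+ k.
Proof. by rewrite /geom big_nat_recr. Qed.

Lemma leaf_sumS n g : leaf_sum n.+1 g = \sum_(c < b) leaf_sum n (fun t => g (c :: t)).
Proof. exact: big_tuple_cons. Qed.

Lemma leaf_sum0 g : leaf_sum 0 g = g [::].
Proof. exact: big_tuple0. Qed.

Lemma leaf_sum_shift n g z :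
  leaf_sum n (fun t => g t - z) = leaf_sum n g - b%:R ^+ n * z.
Proof.
rewrite /leaf_sum big_split/= sumrN sumr_const card_tuple card_ord.
by rewrite -natrX mulr_natl.
Qed.

(** Constants are felt only by the killing term: the operator sends [1] to the constant
    [1 / geom n.+1]. *)
Lemma energy_shift n g z : energy n (fun t => g t - z) =
  energy n g - (2 * z * leaf_sum n g - b%:R ^+ n * z ^+ 2) / geom n.+1.
Proof.
elim: n g => [|n ih] g.
  by rewrite leaf_sum0 /= /geom big_nat1 expr0 divr1; ring.
rewrite [LHS]/= [energy n.+1 g]/=.
under eq_bigr do rewrite ih.
rewrite leaf_sum_shift sumrB -mulr_suml sumrB -!mulr_sumr -leaf_sumS.
rewrite sumr_const card_ord -mulr_natl.
set A := \sum_(i < b) _; set S := leaf_sum _ _.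
have s0 : geom n.+1 != 0 by rewrite gt_eqF// geom_gt0.
have s1 : geom n.+2 != 0 by rewrite gt_eqF// geom_gt0.
have bn : b%:R ^+ n != 0 :> R by rewrite gt_eqF// exprn_gt0.
have b0 : b%:R != 0 :> R by rewrite gt_eqF.
rewrite !exprS; field.
by rewrite s0 s1 bn b0.
Qed.

(** Completing the square yields a Gaussian with [beta] replaced by [beta * (1 + kappa)]. *)
Lemma gmean_quadratic (A t kappa : R) : 0 <= A -> 0 <= kappa ->
  gmean beta (fun z => A * expR (beta * t * z - beta / 2 * kappa * z ^+ 2)) =
  A * (gauss_mass (beta * (1 + kappa)) / gauss_mass beta *
    expR (beta / 2 * (t ^+ 2 / (1 + kappa)))).
Proof.
move=> A0 k0; pose beta' := beta * (1 + kappa).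
have k1 : 0 < 1 + kappa by rewrite ltr_pwDl.
have b'0 : 0 < beta' by rewrite mulr_gt0.
have m0 := gauss_mass_gt0 beta_gt0.
pose B := A * expR (beta / 2 * (t ^+ 2 / (1 + kappa))) / gauss_mass beta.
have B0 : 0 <= B by apply: divr_ge0; [rewrite mulr_ge0 ?expR_ge0|exact: ltW].
have mg : measurable_fun [set: R] (fun x => (gw beta' x)%:E).
  by apply/measurable_EFinP; exact: measurable_gw.
have g0 x : (0 <= (gw beta' x)%:E)%E by rewrite lee_fin gw_ge0.
rewrite /gmean /Rintegral.
rewrite (_ : (\int[_]_x _)%E = (B * gauss_mass beta')%:E)%E.
  by rewrite /= /B; field; rewrite gt_eqF.
rewrite ge0_integral_gauss//; last 2 first.
- apply/measurable_EFinP; apply: measurable_funM => //; apply: measurableT_comp => //.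
  apply: measurable_funB; first exact: measurable_funM.
  by apply: measurable_funM => //; exact: measurable_funX.
- by move=> x; rewrite lee_fin mulr_ge0 ?expR_ge0.
rewrite EFinM -(integral_gw b'0) -(ge0_integral_lebesgue_shift (- (t / (1 + kappa))) mg g0).
rewrite -ge0_integralZl//; last first.
  apply: (measurableT_comp mg); exact: measurable_funD.
apply: eq_integral => z _; rewrite -!EFinM; congr EFin.
have e : expR (beta * t * z - beta / 2 * kappa * z ^+ 2) * gw beta z =
    expR (beta / 2 * (t ^+ 2 / (1 + kappa))) * gw beta' (z + - (t / (1 + kappa))).
  by rewrite -!expRD /beta'; congr expR; field; rewrite gt_eqF.
by rewrite -[LHS]mulrA [expR _ * (gw _ _ / _)]mulrA e /B; ring.
Qed.

(** Averaging over the step above the [b] subtrees subtracts [S ^ 2 / (geom n.+1 * geom n.+2)] from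
    their total energy, [S] being the leaf sum. This is the coefficient in [energy], because
    [geom n.+2 = geom n.+1 + b ^ n.+1]; it explains the weights in the Laplacian. *)
Lemma tree_avg_gw n : exists2 C, 0 < C & forall g psi,
  tree_avg beta n (fun t y => gw beta (g t - y)) psi =
  C * expR (- (beta / 2 * energy n (fun t => g t - psi))).
Proof.
elim: n => [|n [C C0 ih]]; first by exists 1 => // g psi; rewrite mul1r.
(* Curvature in the step [z] contributed by the [b] subtrees through [energy_shift]; [1 + kappa] is
   [geom n.+2 / geom n.+1]. *)
pose kappa := b%:R ^+ n.+1 / geom n.+1.
have s0 := geom_gt0 n; have s1 := geom_gt0 n.+1.
have bn : 0 < b%:R ^+ n.+1 :> R by rewrite exprn_gt0.
have k0 : 0 < kappa by rewrite divr_gt0.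
have b'0 : 0 < beta * (1 + kappa) by rewrite mulr_gt0// ltr_pwDl// ltW.
exists (C ^+ b * (gauss_mass (beta * (1 + kappa)) / gauss_mass beta)).
  by rewrite mulr_gt0 ?exprn_gt0// divr_gt0// gauss_mass_gt0.
move=> g psi; pose h t := g t - psi.
pose E := \sum_(c < b) energy n (fun t => h (c :: t)).
pose S := leaf_sum n.+1 h.
rewrite [LHS]/= /avg.
rewrite (_ : (fun z => _) = fun z => C ^+ b * expR (- (beta / 2 * E)) *
  expR (beta * (S / geom n.+1) * z - beta / 2 * kappa * z ^+ 2)); last first.
  apply/funext => z; under eq_bigr do rewrite (ih (fun t => g (_ :: t))).
  rewrite big_split/= prodr_const card_ord -mulrA; congr (_ * _).
  rewrite -expR_sum -expRD; congr expR.
  rewrite sumrN -mulr_sumr.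
  rewrite (eq_bigr (fun c => energy n (fun t => h (c :: t)) -
    (2 * z * leaf_sum n (fun t => h (c :: t)) - b%:R ^+ n * z ^+ 2) / geom n.+1)); last first.
    move=> c _; rewrite -energy_shift; congr energy; apply/funext => t.
    by rewrite /h opprD addrA.
  rewrite sumrB -mulr_suml sumrB -mulr_sumr -leaf_sumS sumr_const card_ord -/E -/S.
  rewrite -[_ *+ b]mulr_natl /kappa [b%:R ^+ n.+1]exprS.
  field.
  by rewrite gt_eqF.
rewrite gmean_quadratic ?(ltW k0)//; last by rewrite mulr_ge0 ?exprn_ge0 ?expR_ge0 ?(ltW C0).
rewrite -!mulrA; congr (_ * _); rewrite mulrCA; congr (_ * _); rewrite mulrCA; congr (_ * _).
rewrite -expRD; congr expR.
rewrite [energy n.+1 _]/= -/E -/S /kappa (geomS n.+1).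
field; rewrite -geomS !gt_eqF//.
Qed.

Let form n k g : R := \sum_(x : n.-tuple 'I_b) \sum_(y : n.-tuple 'I_b)
  (if take (n - k) y == take (n - k) x then g x * (g y - g x) else 0).

(** Words with different first letters share no ball of level [k <= n], so the double sum splits
    over the subtrees. *)
Let formS n k g : (k <= n)%N ->
  form n.+1 k g = \sum_(c < b) form n k (fun t => g (c :: t)).
Proof.
move=> kn; rewrite /form.
rewrite (big_tuple_cons _ n (fun x => \sum_(y : n.+1.-tuple 'I_b)
  (if take (n.+1 - k) y == take (n.+1 - k) x then g x * (g y - g x) else 0))).
apply: eq_bigr => c _; apply: eq_bigr => t _.
rewrite (big_tuple_cons _ n (fun y =>
  (if take (n.+1 - k) y == take (n.+1 - k) (c :: t) then g (c :: t) * (g y - g (c :: t)) else 0))).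
rewrite (bigD1 c)//= [X in _ + X]big1 ?addr0.
  by apply: eq_bigr => y _; rewrite subSn//= eqseq_cons eqxx.
move=> c' c'c; apply: big1 => y _.
by rewrite subSn//= eqseq_cons (negbTE c'c).
Qed.

Let form_top n g : form n n g =
  leaf_sum n g ^+ 2 - b%:R ^+ n * leaf_sum n (fun t => g t ^+ 2).
Proof.
rewrite /form subnn; under eq_bigr do under eq_bigr do rewrite !take0 eqxx.
under eq_bigr do rewrite -mulr_sumr sumrB sumr_const card_tuple card_ord mulrBr.
rewrite sumrB -mulr_suml -expr2; congr (_ - _).
by rewrite mulr_sumr; apply: eq_bigr => x _; rewrite -natrX mulr_natl mulrnAr expr2.
Qed.

Let quadratic n g : R :=
  \sum_(1 <= k < n.+1) ((geom k)^-1 - (geom k.+1)^-1) * ((b%:R ^+ k)^-1 * form n k g)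
  - (geom n.+1)^-1 * leaf_sum n (fun t => g t ^+ 2).

(** The diagonal terms telescope: the level coefficients and the killing coefficient add up to
    [1 / geom 1 = 1], the coefficient of a single leaf in [energy]. *)
Let quadraticE n g : quadratic n g = - energy n g.
Proof.
elim: n g => [|n ih] g.
  by rewrite /quadratic big_geq// leaf_sum0 /geom big_nat1 expr0 invr1 mul1r sub0r.
rewrite /quadratic big_nat_recr//= form_top.
rewrite (eq_big_nat _ _ (F2 := fun k => \sum_(c < b) ((geom k)^-1 - (geom k.+1)^-1) *
   ((b%:R ^+ k)^-1 * form n k (fun t => g (c :: t))))); last first.
  by move=> k /andP[_ kn]; rewrite formS// !mulr_sumr.
rewrite exchange_big/=.
rewrite [X in - (X - _)](eq_bigr (fun c => - quadratic n (fun t => g (c :: t)))); last first.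
  by move=> c _; rewrite ih opprK.
rewrite sumrN /quadratic sumrB -mulr_sumr -(leaf_sumS n (fun t => g t ^+ 2)).
have s0 : geom n.+1 != 0 by rewrite gt_eqF// geom_gt0.
have s1 : geom n.+2 != 0 by rewrite gt_eqF// geom_gt0.
have bn : b%:R ^+ n.+1 != 0 :> R by rewrite gt_eqF// exprn_gt0.
set X := \sum_(j < b) _; set Y := leaf_sum _ (fun t => g t ^+ 2); set Z := leaf_sum _ g.
set B := b%:R ^+ n.+1 in bn *.
by field; rewrite s0 s1 bn.
Qed.

Lemma mem_hball n k (x y : lattice b n) :
  (y \in hball k x) = (take (n - k) y == take (n - k) x).
Proof.
rewrite inE; apply/forallP/eqP => [h|h i].
  apply: (@eq_from_nth _ (Ordinal (ltnW b_gt1))).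
    by rewrite !size_take !size_tuple.
  move=> i; rewrite size_take size_tuple => ik.
  have ink : (i < n - k)%N by move: ik; case: (ltnP (n - k) n) => // nk ik; exact: leq_trans ik nk.
  have iN : (i < n)%N by rewrite (leq_trans ink)// leq_subr.
  rewrite !nth_take//; have := h (Ordinal iN); rewrite ink /= => /eqP.
  by rewrite !(tnth_nth (Ordinal (ltnW b_gt1))).
apply/implyP => ik; apply/eqP; rewrite !(tnth_nth (Ordinal (ltnW b_gt1))).
by rewrite -(nth_take _ ik) h nth_take.
Qed.

Lemma inner_laplacian n g :
  inner (fun x : lattice b n => g x) (laplacian (fun x : lattice b n => g x)) = - energy n g.
Proof.
rewrite -quadraticE /quadratic /inner /laplacian.
under eq_bigr do rewrite mulrBr mulr_sumr.
rewrite sumrB exchange_big/=; congr (_ - _); last first.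
  rewrite /leaf_sum mulr_sumr; apply: eq_bigr => x _.
  by rewrite mulrCA expr2.
apply: eq_bigr => k _; rewrite /form !mulr_sumr; apply: eq_bigr => x _.
rewrite mulrCA; congr (_ * _); rewrite mulrCA; congr (_ * _).
rewrite mulr_sumr big_mkcond/=; apply: eq_bigr => y _.
by rewrite mem_hball; case: ifP.
Qed.

End hierarchical_energy.

(** * Laws of the two maxima as iterates of [rg] *)

Section gibbs_tree.
Context (R : realType) (b : nat) (beta : R).
Hypotheses (b_gt1 : (1 < b)%N) (beta_gt0 : 0 < beta).

Lemma iter_rgZ n c f x : bmeas f -> iter n (rg b beta) (fun x => c * f x) x =
  c ^+ (b ^ n) * iter n (rg b beta) f x.
Proof.
move=> bf; elim: n x => [|n ih] x; first by rewrite expr1.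
rewrite /= {1 3}/rg -avgZ; last exact/bmeasX/bmeas_iter_rg.
by congr (avg _ _ _); apply/funext => z; rewrite ih exprMn -exprM expnSr.
Qed.

(** By [tree_avg_gw] and the branching representation, the Gibbs weight is a constant times a
    mixture of product weights. Given the walk, the spins are independent and each integrates to
    [W]. The constant [C] is the same for all spins, reference measures and [chi], so it cancels in
    probabilities. *)
Lemma integral_gibbs_weight n : exists2 C, 0 < C &
  forall d (T : measurableType d) (spin : {mfun T >-> R})
    (nu : {sigma_finite_measure set T -> \bar R}) (chi W : R -> R),
  measurable_fun [set: R] chi -> (forall y, 0 <= chi y) ->
  bmeas W -> (forall y, 0 <= W y) ->
  (forall y, \int[nu]_t (chi (spin t) * gw beta (spin t - y))%:E = (W y)%:E)%E ->
  (\int[product_power nu #|lattice b n|]_(phi in [set: config T b n])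
     (gibbs_weight spin beta phi * \prod_x chi (field spin phi x))%:E =
   (C * iter n (rg b beta) W 0)%:E)%E.
Proof.
have [C C0 CE] := tree_avg_gw b_gt1 beta_gt0 n.
have [d [Om [P [om [mom rep]]]]] := tree_avg_branching b beta n.
exists C^-1; first by rewrite invr_gt0.
move=> d' T spin nu chi W mchi chi0 bW W0 hW.
have mspin : measurable_fun [set: T] spin by exact: measurable_funP.
pose h x o t := chi (spin t) * gw beta (spin t - om x o).
have h0 x o t : 0 <= h x o t by rewrite mulr_ge0 ?gw_ge0.
have mh x o : measurable_fun [set: T] (h x o).
  apply: measurable_funM; first exact: measurableT_comp.
  by apply: (measurableT_comp (measurable_gw _)); exact: measurable_funB.
have weightE (phi : config T b n) :
    (gibbs_weight spin beta phi * \prod_x chi (field spin phi x))%:E =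
    ((C^-1)%:E * \int[P]_o (\prod_(x : lattice b n) h x o (tnth phi (enum_rank x)))%:E)%E.
  (* The field extended to all words, by [0] off the leaves, as [tree_avg] requires. *)
  pose g (t : seq 'I_b) : R :=
    if (insub t : option (n.-tuple 'I_b)) is Some x then field spin phi x else 0.
  have gE (x : lattice b n) : field spin phi x = g x by rewrite /g valK.
  have e1 : gibbs_weight spin beta phi =
      C^-1 * tree_avg beta n (fun t y => gw beta (g t - y)) 0.
    rewrite CE mulKf ?gt_eqF// /gibbs_weight; congr expR.
    rewrite (_ : field spin phi = (fun x : lattice b n => g x)); last exact/funext.
    rewrite inner_laplacian// (_ : (fun t => g t - 0) = g); last first.
      by apply/funext => t; rewrite subr0.
    by rewrite mulrN; congr (- (_ * _)); rewrite mulrC.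
  have bw t : bmeas (fun y => gw beta (g t - y)).
    split.
      by apply: (measurableT_comp (measurable_gw _)); exact: measurable_funB.
    by exists 1 => y; rewrite ger0_norm ?gw_ge0// gw_le1.
  rewrite e1 -mulrA EFinM; congr (_ * _)%E.
  rewrite mulrC EFinM rep//; last by move=> *; exact: gw_ge0.
  rewrite -ge0_integralZl//; last 3 first.
  - apply/measurable_EFinP; apply: measurable_prod => x _.
    apply: (measurableT_comp (bw _).1); exact: measurable_funD.
  - by move=> o _; rewrite lee_fin prodr_ge0// => x _; exact: gw_ge0.
  - by rewrite lee_fin prodr_ge0.
  apply: eq_integral => o _; rewrite -EFinM -big_split/=; congr EFin.
  by apply: eq_bigr => x _; rewrite /h -gE add0r.
under eq_integral do rewrite weightE.
have mjoint : measurable_fun [set: (#|lattice b n|.-tuple T) * Om]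
    (fun z => (\prod_(x : lattice b n) h x z.2 (tnth z.1 (enum_rank x)))%:E).
  apply/measurable_EFinP; apply: measurable_prod => x _.
  have ms : measurable_fun [set: (#|lattice b n|.-tuple T) * Om]
      (fun z => spin (tnth z.1 (enum_rank x))).
    apply: (measurableT_comp mspin).
    exact: (measurableT_comp (@measurable_tnth _ T _ (enum_rank x))).
  apply: measurable_funM; first exact: measurableT_comp.
  apply: (measurableT_comp (measurable_gw _)); apply: measurable_funB => //.
  exact: (measurableT_comp (mom x)).
have joint0 (z : (#|lattice b n|.-tuple T) * Om) :
    (0 <= (\prod_(x : lattice b n) h x z.2 (tnth z.1 (enum_rank x)))%:E)%E.
  by rewrite lee_fin prodr_ge0.
rewrite ge0_integralZl//; last 3 first.
- exact: (@measurable_fun_fubini_tonelli_F _ _ (#|lattice b n|.-tuple T) Om R P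
    (fun z => (\prod_(x : lattice b n) h x z.2 (tnth z.1 (enum_rank x)))%:E)).
- by move=> phi _; apply: integral_ge0 => o _; rewrite lee_fin prodr_ge0.
- by rewrite lee_fin invr_ge0 ltW.
rewrite EFinM; congr (_ * _)%E.
rewrite (@fubini_tonelli _ _ (#|lattice b n|.-tuple T) Om R (product_power nu _) P
  (fun z => (\prod_(x : lattice b n) h x z.2 (tnth z.1 (enum_rank x)))%:E))//.
rewrite -tree_avg_cst rep//; apply: eq_integral => o _ /=.
have reind (F : lattice b n -> R) :
    \prod_(x : lattice b n) F x = \prod_(i < #|lattice b n|) F (enum_val i).
  by rewrite (reindex _ (onW_bij _ (@enum_val_bij (lattice b n)))).
rewrite [in RHS]reind -(@integral_product_power _ T R nu _ (fun i => h (enum_val i : n.-tuple _) o))//.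
- apply: eq_integral => phi _; congr EFin; rewrite reind.
  by apply: eq_bigr => i _; rewrite enum_valK.
- by move=> i; rewrite add0r hW.
Qed.

Lemma config_max_le d (T : measurableType d) (spin : {mfun T >-> R}) n u
    (phi : config T b n) :
  (config_max spin b_gt1 phi <= u) = [forall x, field spin phi x <= u].
Proof.
rewrite /config_max /field_max; apply/idP/forallP => [h x|h].
  by apply: le_trans h; exact: le_bigmax.
by apply/bigmax_leP; split.
Qed.

Lemma gibbs_max_le d (T : measurableType d) (spin : {mfun T >-> R})
    (nu : {sigma_finite_measure set T -> \bar R}) (W Wtot : R -> R) n u :
  bmeas W -> (forall y, 0 <= W y) -> bmeas Wtot -> (forall y, 0 <= Wtot y) ->
  0 < iter n (rg b beta) Wtot 0 ->
  (forall y, \int[nu]_t ((spin t <= u :> R)%:R * gw beta (spin t - y))%:E = (W y)%:E)%E ->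
  (forall y, \int[nu]_t (gw beta (spin t - y))%:E = (Wtot y)%:E)%E ->
  gibbs spin b n nu beta [set phi | config_max spin b_gt1 phi <= u] =
  (iter n (rg b beta) W 0 / iter n (rg b beta) Wtot 0)%:E.
Proof.
move=> bW W0 bWt Wt0 Wt_gt0 hW hWt.
have [C C0 CE] := integral_gibbs_weight n.
have unT : gibbs_unnormalized spin nu beta [set: config T b n] =
    (C * iter n (rg b beta) Wtot 0)%:E.
  rewrite -(CE _ _ spin nu (fun=> 1) Wtot)//; last first.
    by move=> y; rewrite -hWt; apply: eq_integral => t _; rewrite mul1r.
  by apply: eq_integral => phi _; rewrite big1// mulr1.
have unu : gibbs_unnormalized spin nu beta [set phi : config T b n | config_max spin b_gt1 phi <= u] =
    (C * iter n (rg b beta) W 0)%:E.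
  rewrite -(CE _ _ spin nu (fun y => (y <= u :> R)%:R) W)//.
  - rewrite /gibbs_unnormalized integral_mkcond; apply: eq_integral => phi _.
    rewrite patchE (_ : phi \in _ = [forall x, field spin phi x <= u]); last first.
      by rewrite -config_max_le; apply/idP/idP => [/set_mem|/mem_set].
    case: ifPn => [/forallP h|].
      by rewrite big1 ?mulr1// => x _; rewrite h.
    rewrite negb_forall => /existsP[x xu].
    by rewrite (bigD1 x)//= (negbTE xu) mul0r mulr0.
  - rewrite (_ : (fun y => _) = \1_`]-oo, u]); first exact: measurable_indic.
    by apply/funext => y; rewrite indicE mem_setE in_itv.
rewrite /gibbs /= /mnormalize /=.
set m := gibbs_unnormalized _ _ _ [set: _].
have -> : m = (C * iter n (rg b beta) Wtot 0)%:E by exact: unT.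
(* The total mass is positive and finite, which rules out the default value of [mnormalize]. *)
rewrite ifF; last by apply/negbTE; rewrite negb_or eqe gt_eqF ?mulr_gt0.
apply: etrans (congr1 (fun z => z * _)%E unu) _.
by rewrite -EFinM/=; congr EFin; field; rewrite !gt_eqF.
Qed.

Lemma DG_max_le n u : DG b n beta [set phi | DG_max n beta b_gt1 phi <= u] =
  (dg_cdf b beta n u)%:E.
Proof.
apply: (@gibbs_max_le _ _ (@int_spin R) (@counting int R)).
- exact: bmeas_theta_below.
- by move=> y; exact: theta_below_ge0.
- exact: bmeas_theta.
- by move=> y; apply/ltW/theta_gt0.
- have [c c0 H] := @iter_rg_gt0 R b beta n _ _ (bmeas_theta beta_gt0) (gw_gt0 beta 1)
    (fun x => theta_ge x beta_gt0).
  exact: lt_le_trans (H 0).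
- by move=> y; rewrite EFin_theta_below//; apply: eq_integral => m _; rewrite mulrC.
- by move=> y; rewrite EFin_theta.
Qed.

(** Lebesgue spins give the leaf weights [gauss_mass * Phi (u - y)] and [gauss_mass]; the resulting
    powers of [gauss_mass] cancel in the quotient. *)
Lemma GFF_max_le n u : GFF b n beta [set phi | GFF_max n beta b_gt1 phi <= u] =
  (gff_cdf b beta n u)%:E.
Proof.
have m0 := gauss_mass_gt0 beta_gt0.
rewrite (@gibbs_max_le _ _ (@real_spin R) (@lebesgue_measure R)
  (fun y => gauss_mass beta * Phi beta (u - y)) (fun=> gauss_mass beta * 1)).
- rewrite !iter_rgZ ?rg1//; last exact: bmeas_Phi_sub.
  by rewrite mulr1 mulrC mulKf// gt_eqF// exprn_gt0.
- by apply: bmeasZ; exact: bmeas_Phi_sub.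
- by move=> y; rewrite mulr_ge0 ?Phi_ge0// ltW.
- exact: bmeas_cst.
- by move=> y; rewrite mulr1 ltW.
- by rewrite iter_rgZ// rg1 mulr1 exprn_gt0.
- move=> y; have b1 : bmeas (\1_`]-oo, u - y] : R -> R) by exact: bmeas_indic.
  rewrite EFinM EFin_gmean// ge0_integral_gauss//; last by apply/measurable_EFinP; case: b1.
  rewrite -ge0_integralZl//; last 3 first.
  + apply: emeasurable_funM; first by apply/measurable_EFinP; case: b1.
    by apply/measurable_EFinP; apply: measurable_funM => //; exact: measurable_gw.
  + by move=> x _; rewrite mule_ge0// lee_fin// divr_ge0 ?gw_ge0// ltW.
  + by rewrite lee_fin ltW.
  rewrite -[RHS](@ge0_integral_lebesgue_shift _ _ (- y)); last 2 first.
  + apply: emeasurable_funM => //; apply: emeasurable_funM; first by apply/measurable_EFinP; case: b1.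
    by apply/measurable_EFinP; apply: measurable_funM => //; exact: measurable_gw.
  + move=> x; rewrite -!EFinM lee_fin; apply: mulr_ge0; first exact: ltW.
    by apply: mulr_ge0 => //; apply: divr_ge0; [exact: gw_ge0|exact: ltW].
  apply: eq_integral => t _; rewrite -!EFinM; congr EFin.
  rewrite indicE mem_setE in_itv/= lerD2r /real_spin.
  by field; rewrite gt_eqF.
- move=> y; rewrite mulr1 -(integral_gw beta_gt0).
  rewrite -[RHS](@ge0_integral_lebesgue_shift _ _ (- y))//.
    by apply/measurable_EFinP; exact: measurable_gw.
  by move=> x; rewrite lee_fin gw_ge0.
Qed.

End gibbs_tree.

(** * Quantile functions *)

Section quantile_functions.
Context (R : realType).

Lemma probability_cdf_unique (P1 P2 : probability (measurableTypeR R) R) :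
  (forall u : R, P1 `]-oo, u]%classic = P2 `]-oo, u]%classic) ->
  forall A, measurable A -> P1 A = P2 A.
Proof.
move=> P12 A mA.
have itvE (P : probability (measurableTypeR R) R) (x y : R) : x <= y ->
    P `]x, y]%classic = (P `]-oo, y]%classic - P `]-oo, x]%classic)%E.
  move=> xy; have -> : `]x, y]%classic = `]-oo, y] `\` `]-oo, x] :> set R.
    apply/seteqP; split => z /=; rewrite !in_itv/=.
      by move=> /andP[xz zy]; split => //; apply/negP; rewrite -ltNge.
    by move=> [-> /negP]; rewrite -ltNge => ->.
  rewrite measureD// ?setIidr//; first exact: subset_itvl.
  by rewrite -ge0_fin_numE// fin_num_measure.
rewrite -(lebesgue_stieltjes_cdf_id P1 mA).
apply: lebesgue_stieltjes_measure_unique => // _ [[x y] _ <-] /=.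
rewrite lebesgue_stieltjes_cdf_id//.
have [xy|yx] := leP x y; last by rewrite set_itv_ge ?measure0// bnd_simp -leNgt ltW.
by rewrite [LHS]itvE// [RHS]itvE// !P12.
Qed.

(* The two canonical measurable structures on [R] have the same measurable sets
   but are not unified. *)
Definition to_borel (x : R) : measurableTypeR R := x.
Lemma measurable_to_borel : measurable_fun [set: R] to_borel.
Proof. exact: measurable_id. Qed.
HB.instance Definition _ := isMeasurableFun.Build _ _ _ _ to_borel measurable_to_borel.

Lemma distribution_cdf_unique d1 d2 (T1 : measurableType d1) (T2 : measurableType d2)
    (P1 : probability T1 R) (P2 : probability T2 R)
    (X : {RV P1 >-> R}) (Y : {RV P2 >-> R}) :
  cdf X =1 cdf Y -> forall A : set R, measurable A -> distribution P1 X A = distribution P2 Y A.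
Proof.
move=> XY A mA.
pose X' : {RV P1 >-> measurableTypeR R} := to_borel \o X.
pose Y' : {RV P2 >-> measurableTypeR R} := to_borel \o Y.
exact: (@probability_cdf_unique (distribution P1 X') (distribution P2 Y')).
Qed.
Section quantile.
Context d (T : measurableType d) (P : probability T R) (X : {RV P >-> R}).

Definition quantile (p : R) : R := inf [set u | (p%:E <= cdf X u)%E].

(** The limits of the distribution function at both infinities make the infimum finite, and right
    continuity makes it attained. *)
Lemma quantile_le p u : 0 < p < 1 -> (quantile p <= u) = (p%:E <= cdf X u)%E.
Proof.
move=> /andP[p0 p1]; pose S := [set v | (p%:E <= cdf X v)%E].
have [v Sv] : exists v, S v.
  apply: contrapT => /forallNP nS; suff : (1%:E <= p%:E)%E by rewrite lee_fin leNgt p1.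
  apply: cvge_le (cvg_cdfy1 X); apply: nearW => w.
  by rewrite leNgt; apply/negP => /ltW; exact: nS.
have [l lS] : exists l, ~ S l.
  apply: contrapT => /forallNP nS; suff : (p%:E <= 0%:E)%E by rewrite lee_fin leNgt p0.
  by apply: cvge_ge (cvg_cdfNy0 X); apply: nearW => w; have /contrapT := nS w.
have lbS : has_lbound S.
  exists l => w Sw; rewrite leNgt; apply/negP => wl; apply: lS.
  by apply: (le_trans Sw); apply: cdf_nondecreasing; exact: ltW.
have infS : has_inf S by split => //; exists v.
apply/idP/idP => [qu|pu]; last exact: inf_lbound.
apply: (@le_trans _ _ (cdf X (quantile p))); last exact: cdf_nondecreasing.
have H e : 0 < e -> S (quantile p + e).
  move=> e0; have [w Sw we] := inf_adherent e0 infS.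
  by apply: (le_trans Sw); apply: cdf_nondecreasing; exact: ltW.
apply: cvge_ge (@cdf_right_continuous _ _ _ P X (quantile p)).
near=> w; rewrite -[w](subrK (quantile p)) addrC; apply: H.
by rewrite subr_gt0; near: w; exact: nbhs_right_gt.
Unshelve. all: by end_near. Qed.

(** The value [0] outside []0, 1[] makes the function total; it is common to all variables, so two
    quantile functions agree there. *)
Definition quantile01 (p : measurableTypeR R) : R := if 0 < p < 1 then quantile p else 0.

Lemma measurable_quantile01 : measurable_fun [set: measurableTypeR R] quantile01.
Proof.
apply: measurable_fun_if => //.
  by apply: measurable_and => //; exact: measurable_fun_ltr.
rewrite setTI (_ : _ @^-1` _ = `]0, 1[%classic); last first.
  by apply/seteqP; split => z /=; rewrite in_itv.
apply: (measurability (@RGenOInfty.G R)) => [|/= _ [_] [u] -> <-].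
  exact: RGenOInfty.measurableE.
rewrite (_ : _ `&` _ = `]0, 1[ `&` `]fine (cdf X u), +oo[%classic).
  exact: measurableI.
apply/seteqP; split => p [] /=; rewrite !in_itv/= !andbT => p01 h; split => //.
  by move: h; rewrite ltNge quantile_le// -ltNge -[cdf X u]fineK ?fin_num_measure// lte_fin.
by rewrite ltNge quantile_le// -ltNge -[cdf X u]fineK ?fin_num_measure// lte_fin.
Qed.

HB.instance Definition _ :=
  isMeasurableFun.Build _ _ _ _ quantile01 measurable_quantile01.

Lemma uniform_quantile u :
  uniform_prob (@ltr01 R) [set p | quantile01 p <= u] = cdf X u.
Proof.
set S := [set p | _]; have mS : measurable S.
  rewrite (_ : S = [set: R] `&` quantile01 @^-1` `]-oo, u]); last first.
    by rewrite setTI; apply/seteqP; split => p /=; rewrite in_itv.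
  exact: measurable_quantile01.
have [c cE] : exists c, cdf X u = c%:E.
  by exists (fine (cdf X u)); rewrite fineK// fin_num_measure.
have c01 : 0 <= c <= 1 by rewrite -!lee_fin -cE cdf_ge0 cdf_le1.
pose mu := @lebesgue_measure R; pose V : set R := `[0, c]%classic.
have mI (A : set R) : measurable A -> measurable_fun [set: R] (fun x => (\1_A x : R)%:E).
  by move=> mA; apply/measurable_EFinP; exact: measurable_indic.
have mV : measurable V by exact: measurable_itv.
(* Passing to the open interval leaves aside the endpoints, where [quantile_le] does not apply. *)
have open_itv (A : set R) : measurable A -> (\int[mu]_(x in `[0%R, 1%R]) (\1_A x : R)%:E =
    \int[mu]_(x in `]0%R, 1%R[) (\1_A x : R)%:E)%E.
  move=> mA; rewrite -integral_itv_bndo_bndc; last by apply: measurable_funTS; exact: mI.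
  by rewrite -integral_itv_obnd_cbnd//; apply: measurable_funTS; exact: mI.
transitivity (\int[uniform_prob (@ltr01 R)]_x (\1_S x : R)%:E)%E.
  by rewrite integral_indic// setIT.
rewrite integral_uniform//; last exact: mI.
rewrite subr0 invr1 mul1e open_itv// (_ : (\int[_]_(x in _) _)%E =
    (\int[mu]_(x in `]0%R, 1%R[) (\1_V x : R)%:E)%E); last first.
  apply: eq_integral => p /set_mem; rewrite /= in_itv/= => p01.
  rewrite !indicE; congr ((nat_of_bool _)%:R%:E).
  have pE : (quantile01 p <= u) = (p <= c) by rewrite /quantile01 p01 quantile_le// cE lee_fin.
  apply/idP/idP => /set_mem; rewrite /S /V /= ?in_itv/= => h; apply/mem_set; rewrite /= ?in_itv/=.
    by rewrite -pE h; have /andP[/ltW -> _] := p01.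
  by rewrite pE; have /andP[] := h.
rewrite -open_itv// integral_indic// setIC setIidr; last first.
  by move=> p; rewrite /V /= !in_itv/=; lra.
rewrite /mu /V /= lebesgue_measure_itv/= lte_fin cE; have /andP[+ _] := c01.
by rewrite le_eqVlt => /orP[/eqP<-|->]; rewrite ?ltxx// sube0.
Qed.

End quantile.

End quantile_functions.

(** * Coupling two variables with close distribution functions *)

Section coupling_of_close_cdfs.
Context (R : realType).

Lemma quantile_coupling d1 d2 (T1 : measurableType d1) (T2 : measurableType d2)
    (P1 : probability T1 R) (P2 : probability T2 R)
    (X : {RV P1 >-> R}) (Y : {RV P2 >-> R}) (K : R) :
  (forall u, (cdf Y (u - K)%R <= cdf X u)%E) ->
  (forall u, (cdf X u <= cdf Y (u + K)%R)%E) ->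
  exists Q : probability (R * R)%type R,
    coupling (distribution P1 X) (distribution P2 Y) Q /\
    (Q [set z | (`|z.1 - z.2| <= K)%R] = 1)%E.
Proof.
move=> YX XY.
have Xn p : 0 < p < 1 -> (p%:E <= cdf X (quantile X p))%E.
  by move=> p01; rewrite -quantile_le.
have Yn p : 0 < p < 1 -> (p%:E <= cdf Y (quantile Y p))%E.
  by move=> p01; rewrite -quantile_le.
(* Nonnegativity follows from the two inequalities at the medians; it covers the levels outside []0,
   1[], where both quantiles are [0]. *)
have K0 : 0 <= K.
  have h : 0 < (2^-1 : R) < 1 by lra.
  have h1 : quantile Y 2^-1 <= quantile X 2^-1 + K.
    by rewrite quantile_le//; exact: le_trans (Xn _ h) (XY _).
  have h2 : quantile X 2^-1 <= quantile Y 2^-1 + K.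
    rewrite quantile_le//; apply: le_trans (Yn _ h) _.
    by have := YX (quantile Y 2^-1 + K); rewrite addrK.
  by lra.
pose Z (p : measurableTypeR R) : R * R := (quantile01 X p, quantile01 Y p).
have mZ : measurable_fun [set: measurableTypeR R] Z.
  by apply/measurable_fun_pair; exact: measurable_quantile01.
pose Z' : {mfun measurableTypeR R >-> (R * R)%type} := mfun_Sub (mem_set mZ).
pose U : probability (measurableTypeR R) R := uniform_prob (@ltr01 R).
have marginal d (T : measurableType d) (P : probability T R) (W : {RV P >-> R}) A :
    measurable A -> U (quantile01 W @^-1` A) = distribution P W A.
  move=> mA.
  pose W' : {RV U >-> R} := quantile01 W.
  apply: (@distribution_cdf_unique R _ _ _ _ U P W' W) => // u.
  rewrite -[RHS]uniform_quantile /cdf /distribution /pushforward.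
  congr (U _); by apply/seteqP; split => p /=; rewrite in_itv.
exists (distribution U Z'); split; first by split => A mA; exact: marginal.
transitivity (U [set: R]); last exact: probability_setT.
congr (U _); apply/seteqP; split => // p _ /=; rewrite /Z /quantile01.
case: ifPn => [p01|_]; last by rewrite subrr normr0.
rewrite ler_distl; apply/andP; split.
- rewrite lerBlDr quantile_le//; exact: le_trans (Xn _ p01) (XY _).
- rewrite quantile_le//; apply: le_trans (Yn _ p01) _.
  by have := YX (quantile Y p + K); rewrite addrK.
Qed.

End coupling_of_close_cdfs.

Lemma gff_cdf_continuous (R : realType) b (beta : R) n : 0 < beta ->
  continuous (gff_cdf b beta n).
Proof.
move=> beta0 u; have m0 := gauss_mass_gt0 beta0.
pose L := b%:R ^+ n / gauss_mass beta.
have L0 : 0 <= L by apply: divr_ge0; [exact: exprn_ge0|exact: ltW].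
have L1 : 0 < L + 1 by rewrite ltr_wpDl.
have lip x y : x <= y -> `|gff_cdf b beta n x - gff_cdf b beta n y| <= L * (y - x).
  move=> xy; rewrite distrC ger0_norm; last by rewrite subr_ge0 gff_cdf_mono.
  by have := gff_cdf_lipschitz b beta0 n xy; rewrite /L mulrA mulrAC.
apply/cvgrPdist_le => e e0; near=> v.
have uv : `|u - v| <= e / (L + 1).
  near: v; apply: cvgr_dist_le; first exact: cvg_id.
  by rewrite divr_gt0.
have h : `|gff_cdf b beta n u - gff_cdf b beta n v| <= L * `|u - v|.
  have [uv'|vu] := leP u v.
    by rewrite (distrC u) (ger0_norm (_ : 0 <= v - u)) ?subr_ge0// lip.
  by rewrite distrC (gtr0_norm (_ : 0 < u - v)) ?subr_gt0// lip// ltW.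
apply: (le_trans h); apply: (@le_trans _ _ ((L + 1) * (e / (L + 1)))).
  by apply: ler_pM => //; rewrite lerDl.
by rewrite mulrC divfK// gt_eqF.
Unshelve. all: by end_near. Qed.

Theorem corollary2p2 (R : realType) (b : nat) (b_gt1 : (1 < b)%N) (beta : R)
    (beta_gt0 : 0 < beta) (beta_lt : beta < beta_c R b) :
  (exists a : R, 0 < a /\
    (fun n : nat =>
       ereal_sup [set ereal_inf
         [set `| DG b n beta [set phi | (DG_max n beta b_gt1 phi <= u)%R]
                 - GFF b n beta [set phi | (GFF_max n beta b_gt1 phi <= u + r)%R] |%E
         | r in `[- a, a]]
       | u in [set: R]]) @ \oo --> 0%E) /\
  (exists K : R, 0 < K /\
    exists Q : nat -> probability (R * R)%type R,
      (forall n : nat, (0 < n)%N ->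
         coupling (distribution (DG b n beta) (DG_max n beta b_gt1))
                  (distribution (GFF b n beta) (GFF_max n beta b_gt1)) (Q n)) /\
      (fun n : nat => Q n [set z | `|z.1 - z.2| <= K]) @ \oo --> 1%E).
Proof.
have [K K0 HK] := cdf_sandwich b_gt1 beta_gt0 beta_lt.
(* The constant of the sandwich serves as [a] and as [K]. Both limits are those of constant
   sequences: the infimum is [0] for every [n] and [u], and the coupling succeeds with probability
   [1] for every [n]. *)
split; exists K; split => //.
  rewrite [X in X @ \oo --> _](_ : _ = fun=> 0%E); first exact: cvg_cst.
  apply/funext => n; rewrite [X in ereal_sup X](_ : _ = [set 0%E]); first exact: ereal_sup1.
  have inf0 u : ereal_inf
      [set `| DG b n beta [set phi | (DG_max n beta b_gt1 phi <= u)%R]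
              - GFF b n beta [set phi | (GFF_max n beta b_gt1 phi <= u + r)%R] |%E
      | r in `[- K, K]] = 0%E.
    apply/eqP; rewrite eq_le; apply/andP; split; last first.
      by apply: le_ereal_inf_tmp => _ [r _ <-]; exact: abse_ge0.
    have /andP[l h] := HK n u.
    (* The sandwich places the DG value between the GFF values at [u - K] and [u + K], so continuity
       gives an exact match, and [r = v - u]. *)
    have [v vK vE] : exists2 v, v \in `[u - K, u + K] & gff_cdf b beta n v = dg_cdf b beta n u.
      apply: IVT; first by lra.
        exact/continuous_subspaceT/gff_cdf_continuous.
      by rewrite ge_min le_max l h orbT.
    apply: ereal_inf_lbound; exists (v - u).
      by move: vK; rewrite /= !in_itv/=; lra.
    by rewrite DG_max_le// GFF_max_le// (addrC u) subrK vE subee// abse0.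
  apply/seteqP; split => [_ [u _ <-]|_ ->] /=; first exact: inf0.
  by exists 0 => //; exact: inf0.
have cdfX n u : cdf (DG_max n beta b_gt1) u = (dg_cdf b beta n u)%:E.
  by rewrite -(DG_max_le b_gt1)//; exact: (congr1 (DG b n beta)).
have cdfY n u : cdf (GFF_max n beta b_gt1) u = (gff_cdf b beta n u)%:E.
  by rewrite -(GFF_max_le b_gt1)//; exact: (congr1 (GFF b n beta)).
have /choice[Q HQ] n : exists Q : probability (R * R)%type R,
    coupling (distribution (DG b n beta) (DG_max n beta b_gt1))
             (distribution (GFF b n beta) (GFF_max n beta b_gt1)) Q /\
    (Q [set z | (`|z.1 - z.2| <= K)%R] = 1)%E.
  apply: quantile_coupling => u; rewrite cdfX cdfY lee_fin; have /andP[] := HK n u => //.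
exists Q; split; first by move=> n _; have [] := HQ n.
rewrite [X in X @ \oo --> _](_ : _ = fun=> 1%E); first exact: cvg_cst.
by apply/funext => n; have [] := HQ n.
Qed.
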